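(* Let $K$ be a torus (a compact, connected, abelian Lie group) with Lie algebra $\mathfrak k$, let $M$ be a $K$-manifold, and let $X$ be a $K$-equivariant vector field on $M$ with a relative equilibrium at $m$. Let $d$ be the dimension of the closure of the integral curve of $X$ starting at $m$. Then for every order $j$ with $0\le j\le d$ there exists an infinitesimal gauge transformation $\psi\in C^\infty(M,\mathfrak k)^K$ that stabilizes the frequencies of $X$ at $m$ to order $j$. Furthermore, $\psi$ may be chosen so that $X+\partial(\psi)$ only differs from $X$ in an arbitrarily small neighborhood of the group orbit $K\cdot m$.
   Context: A $K$-manifold is a smooth manifold with a smooth action of $K$. An infinitesimal gauge transformation is a smooth map $\psi:M\to\mathfrak k$ with $\psi(k\cdot p)=\mathrm{Ad}(k)\psi(p)$; their space is $C^\infty(M,\mathfrak k)^K$. It induces the equivariant vector field $\partial(\psi)(p)=\frac{d}{d\tau}|_0\exp(\tau\psi(p))\cdot p$. A point $m$ is a relative equilibrium of an equivariant vector field $X$ if $X(m)\in T_m(K\cdot m)$. For $K$ compact, the closure of the integral curve of $X$ starting at a relative equilibrium is diffeomorphic to a torus (a point being a torus of dimension $0$). $\psi\in C^\infty(M,\mathfrak k)^K$ stabilizes the frequencies of $X$ at $m$ to order $j$ (where $0\le j\le d$) if the torus $\overline{\{\varphi_m(\tau)\mid\tau\in\mathbb R\}}$ has dimension $j$, where $\varphi_m$ is the integral curve of $X+\partial(\psi)$ starting at $m$. *)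

(* Defs.v *)
From HB Require Import structures.
From mathcomp Require Import all_boot all_order all_algebra.
From mathcomp Require Import all_classical all_reals all_analysis.

Set Implicit Arguments.
Unset Strict Implicit.
Unset Printing Implicit Defensive.

Import Order.TTheory GRing.Theory Num.Theory.
Import numFieldNormedType.Exports.

Local Open Scope classical_set_scope.
Local Open Scope ring_scope.

(* For U open and V finite-dimensional this is the usual C^k condition: a
   directional derivative at a point of U only depends on f near that point. *)
Fixpoint Ck_on (R : realType) (V W : normedModType R) (k : nat)
    (U : set V) (f : V -> W) : Prop :=
  if k is k'.+1 then
    (forall x, U x -> differentiable f x) /\
    (forall v, Ck_on k' U (fun x => 'D_v f x))
  else forall x, U x -> {for x, continuous f}.

Definition smooth_on (R : realType) (V W : normedModType R)
    (U : set V) (f : V -> W) : Prop :=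
  forall k, Ck_on k U f.

(* The total functions chart_map and chart_inv are only meaningful on chart_dom
   and chart_cod respectively. *)
Record chart (R : realType) (n : nat) (T : topologicalType) := Chart {
  chart_dom : set T;
  chart_cod : set 'rV[R]_n;
  chart_map : T -> 'rV[R]_n;
  chart_inv : 'rV[R]_n -> T;
  chart_open_dom : open chart_dom;
  chart_open_cod : open chart_cod;
  chart_map_cod : forall p, chart_dom p -> chart_cod (chart_map p);
  chart_inv_dom : forall x, chart_cod x -> chart_dom (chart_inv x);
  chart_mapK : forall p, chart_dom p -> chart_inv (chart_map p) = p;
  chart_invK : forall x, chart_cod x -> chart_map (chart_inv x) = x;
  chart_map_cont : forall p, chart_dom p -> {for p, continuous chart_map};
  chart_inv_cont : forall x, chart_cod x -> {for x, continuous chart_inv}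
}.

Definition compatible (R : realType) (n : nat) (T : topologicalType)
    (a b : chart R n T) : Prop :=
  smooth_on [set x | chart_cod a x /\ chart_dom b (chart_inv a x)]
            (chart_map b \o chart_inv a).

HB.mixin Record isManifold (R : realType) (n : nat) T of Topological T := {
  atlas : set (chart R n T);
  manifold_hausdorff : hausdorff_space T;
  manifold_second_countable : @second_countable T;
  atlas_cover : forall p : T, exists2 c, atlas c & chart_dom c p;
  atlas_compatible : forall a b, atlas a -> atlas b -> compatible a b
}.

#[short(type="manifoldType")]
HB.structure Definition Manifold (R : realType) (n : nat) :=
  {T of Topological T & isManifold R n T}.

Definition smooth_fun (R : realType) (n : nat) (M : manifoldType R n)
    (f : M -> R) : Prop :=
  forall c : chart R n M, atlas c -> smooth_on (chart_cod c) (f \o chart_inv c).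

Definition smooth_from (R : realType) (V : normedModType R)
    (n : nat) (M : manifoldType R n) (f : V -> M) : Prop :=
  continuous f /\
  forall c : chart R n M, atlas c ->
    smooth_on [set x | chart_dom c (f x)] (chart_map c \o f).

Definition smooth_map (R : realType) (n q : nat)
    (M : manifoldType R n) (N : manifoldType R q) (f : M -> N) : Prop :=
  continuous f /\
  forall (a : chart R n M) (b : chart R q N), atlas a -> atlas b ->
    smooth_on [set x | chart_cod a x /\ chart_dom b (f (chart_inv a x))]
              (chart_map b \o f \o chart_inv a).

(* Smoothness on the product manifold M * N, read in the product charts. *)
Definition smooth_map2 (R : realType) (n q r : nat)
    (M : manifoldType R n) (N : manifoldType R q) (P : manifoldType R r)
    (f : M -> N -> P) : Prop :=
  continuous (fun z : M * N => f z.1 z.2) /\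
  forall (a : chart R n M) (b : chart R q N) (c : chart R r P),
    atlas a -> atlas b -> atlas c ->
    let F (z : 'rV[R]_(n + q)) :=
      f (chart_inv a (lsubmx z)) (chart_inv b (rsubmx z)) in
    smooth_on [set z | [/\ chart_cod a (lsubmx z), chart_cod b (rsubmx z)
                         & chart_dom c (F z)]]
              (chart_map c \o F).

(* A tangent vector at p is a derivation at p of the algebra of smooth functions
   on M.  The values of such a functional on non-smooth functions are junk, so
   tangent vectors are compared with tangent_eq rather than with equality. *)
Definition functional (R : realType) (n : nat) (M : manifoldType R n) : Type :=
  (M -> R) -> R.

Definition is_tangent (R : realType) (n : nat) (M : manifoldType R n)
    (p : M) (v : functional M) : Prop :=
  (forall (a : R) (f g : M -> R), smooth_fun f -> smooth_fun g ->
     v (fun x => a * f x + g x) = a * v f + v g) /\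
  (forall f g : M -> R, smooth_fun f -> smooth_fun g ->
     v (fun x => f x * g x) = f p * v g + v f * g p).

Definition tangent_eq (R : realType) (n : nat) (M : manifoldType R n)
    (v w : functional M) : Prop :=
  forall f : M -> R, smooth_fun f -> v f = w f.

Definition vector_field (R : realType) (n : nat) (M : manifoldType R n)
    (X : M -> functional M) : Prop :=
  (forall p, is_tangent p (X p)) /\
  (forall f : M -> R, smooth_fun f -> smooth_fun (fun p => X p f)).

Definition vf_add (R : realType) (n : nat) (M : manifoldType R n)
    (X Y : M -> functional M) : M -> functional M :=
  fun p f => X p f + Y p f.

Definition velocity (R : realType) (n : nat) (M : manifoldType R n)
    (gamma : R -> M) (t : R) (v : functional M) : Prop :=
  forall f : M -> R, smooth_fun f -> is_derive t (1 : R) (f \o gamma) (v f).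

Definition integral_curve (R : realType) (n : nat) (M : manifoldType R n)
    (X : M -> functional M) (m : M) (phi : R -> M) : Prop :=
  phi 0 = m /\ forall t, velocity phi t (X (phi t)).

(* v lies in the tangent space at p of the submanifold S of M. *)
Definition tangent_to (R : realType) (n : nat) (M : manifoldType R n)
    (S : set M) (p : M) (v : functional M) : Prop :=
  exists gamma : R -> M,
    [/\ smooth_from gamma, forall t, S (gamma t), gamma 0 = p
      & velocity gamma 0 v].

(* S is an embedded submanifold diffeomorphic to the torus (R/Z)^j: smooth maps
   on (R/Z)^j are the Z^j-periodic smooth maps on R^j, and an injective
   immersion of the compact manifold (R/Z)^j is an embedding. *)
Definition torus_of_dim (R : realType) (n : nat) (M : manifoldType R n)
    (j : nat) (S : set M) : Prop :=
  exists e : 'rV[R]_j -> M,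
    [/\ smooth_from e,
        forall x y, e x = e y <-> (forall i, x 0 i - y 0 i \is a Num.int),
        forall x v, v != 0 ->
          exists2 f : M -> R, smooth_fun f & 'D_v (f \o e) x != 0
      & range e = S].

HB.mixin Record isLieGroup (R : realType) (l : nat) K
    of Manifold R l K & Group K := {
  mul_smooth : smooth_map2 (fun x y : K => (x * y)%g);
  inv_smooth : smooth_map (fun x : K => x^-1%g)
}.

#[short(type="lieGroupType")]
HB.structure Definition LieGroup (R : realType) (l : nat) :=
  {K of Manifold R l K & Group K & isLieGroup R l K}.

Definition torus_group (R : realType) (l : nat) (K : lieGroupType R l) : Prop :=
  [/\ compact [set: K], connected [set: K]
    & forall x y : K, (x * y)%g = (y * x)%g].

(* The Lie algebra of K is the tangent space at 1, and one_param xi gamma says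
   that gamma is the one-parameter subgroup t |-> exp (t xi). *)
Definition one_param (R : realType) (l : nat) (K : lieGroupType R l)
    (xi : functional K) (gamma : R -> K) : Prop :=
  [/\ smooth_from gamma,
      forall s t, gamma (s + t) = (gamma s * gamma t)%g
    & velocity gamma 0 xi].

Definition lie_exp (R : realType) (l : nat) (K : lieGroupType R l)
    (xi : functional K) : K :=
  xget 1%g [set k | exists2 gamma, one_param xi gamma & gamma 1 = k].

Definition Ad (R : realType) (l : nat) (K : lieGroupType R l)
    (k : K) (xi : functional K) : functional K :=
  fun f => xi (fun x => f (k * x * k^-1)%g).

Definition smooth_action (R : realType) (l n : nat)
    (K : lieGroupType R l) (M : manifoldType R n) (act : K -> M -> M) : Prop :=
  [/\ smooth_map2 act, forall p, act 1%g p = p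
    & forall k h p, act (k * h)%g p = act k (act h p)].

Definition group_orbit (R : realType) (l n : nat)
    (K : lieGroupType R l) (M : manifoldType R n)
    (act : K -> M -> M) (m : M) : set M :=
  range (fun k => act k m).

Definition equivariant (R : realType) (l n : nat)
    (K : lieGroupType R l) (M : manifoldType R n)
    (act : K -> M -> M) (X : M -> functional M) : Prop :=
  forall k p, tangent_eq (X (act k p)) (fun f => X p (f \o act k)).

Definition relative_equilibrium (R : realType) (l n : nat)
    (K : lieGroupType R l) (M : manifoldType R n)
    (act : K -> M -> M) (X : M -> functional M) (m : M) : Prop :=
  tangent_to (group_orbit act m) m (X m).

(* The second clause is smoothness of psi as a map into the Lie algebra: the evaluations at smooth functions on K are exactly the
   linear forms on that finite-dimensional space. *)
Definition gauge (R : realType) (l n : nat)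
    (K : lieGroupType R l) (M : manifoldType R n)
    (act : K -> M -> M) (psi : M -> functional K) : Prop :=
  [/\ forall p, is_tangent (1%g : K) (psi p),
      forall f : K -> R, smooth_fun f -> smooth_fun (fun p => psi p f)
    & forall k p, tangent_eq (psi (act k p)) (Ad k (psi p))].

Definition gauge_field (R : realType) (l n : nat)
    (K : lieGroupType R l) (M : manifoldType R n)
    (act : K -> M -> M) (psi : M -> functional K) : M -> functional M :=
  fun p f =>
    derive1 (fun tau : R => f (act (lie_exp (fun h => tau * psi p h)) p)) 0.

Definition stabilizes (R : realType) (l n : nat)
    (K : lieGroupType R l) (M : manifoldType R n)
    (act : K -> M -> M) (X : M -> functional M) (m : M)
    (psi : M -> functional K) (j : nat) : Prop :=
  exists2 phi : R -> M,
    integral_curve (vf_add X (gauge_field act psi)) m phi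
    & torus_of_dim j (closure (range phi)).

(* Main.v *)
Require Import Defs.
From HB Require Import structures.
From mathcomp Require Import all_boot all_order all_algebra.
From mathcomp Require Import all_classical all_reals all_analysis.
From mathcomp Require Import ring lra.

Set Implicit Arguments.
Unset Strict Implicit.
Unset Printing Implicit Defensive.

Import Order.TTheory GRing.Theory Num.Theory.
Import numFieldNormedType.Exports.

Local Open Scope classical_set_scope.
Local Open Scope ring_scope.

(** Choose a chart E : R^r -> K of the orbit, i.e. a homomorphism such that
    Psi u = E u . m is an immersion onto K.m; its stabilizer Lambda is a lattice
    of R^r.  Since X(m) is tangent to the orbit, it is dPsi(u0) for some u0, and
    by equivariance and uniqueness of integral curves phi(t) = Psi(t u0); the
    closure of phi lies in K.m, so d <= r.  For j <= d let z be a vector whose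
    multiples are dense modulo a primitive sublattice of Lambda of rank j: the
    closure of t |-> Psi(t z) is a j-torus.  The constant gauge transformation
    z - u0 turns phi into this curve, and it may be cut off by a K-invariant
    bump function that is 1 at m and supported near K.m. *)

(** * Differential calculus *)

(** No existence theorem for differential equations is used. The homomorphism from a vector space to
    $K$ comes from compactness and commutativity: in coordinates at the identity the product is a
    sum up to an error $O(|x||y|)$, so iterated squaring of small elements stays controlled, and a
    limit along an ultrafilter is a homomorphism whose smoothness follows from its functional
    equation. A second ultrafilter limit gives an invariant mean, which replaces Haar integration
    when the bump function is averaged. As $K$ is abelian, the adjoint action is trivial, so an
    invariant function times a fixed element of the Lie algebra is a gauge transformation. The
    integral curve of the modified field is written down explicitly; uniqueness of integral curves
    is needed only for $X$. Tangency to the orbit is witnessed by a curve in $M$ with values in a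
    set, without a lift to $K$. The obstacle is that its velocity must be shown to lie in the image
    of $d\Psi$. Compactness of $K$ gives this: points of the orbit close to $m$ have small
    parameters. The same fact, applied to the $d$-torus, yields $d\le r$. *)

Section Differentiability.
Variable R : realType.
Implicit Types V W : normedModType R.

Lemma diff_near V W (f : V -> W) (x : V) : differentiable f x ->
  forall e : R, 0 < e ->
  \forall h \near (0 : V), `|f (h + x) - f x - 'd f x h| <= e * `|h|.
Proof.
move=> /diff_locally fE e e0.
have /eqaddoP := fE => /(_ e e0); apply: filterS => h /=.
by rewrite fctE /= opprD addrA.
Qed.

Lemma near_diff V W (f : V -> W) (x : V) (L : {linear V -> W}) :
  continuous L ->
  (forall e : R, 0 < e ->
    \forall h \near (0 : V), `|f (h + x) - f x - L h| <= e * `|h|) ->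
  differentiable f x /\ 'd f x = L :> (V -> W).
Proof.
move=> cL fL.
have fE : f \o shift x = cst (f x) + L +o_ (0 : V) id.
  apply/eqaddoP => e e0; have := fL e e0; apply: filterS => h /=.
  by rewrite fctE /= opprD addrA.
have dE := diff_unique cL fE.
by split => //; apply/diff_locallyP; rewrite dE.
Qed.

Lemma near_differentiable V W (f g : V -> W) (x : V) :
  (\forall y \near x, f y = g y) -> differentiable f x -> differentiable g x.
Proof.
move=> fg df.
have fgx := nbhs_singleton fg.
have [] := @near_diff _ _ g x ('d f x) _ _ => // [|e e0].
  exact: diff_continuous.
have := diff_near df e0; move: fg; rewrite (near_shift 0) /= => fg.
by apply: filterS2 fg => h /=; rewrite subr0 fgx => ->.
Qed.

Lemma differentiable_rowP V n (f : V -> 'rV[R]_n) (x : V) :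
  differentiable f x <-> forall i, differentiable (fun y => f y 0 i) x.
Proof.
split=> [df i|df].
  have -> : (fun y => f y 0 i) = (fun M : 'rV[R]_n => M 0 i) \o f by [].
  by apply: differentiable_comp => //; exact: differentiable_coord.
have -> : f = \sum_(i < n) (fun y => f y 0 i *: (delta_mx 0 i : 'rV[R]_n)).
  by apply/funext => y; rewrite fct_sumE; exact: row_sum_delta.
by apply: differentiable_sum => i; exact: differentiableZl.
Qed.

Lemma derive_coord V n (f : V -> 'rV[R]_n) (x v : V) i :
  differentiable f x -> ('D_v f x) 0 i = 'D_v (fun y => f y 0 i) x.
Proof.
by move=> df; rewrite derive_mx ?mxE//; exact: diff_derivable.
Qed.

Lemma derive_comp V W (Z : normedModType R) (f : V -> W) (g : W -> Z) (x v : V) :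
  differentiable f x -> differentiable g (f x) ->
  'D_v (g \o f) x = 'D_('D_v f x) g (f x).
Proof.
move=> df dg; rewrite !deriveE//; last exact: differentiable_comp.
by rewrite diff_comp.
Qed.

Lemma deriveDr V W (f : V -> W) (x u v : V) :
  differentiable f x -> 'D_(u + v) f x = 'D_u f x + 'D_v f x.
Proof. by move=> df; rewrite !deriveE// linearD. Qed.

Lemma deriveZr V W (f : V -> W) (x v : V) (a : R) :
  differentiable f x -> 'D_(a *: v) f x = a *: 'D_v f x.
Proof. by move=> df; rewrite !deriveE// linearZ. Qed.

Lemma derive_row_sum n W (f : 'rV[R]_n -> W) (x v : 'rV[R]_n) :
  differentiable f x ->
  'D_v f x = \sum_(i < n) v 0 i *: 'D_(delta_mx 0 i) f x.
Proof.
move=> df; rewrite {1}(row_sum_delta v) deriveE// linear_sum.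
by apply: eq_bigr => i _; rewrite linearZ/= deriveE.
Qed.

Lemma is_derive_near V W (f : V -> W) (x v : V) (l : W) :
  (forall e : R, 0 < e ->
    \forall h \near (0 : R), `|f (h *: v + x) - f x - h *: l| <= e * `|h|) ->
  is_derive x v f l.
Proof.
move=> H.
have fl : h^-1 *: (f (h *: v + x) - f x) @[h --> (0 : R)^'] --> l.
  apply/cvgrPdist_le => e e0; have := H e e0.
  rewrite !near_withinE; apply: filterS => h Hh h0.
  rewrite -(scale1r l) -(mulVf h0) -scalerA -scalerBr normrZ normfV distrC.
  by rewrite ler_pdivrMl ?normr_gt0// mulrC.
by split; [apply/cvg_ex; exists l|exact: cvg_lim fl].
Qed.

Lemma is_derive_near_le V W (f : V -> W) (x v : V) (l : W) :
  is_derive x v f l -> forall e : R, 0 < e ->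
    \forall h \near (0 : R), `|f (h *: v + x) - f x - h *: l| <= e * `|h|.
Proof.
move=> [df <-] e e0; have /cvgrPdist_le/(_ e e0) := df.
rewrite near_withinE; apply: filterS => h Hh.
have [->|h0] := eqVneq h 0.
  by rewrite !scale0r add0r subrr subr0 !normr0 mulr0.
have := Hh h0; rewrite -[X in `|X - _|]scale1r -(mulVf h0) -scalerA -scalerBr.
by rewrite normrZ normfV distrC ler_pdivrMl ?normr_gt0// mulrC.
Qed.

End Differentiability.

(** * Calculus of functions of class $C^k$ *)

Section Ck.
Variable R : realType.
Implicit Types V W : normedModType R.

Lemma Ck_onS V W k (U : set V) (f : V -> W) : Ck_on k.+1 U f ->
  (forall x, U x -> differentiable f x) /\ (forall v, Ck_on k U ('D_v f)).
Proof. by []. Qed.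

Lemma Ck_on_cont V W k (U : set V) (f : V -> W) :
  Ck_on k U f -> forall x, U x -> {for x, continuous f}.
Proof.
case: k => [//|k] /Ck_onS[df _] x Ux; exact: differentiable_continuous (df x Ux).
Qed.

Lemma Ck_onW V W k (U : set V) (f : V -> W) : Ck_on k.+1 U f -> Ck_on k U f.
Proof.
elim: k f => [f H|k IH f /Ck_onS[df Df]]; first exact: (Ck_on_cont H).
by split=> // v; apply: IH; exact: Df.
Qed.

Lemma Ck_on_sub V W k (U U' : set V) (f : V -> W) :
  U `<=` U' -> Ck_on k U' f -> Ck_on k U f.
Proof.
move=> UU'; elim: k f => [f H x /UU'|k IH f /Ck_onS[df Df]]; first exact: H.
by split=> [x /UU'|v]; [exact: df|exact: IH].
Qed.

Lemma Ck_on_eq V W k (U : set V) (f g : V -> W) : open U ->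
  (forall x, U x -> f x = g x) -> Ck_on k U f -> Ck_on k U g.
Proof.
move=> oU; elim: k f g => [f g fg H x Ux|k IH f g fg /Ck_onS[df Df]].
  have nfg : \forall y \near x, f y = g y.
    by apply: filterS (open_nbhs_nbhs (conj oU Ux)) => y; exact: fg.
  have := H x Ux; rewrite /prop_for /continuous_at -(fg x Ux) => fx.
  by apply: cvg_trans fx; exact: near_eq_cvg.
have nfg x : U x -> \forall y \near x, f y = g y.
  by move=> Ux; apply: filterS (open_nbhs_nbhs (conj oU Ux)) => y; exact: fg.
split=> [x Ux|v]; first exact: near_differentiable (nfg x Ux) (df x Ux).
apply: IH (Df v) => x Ux; apply: near_eq_derive; exact: nfg.
Qed.

(** [Ck_on] is a condition at each point separately on a total function, so the sets [N] need be
    neither open nor contained in [U]. *)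
Lemma Ck_on_local V W k (U : set V) (f : V -> W) :
  (forall x, U x -> exists2 N, N x & Ck_on k N f) -> Ck_on k U f.
Proof.
elim: k f => [f H x Ux|k IH f H].
  by have [N Nx] := H x Ux; apply.
split=> [x Ux|v]; first by have [N Nx /Ck_onS[+ _]] := H x Ux; apply.
by apply: IH => x Ux; have [N Nx /Ck_onS[_ Df]] := H x Ux; exists N; last exact: Df.
Qed.

Lemma Ck_on_cst V W k (U : set V) (a : W) : Ck_on k U (fun=> a).
Proof.
elim: k a => [a x _|k IH a]; first exact: cvg_cst.
split=> [x _|v]; first exact: differentiable_cst.
apply: (@eq_ind_r _ (fun=> 0) (Ck_on k U)) => //.
by apply/funext => x; exact: derive_cst.
Qed.

Lemma Ck_on_add V W k (U : set V) (f g : V -> W) : open U ->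
  Ck_on k U f -> Ck_on k U g -> Ck_on k U (fun x => f x + g x).
Proof.
move=> oU; elim: k f g => [f g fU gU x Ux|k IH f g /Ck_onS[df Df] /Ck_onS[dg Dg]].
  by apply: cvgD; [exact: fU|exact: gU].
split=> [x Ux|v]; first exact: differentiableD (df x Ux) (dg x Ux).
apply: Ck_on_eq (IH _ _ (Df v) (Dg v)) => // x Ux.
by rewrite -deriveD//; apply: diff_derivable; [exact: df|exact: dg].
Qed.

Lemma Ck_on_mul V k (U : set V) (f g : V -> R) : open U ->
  Ck_on k U f -> Ck_on k U g -> Ck_on k U (fun x => f x * g x).
Proof.
move=> oU; elim: k f g => [f g fU gU x Ux|k IH f g fC gC].
  by apply: cvgM; [exact: fU|exact: gU].
have /Ck_onS[df Df] := fC; have /Ck_onS[dg Dg] := gC.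
split=> [x Ux|v]; first exact: differentiableM (df x Ux) (dg x Ux).
have fg := Ck_on_add oU (IH _ _ (Ck_onW fC) (Dg v)) (IH _ _ (Ck_onW gC) (Df v)).
apply: Ck_on_eq fg => // x Ux; rewrite -[RHS]/('D_v (f * g) x) deriveM//.
- by apply: diff_derivable; exact: df.
- by apply: diff_derivable; exact: dg.
Qed.

Lemma Ck_on_inv V k (U : set V) (f : V -> R) : open U ->
  (forall x, U x -> f x != 0) ->
  Ck_on k U f -> Ck_on k U (fun x => (f x)^-1).
Proof.
move=> oU f0; elim: k => [fU x Ux|k IH fC].
  by apply: cvgV; [exact: f0|exact: fU].
have /Ck_onS[df Df] := fC.
split=> [x Ux|v]; first exact: differentiableV (df x Ux) (f0 x Ux).
have fV := IH (Ck_onW fC).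
have := Ck_on_mul oU (@Ck_on_cst V R k U (-1))
          (Ck_on_mul oU (Ck_on_mul oU fV fV) (Df v)).
apply: Ck_on_eq => // x Ux.
have := @deriveV R V f x v (f0 x Ux) (diff_derivable (df x Ux)).
by move=> ->; rewrite mulN1r -expr2 exprVn scaleNr.
Qed.

Lemma Ck_on_rowP V n k (U : set V) (f : V -> 'rV[R]_n) : open U ->
  Ck_on k U f <-> forall i, Ck_on k U (fun x => f x 0 i).
Proof.
move=> oU; elim: k f => [f|k IH f].
  split=> [fU i x Ux|fU x Ux].
    apply: (@continuous_comp _ _ _ f (fun M : 'rV[R]_n => M 0 i)).
      exact: fU.
    exact: coord_continuous.
  rewrite /prop_for /continuous_at.
  have -> : f = \sum_(i < n) (fun y => f y 0 i *: (delta_mx 0 i : 'rV[R]_n)).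
    by apply/funext => y; rewrite fct_sumE; exact: row_sum_delta.
  apply: (big_ind (fun g : V -> 'rV[R]_n => {for x, continuous g})).
  - exact: cvg_cst.
  - by move=> g h cg ch; apply: cvgD.
  - by move=> i _; apply: cvgZr_tmp; exact: fU.
split=> [/Ck_onS[df Df] i|H].
  split=> [x Ux|v]; first by move: (df x Ux) => /differentiable_rowP/(_ i).
  have /IH/(_ i) := Df v; apply: Ck_on_eq => // x Ux.
  by rewrite derive_coord//; exact: df.
have df x : U x -> differentiable f x.
  by move=> Ux; apply/differentiable_rowP => i; have /Ck_onS[d _] := H i; exact: d.
split=> // v; apply/IH => i; have /Ck_onS[_ Df] := H i.
by apply: Ck_on_eq (Df v) => // x Ux; rewrite derive_coord//; exact: df.
Qed.

Lemma Ck_on_sum V k n (U : set V) (f : 'I_n -> V -> R) : open U ->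
  (forall i, Ck_on k U (f i)) -> Ck_on k U (fun x => \sum_(i < n) f i x).
Proof.
move=> oU fC; elim: n f fC => [|n IH] f fC.
  apply: Ck_on_eq (@Ck_on_cst V R k U 0) => // x _.
  by rewrite big_ord0.
have := Ck_on_add oU (fC ord0) (IH _ (fun i => fC (lift ord0 i))).
by apply: Ck_on_eq => // x _; rewrite big_ord_recl.
Qed.

(** The chain rule differentiates [g] in the direction ['D_v f x], which varies with [x], whereas
    [Ck_on] only speaks of fixed directions. Expanding along the standard basis turns the derivative
    into a sum of products to which the induction hypothesis applies. *)
Lemma Ck_on_comp V n k (U : set V) (U' : set 'rV[R]_n) (f : V -> 'rV[R]_n)
    (g : 'rV[R]_n -> R) : open U -> (forall x, U x -> U' (f x)) ->
  Ck_on k U f -> Ck_on k U' g -> Ck_on k U (g \o f).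
Proof.
move=> oU fU; elim: k f g fU => [f g fU fC gC x Ux|k IH f g fU fC gC].
  by apply: continuous_comp; [exact: fC|exact/gC/fU].
have /Ck_onS[df Df] := fC; have /Ck_onS[dg Dg] := gC.
split=> [x Ux|v]; first exact: differentiable_comp (df x Ux) (dg _ (fU _ Ux)).
have C i : Ck_on k U (fun x => ('D_v f x) 0 i * 'D_(delta_mx 0 i) g (f x)).
  apply: Ck_on_mul => //; first by apply: (Ck_on_rowP _ _ oU).1; exact: Df.
  by apply: IH fU (Ck_onW fC) (Dg _).
apply: Ck_on_eq (Ck_on_sum oU C) => // x Ux.
have dfx := df x Ux; have dgx := dg _ (fU x Ux).
by rewrite (derive_comp v dfx dgx) (derive_row_sum _ dgx).
Qed.

(** For an affine inner map the direction [L v] is constant, so no coordinates are needed and the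
    spaces may be arbitrary. *)
Lemma Ck_on_precomp V V' W k (U : set V) (L : {linear V' -> V}) (b : V)
    (g : V -> W) : open U -> continuous L ->
  Ck_on k U g -> Ck_on k [set x | U (L x + b)] (fun x => g (L x + b)).
Proof.
move=> oU cL.
have dL x : differentiable (fun y => L y + b) x.
  by apply: differentiableD; [exact: linear_differentiable|
                              exact: differentiable_cst].
have cLb : continuous (fun y => L y + b).
  by move=> x; exact: differentiable_continuous.
have oU' : open [set x | U (L x + b)].
  by move/continuousP : cLb => /(_ _ oU).
elim: k g => [g gC x Ux|k IH g /Ck_onS[dg Dg]].
  by apply: (@continuous_comp _ _ _ (fun y => L y + b) g); [exact: cLb|exact: gC].
split=> [x Ux|v]; first exact: differentiable_comp (dL x) (dg _ Ux).
apply: Ck_on_eq (IH _ (Dg (L v))) => // y Uy.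
have := @derive_comp R _ _ _ (fun y => L y + b) g y v (dL y) (dg _ Uy).
rewrite /comp => ->; congr derive.
have dLy : differentiable L y by exact: linear_differentiable.
have := @deriveD R _ _ L (cst b) y v (diff_derivable dLy) (derivable_cst _ _ _).
by move=> ->; rewrite derive_cst addr0 deriveE// diff_lin.
Qed.

End Ck.

(** * A smooth transition function built from $e^{-1/x}$ *)

Section Flat.
Variable R : realType.
Implicit Types (p : {poly R}) (x y : R).

(* These functions vanish to infinite order at 0 and are closed under
   differentiation; exp (-1/x) is the case p = 1. *)
Definition flat p x : R := if 0 < x then p.[x^-1] * expR (- x^-1) else 0.

(** This is $y/n\le e^{y/n}$ raised to the power $n$. *)
Lemma exprn_expRN_le (n : nat) y : 0 <= y -> y ^+ n * expR (- y) <= n%:R ^+ n.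
Proof.
move=> y0; case: n => [|n]; first by rewrite !expr0 mul1r expR_le1 oppr_le0.
have n0 : 0 < n.+1%:R :> R by rewrite ltr0n.
have : y / n.+1%:R <= expR (y / n.+1%:R).
  by apply: le_trans (expR_ge1Dx _); rewrite lerDr.
have yn : 0 <= y / n.+1%:R by rewrite divr_ge0// ltW.
move=> /(lerXn2r n.+1) H; have {H} := H yn (expR_ge0 _).
rewrite -expRM_natr divfK ?gt_eqF// expRN => H.
rewrite ler_pdivrMr ?expR_gt0//.
by rewrite -ler_pdivrMl ?exprn_gt0// mulrC -expr_div_n.
Qed.

(** Multiplying the polynomial by the variable costs one more power of [y], so [n] stays general in
    the induction; [exprn_expRN_le] covers the constant term. *)
Lemma horner_expRN_le p n :
  exists2 C, 0 <= C & forall y, 0 <= y -> `|p.[y]| * expR (- y) * y ^+ n <= C.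
Proof.
elim/poly_ind: p n => [|p c IH] n.
  by exists 0 => // y _; rewrite horner0 normr0 !mul0r.
have [C C0 HC] := IH n.+1.
exists (C + `|c| * n%:R ^+ n) => [|y y0].
  by rewrite addr_ge0 ?mulr_ge0 ?exprn_ge0.
rewrite hornerMXaddC.
apply: (@le_trans _ _ ((`|p.[y]| * y + `|c|) * expR (- y) * y ^+ n)).
  rewrite !ler_wpM2r ?exprn_ge0 ?expR_ge0//.
  by apply: le_trans (ler_normD _ _) _; rewrite normrM (ger0_norm y0).
have -> : (`|p.[y]| * y + `|c|) * expR (- y) * y ^+ n =
  `|p.[y]| * expR (- y) * y ^+ n.+1 + `|c| * (y ^+ n * expR (- y)).
  by rewrite exprS; ring.
by rewrite lerD ?HC// ler_wpM2l// exprn_expRN_le.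
Qed.

Lemma flat_le p : exists2 C, 0 <= C & forall x, `|flat p x| <= C * x ^+ 2.
Proof.
have [C C0 HC] := horner_expRN_le p 2; exists C => // x.
rewrite /flat; case: ifPn => [x0|_]; last by rewrite normr0 mulr_ge0// sqr_ge0.
have := HC x^-1; rewrite invr_ge0 => /(_ (ltW x0)).
by rewrite exprVn ler_pdivrMr ?exprn_gt0// normrM (ger0_norm (expR_ge0 _)).
Qed.

(** For $x>0$, $(p(1/x)e^{-1/x})' = x^{-2}\,(p-p')(1/x)\,e^{-1/x}$, again of the form [flat]. *)
Definition flatD p : {poly R} := (p - p^`()) * 'X^2.

Lemma is_derive_flat p x : is_derive x (1 : R) (flat p) (flat (flatD p) x).
Proof.
have [x0|x0|->] := ltgtP x 0.
- have E : \forall y \near x, cst 0 y = flat p y.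
    by near=> y; rewrite /flat ltNge ltW//; near: y; exact: lt_nbhsl.
  apply: (near_eq_is_derive E); rewrite [flat (flatD p) x]/flat ltNge ltW//.
  exact: is_derive_cst.
- pose g y := p.[y^-1] * expR (- y^-1).
  have E : \forall y \near x, g y = flat p y.
    near=> y; rewrite /flat ifT//; near: y; exact: lt_nbhsr.
  apply: (near_eq_is_derive E).
  have xN0 : x != 0 by rewrite gt_eqF.
  have dV : is_derive x (1 : R) (fun y : R => y^-1) (- x ^- 2).
    by apply: is_derive_eq (is_deriveV xN0 (is_derive_id _ _)) _; rewrite [LHS]mulr1.
  have dN : is_derive x (1 : R) (fun y : R => - y^-1) (x ^- 2).
    by apply: is_derive_eq (is_deriveN dV) _; rewrite opprK.
  have d1 := is_derive1_comp (is_derive_poly p x^-1) dV.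
  have d2 := @is_derive1_comp R expR (fun y => - y^-1) x _ _ (is_derive_expR (- x^-1)) dN.
  apply: is_derive_eq (is_deriveM d1 d2) _.
  rewrite /flat x0 /flatD hornerM hornerD hornerN hornerXn /= exprVn.
  by rewrite /GRing.scale /=; ring.
- have [C /= C0 HC] := flat_le p.
  have E0 q : flat q 0 = 0 by rewrite /flat ltxx.
  rewrite E0; apply: is_derive_near => e e0; near=> h.
  rewrite addr0 E0 scaler0 !subr0 [h *: _]mulr1; apply: le_trans (HC h) _.
  rewrite -real_normK ?num_real// expr2 mulrA ler_wpM2r//.
  apply: (@le_trans _ _ ((C + 1) * `|h|)); first by rewrite ler_wpM2r// lerDl.
  rewrite -ler_pdivlMl ?ltr_wpDl//; near: h.
  have e1 : 0 < (C + 1)^-1 * e by rewrite mulr_gt0// invr_gt0 ltr_wpDl.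
  by apply/nbhs_ballP; exists ((C + 1)^-1 * e) => //= h; rewrite /ball /= sub0r normrN => /ltW.
Unshelve. all: by end_near. Qed.

Lemma Ck_on_flat p k : Ck_on k [set: R] (flat p).
Proof.
have df q x : differentiable (flat q) x.
  by apply/derivable1_diffP; have [] := is_derive_flat q x.
elim: k p => [|k IH] p; first by move=> x _; exact: differentiable_continuous.
split=> // v; have := Ck_on_mul openT (Ck_on_cst k setT v) (IH (flatD p)).
apply: Ck_on_eq; first exact: openT.
move=> x _ /=; have -> : v = v *: (1 : R) by rewrite /GRing.scale /= mulr1.
by have [_ E] := is_derive_flat p x; rewrite deriveZr// E /GRing.scale /= mulr1.
Qed.

Lemma flat1_gt0 x : 0 < x -> 0 < flat 1 x.
Proof. by move=> x0; rewrite /flat x0 hornerC mul1r expR_gt0. Qed.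

Lemma flat_le0 p x : x <= 0 -> flat p x = 0.
Proof. by move=> x0; rewrite /flat ltNge x0. Qed.

Lemma flat1_ge0 x : 0 <= flat 1 x.
Proof.
by have [x0|/flat1_gt0/ltW//] := leP x 0; rewrite flat_le0.
Qed.

(** The usual smooth transition from 0 to 1 across $[0,1]$. The denominator never vanishes because
    $x$ and $1-x$ are not both nonpositive. *)
Definition step x : R := flat 1 x / (flat 1 x + flat 1 (1 - x)).

Lemma step_den_gt0 x : 0 < flat 1 x + flat 1 (1 - x).
Proof.
have [x0|x0] := leP x 0.
  by rewrite ltr_wpDl ?flat1_ge0// flat1_gt0//; lra.
by rewrite ltr_wpDr ?flat1_ge0// flat1_gt0.
Qed.

Lemma Ck_on_step k : Ck_on k [set: R] step.
Proof.
apply: Ck_on_mul; [exact: openT|exact: Ck_on_flat|].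
apply: Ck_on_inv; [exact: openT| |].
  by move=> x _; rewrite gt_eqF// step_den_gt0.
apply: Ck_on_add; [exact: openT|exact: Ck_on_flat|].
have cN : continuous (-%R : R -> R) by move=> x; exact: opp_continuous.
have := @Ck_on_precomp R R R R k _ (-%R : {linear R -> R}) 1 _ openT cN
  (Ck_on_flat 1 k).
apply: Ck_on_eq; first exact: openT.
by move=> x _; rewrite addrC.
Qed.

Lemma step_le0 x : x <= 0 -> step x = 0.
Proof. by move=> x0; rewrite /step flat_le0// mul0r. Qed.

Lemma step_ge1 x : 1 <= x -> step x = 1.
Proof.
move=> x1; rewrite /step (@flat_le0 1 (1 - x)) ?addr0; last by lra.
by rewrite divff// gt_eqF// flat1_gt0//; lra.
Qed.

Lemma step_ge0 x : 0 <= step x.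
Proof. by rewrite divr_ge0 ?flat1_ge0// ltW// step_den_gt0. Qed.

End Flat.

(** * Sup norm estimates, mean value theorem, Lipschitz bounds *)

Section Estimates.
Variable R : realType.
Implicit Types V W : normedModType R.

Lemma coord_le n (v : 'rV[R]_n) i : `|v 0 i| <= `|v|.
Proof.
rewrite [leRHS]/Num.norm /= mx_normrE.
exact: (le_bigmax _ (fun ij : 'I_1 * 'I_n => `|v ij.1 ij.2|) (0, i)).
Qed.

Lemma row_norm_le n (v : 'rV[R]_n) (C : R) :
  0 <= C -> (forall i, `|v 0 i| <= C) -> `|v| <= C.
Proof.
move=> C0 vC; rewrite [leLHS]/Num.norm /= mx_normrE bigmax_le// => -[i j] _ /=.
by rewrite ord1.
Qed.

Lemma row_norm_lt n (v : 'rV[R]_n) (C : R) :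
  0 < C -> (forall i, `|v 0 i| < C) -> `|v| < C.
Proof.
move=> C0 vC; rewrite [ltLHS]/Num.norm /= mx_normrE bigmax_lt// => -[i j] _ /=.
by rewrite ord1.
Qed.

Lemma ball_normP V (a x : V) (r : R) : ball a r x <-> `|x - a| < r.
Proof. by rewrite -ball_normE /ball_ /= distrC. Qed.

Lemma ball_segment V (a x y : V) (r t : R) : 0 <= t <= 1 ->
  ball a r x -> ball a r y -> ball a r (x + t *: (y - x)).
Proof.
move=> /andP[t0 t1] /ball_normP ax /ball_normP ay; apply/ball_normP.
have -> : x + t *: (y - x) - a = (1 - t) *: (x - a) + t *: (y - a).
  have -> : y - x = (y - a) - (x - a) by rewrite opprB addrA subrK.
  by rewrite addrAC scalerBr scalerBl scale1r addrA [RHS]addrAC.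
apply: le_lt_trans (ler_normD _ _) _; rewrite !normrZ (ger0_norm t0).
rewrite ger0_norm ?subr_ge0//.
have [->|t0'] := eqVneq t 0; first by rewrite mul0r addr0 subr0 mul1r.
have : t * `|y - a| < t * r by rewrite ltr_pM2l// lt0r t0' t0.
have : (1 - t) * `|x - a| <= (1 - t) * r by rewrite ler_wpM2l ?subr_ge0// ltW.
by lra.
Qed.

Lemma ball_MVT V (f : V -> R) (a x y : V) (r : R) :
  (forall z, ball a r z -> differentiable f z) ->
  ball a r x -> ball a r y ->
  exists2 t : R, 0 <= t <= 1 &
    f y - f x = 'D_(y - x) f (x + t *: (y - x)).
Proof.
move=> df ax ay; pose p (t : R) := x + t *: (y - x).
have dp t : is_derive t (1 : R) p (y - x).
  apply: is_derive_near => e e0; near=> h.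
  have -> : p (h%:A + t) - p t - h *: (y - x) = 0.
    by rewrite /p [h *: 1]mulr1 scalerDl addrCA addrK subrr.
  by rewrite normr0 mulr_ge0// ltW.
have dfp (t : R) : 0 <= t <= 1 -> is_derive t (1 : R) (f \o p) ('D_(y - x) f (p t)).
  move=> t01; have dft := df _ (ball_segment t01 ax ay).
  have dpt : differentiable p t.
    by apply/derivable1_diffP; have [] := dp t.
  split; first by apply/diff_derivable/differentiable_comp.
  by rewrite derive_comp//; have [_ ->] := dp t.
have [||t t01 E] := @MVT_segment R (f \o p) (fun t => 'D_(y - x) f (p t)) 0 1 ler01.
- by move=> t; rewrite in_itv /= => /andP[t0 t1]; apply: dfp; rewrite !ltW.
- apply: derivable_within_continuous => t; rewrite in_itv /= => t01.
  by have [] := dfp t t01.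
exists t; first by move: t01; rewrite in_itv.
by move: E; rewrite /= /p scale0r scale1r addr0 subr0 mulr1 [x + (y - x)]addrC subrK.
Unshelve. all: by end_near. Qed.

Lemma ball_lipschitz V (f : V -> R) (a : V) (r C : R) :
  (forall z, ball a r z -> differentiable f z) ->
  (forall z v, ball a r z -> `|'D_v f z| <= C * `|v|) ->
  forall x y, ball a r x -> ball a r y -> `|f y - f x| <= C * `|y - x|.
Proof.
move=> df Df x y ax ay; have [t t01 ->] := ball_MVT df ax ay.
by apply: Df; exact: ball_segment.
Qed.

(** Each partial derivative is continuous at [a], hence near [a] bounded by its absolute value there
    plus 1. In the sup norm the sum of these bounds is a Lipschitz constant, by the mean value
    theorem. *)
Lemma C1_lipschitz n (U : set 'rV[R]_n) (f : 'rV[R]_n -> R) a :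
  open U -> U a -> Ck_on 1 U f ->
  exists2 r : R, 0 < r & exists2 C : R, 0 <= C &
    ball a r `<=` U /\
    (forall x y, ball a r x -> ball a r y -> `|f y - f x| <= C * `|y - x|).
Proof.
move=> oU Ua /Ck_onS[df Df].
pose M i := `|'D_(delta_mx 0 i) f a| + 1.
have nM i : \forall x \near a, `|'D_(delta_mx 0 i) f x| <= M i.
  have := Df (delta_mx 0 i) a Ua.
  move=> /cvgrPdist_le/(_ 1 ltr01); apply: filterS => x Hx.
  rewrite /M -lerBlDl; apply: le_trans Hx.
  by rewrite distrC; exact: lerB_dist.
have nU : \forall x \near a, U x by exact: open_nbhs_nbhs.
have : \forall x \near a, U x /\ forall i, `|'D_(delta_mx 0 i) f x| <= M i.
  apply: filterI => //.
  exact: (@filter_forall _ _ (fun i x => `|'D_(delta_mx 0 i) f x| <= M i)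
            (nbhs a)).
move=> /nbhs_ballP[r /= r0 H]; exists r => //.
exists (\sum_i M i); first by apply: sumr_ge0 => i _; rewrite addr_ge0.
split=> [x /H[]//|]; apply: ball_lipschitz => [z /H[/df]//|z v /H[Uz Mz]].
rewrite (derive_row_sum _ (df _ Uz)); apply: le_trans (ler_norm_sum _ _ _) _.
rewrite mulr_suml; apply: ler_sum => i _; rewrite normrM mulrC.
by rewrite ler_pM// ?coord_le.
Qed.

Lemma C1_lipschitz_row n q (U : set 'rV[R]_n) (f : 'rV[R]_n -> 'rV[R]_q) a :
  open U -> U a -> Ck_on 1 U f ->
  exists2 r : R, 0 < r & exists2 C : R, 0 <= C &
    ball a r `<=` U /\
    (forall x y, ball a r x -> ball a r y -> `|f y - f x| <= C * `|y - x|).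
Proof.
move=> oU Ua /(Ck_on_rowP _ _ oU) fC.
have H i : exists rC : R * R, [/\ 0 < rC.1, 0 <= rC.2, ball a rC.1 `<=` U &
    forall x y, ball a rC.1 x -> ball a rC.1 y ->
      `|f y 0 i - f x 0 i| <= rC.2 * `|y - x|].
  have [r r0 [C C0 [rU HC]]] := C1_lipschitz oU Ua (fC i).
  by exists (r, C).
have {H}[rC H] := choice H.
have : \forall x \near a, U x /\ forall i, ball a (rC i).1 x.
  apply: filterI; first exact: open_nbhs_nbhs.
  apply: (@filter_forall _ _ (fun i x => ball a (rC i).1 x) (nbhs a)) => i.
  by apply: nbhsx_ballx; have [] := H i.
move=> /nbhs_ballP[r /= r0 Hr]; exists r => //.
have S0 : 0 <= \sum_i (rC i).2 by apply: sumr_ge0 => i _; have [] := H i.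
exists (\sum_i (rC i).2) => //; split=> [x /Hr[]//|x y /Hr[_ ax] /Hr[_ ay]].
apply: row_norm_le => [|i]; first by rewrite mulr_ge0.
rewrite !mxE; have [_ _ _ /(_ x y (ax i) (ay i)) Hi] := H i.
apply: le_trans Hi _; rewrite ler_wpM2r// (bigD1 i)//= lerDl.
by apply: sumr_ge0 => j _; have [] := H j.
Qed.

End Estimates.

Lemma open_preim_on (T T' : topologicalType) (U : set T) (O : set T')
    (g : T -> T') : open U -> open O ->
  (forall x, U x -> {for x, continuous g}) -> open [set x | U x /\ O (g x)].
Proof.
move=> oU oO cg; rewrite openE => x [Ux Ox]; apply: filterI.
  exact: open_nbhs_nbhs.
by apply: cg => //; exact: open_nbhs_nbhs.
Qed.

(** * More $C^k$ rules and plateau functions *)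

Section CkMore.
Variable R : realType.
Implicit Types V W : normedModType R.

Lemma Ck_on_comp_row V n q k (U : set V) (U' : set 'rV[R]_n)
    (f : V -> 'rV[R]_n) (g : 'rV[R]_n -> 'rV[R]_q) :
  open U -> open U' -> (forall x, U x -> U' (f x)) ->
  Ck_on k U f -> Ck_on k U' g -> Ck_on k U (g \o f).
Proof.
move=> oU oU' fU fC /(Ck_on_rowP _ _ oU') gC.
by apply/(Ck_on_rowP _ _ oU) => i; exact: (Ck_on_comp oU fU fC (gC i)).
Qed.

Lemma Ck_on_linear V W k (U : set V) (L : {linear V -> W}) :
  continuous L -> Ck_on k U L.
Proof.
move=> cL; case: k => [|k]; first by move=> x _; exact: cL.
split=> [x _|v]; first exact: linear_differentiable.
apply: (@eq_ind_r _ (fun=> L v) (Ck_on k U)); first exact: Ck_on_cst.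
by apply/funext => x; rewrite deriveE ?diff_lin//; exact: linear_differentiable.
Qed.

Lemma Ck_on_coord n k (U : set 'rV[R]_n) i : Ck_on k U (fun x => x 0 i).
Proof.
elim: k => [|k IH]; first by move=> x _; exact: coord_continuous.
split=> [x _|v]; first exact: differentiable_coord.
apply: (@eq_ind_r _ (fun=> v 0 i) (Ck_on k U)); first exact: Ck_on_cst.
apply/funext => x; have did : differentiable (@id 'rV[R]_n) x by exact: ex_diff.
by rewrite -(derive_coord v i did) derive_id.
Qed.

(** [Ck_on_comp] wants row vectors in the middle, so the scalar variable is read as the trace of a
    row of length 1. *)
Lemma Ck_on_compR V k (U : set V) (f : V -> R) (g : R -> R) : open U ->
  Ck_on k U f -> Ck_on k setT g -> Ck_on k U (g \o f).
Proof.
move=> oU fC gC.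
have ctr : continuous (@mxtrace R 1 : 'rV[R]_1 -> R).
  rewrite (_ : mxtrace = fun A : 'rV[R]_1 => A 0 0).
    exact: coord_continuous.
  by apply/funext => A; rewrite /mxtrace big_ord_recl big_ord0 addr0.
have := @Ck_on_precomp R _ _ _ k _ (@mxtrace R 1 : {linear 'rV[R]_1 -> R}) 0 g
  openT ctr gC.
set g' := (X in Ck_on k _ X) => g'C.
have rC : Ck_on k U (fun x => const_mx (f x) : 'rV[R]_1).
  apply/(Ck_on_rowP _ _ oU) => i.
  by apply: Ck_on_eq fC => // x _; rewrite mxE.
apply: Ck_on_eq (Ck_on_comp oU _ rC g'C) => // x _.
by rewrite /g' /= addr0 /mxtrace big_ord_recl big_ord0 addr0 mxE.
Qed.

Lemma Ck_on_prod V k n (U : set V) (f : 'I_n -> V -> R) : open U ->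
  (forall i, Ck_on k U (f i)) -> Ck_on k U (fun x => \prod_(i < n) f i x).
Proof.
move=> oU fC; elim: n f fC => [|n IH] f fC.
  apply: Ck_on_eq (@Ck_on_cst R V R k U 1) => // x _.
  by rewrite big_ord0.
have := Ck_on_mul oU (fC ord0) (IH _ (fun i => fC (lift ord0 i))).
by apply: Ck_on_eq => // x _; rewrite big_ord_recl.
Qed.

Lemma Ck_on_row_mx V n q k (U : set V) (f : V -> 'rV[R]_n) (g : V -> 'rV[R]_q) :
  open U -> Ck_on k U f -> Ck_on k U g ->
  Ck_on k U (fun x => row_mx (f x) (g x)).
Proof.
move=> oU /(Ck_on_rowP _ _ oU) fC /(Ck_on_rowP _ _ oU) gC.
apply/(Ck_on_rowP _ _ oU) => i.
case: (split_ordP i) => j ->.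
  by apply: Ck_on_eq (fC j) => // x _; rewrite row_mxEl.
by apply: Ck_on_eq (gC j) => // x _; rewrite row_mxEr.
Qed.

(** With $t=(x_i-a_i)/r$, the argument $2-2t^2$ is at least 1 for $|t|\le 1/2$ and at most 0 for
    $|t|\ge 1$, and it is smooth, unlike $|t|$. A product over the coordinates fits the sup norm,
    whose balls are cubes. *)
Definition plateau n (a : 'rV[R]_n) (r : R) (x : 'rV[R]_n) : R :=
  \prod_(i < n) step (2 - 2 * ((x 0 i - a 0 i) / r) ^+ 2).

Lemma Ck_on_plateau n (a : 'rV[R]_n) r k : Ck_on k setT (plateau a r).
Proof.
apply: Ck_on_prod => [|i]; first exact: openT.
apply: (@Ck_on_compR _ k setT _ (@step R)); [exact: openT| |exact: Ck_on_step].
have C0 : Ck_on k setT (fun x : 'rV[R]_n => (x 0 i + - a 0 i) * r^-1).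
  apply: Ck_on_mul; [exact: openT| |exact: Ck_on_cst].
  by apply: Ck_on_add; [exact: openT|exact: Ck_on_coord|exact: Ck_on_cst].
have := Ck_on_add openT (@Ck_on_cst R _ _ k setT (2 : R))
  (Ck_on_mul openT (@Ck_on_cst R _ _ k setT (- 2 : R)) (Ck_on_mul openT C0 C0)).
by apply: Ck_on_eq => [|x _]; [exact: openT|rewrite expr2 mulNr].
Qed.

Lemma plateau_eq1 n (a x : 'rV[R]_n) r :
  0 < r -> ball a (r / 2) x -> plateau a r x = 1.
Proof.
move=> r0 /ball_normP ax; apply: big1 => i _; apply: step_ge1.
have : `|x 0 i - a 0 i| < r / 2.
  by apply: le_lt_trans ax; have := coord_le (x - a) i; rewrite !mxE.
set t := _ - _ => tr.
have : `|t / r| ^+ 2 <= (1 / 2) ^+ 2.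
  rewrite lerXn2r// ?nnegrE ?divr_ge0// normrM normfV (gtr0_norm r0).
  by rewrite ler_pdivrMr// mul1r mulrC ltW.
by rewrite real_normK ?num_real//; lra.
Qed.

Lemma plateau_eq0 n (a x : 'rV[R]_n) r :
  0 < r -> ~ ball a r x -> plateau a r x = 0.
Proof.
move=> r0 ax.
have [i] : exists i, r <= `|x 0 i - a 0 i|.
  apply: contra_notP ax => /forallNP H; apply/ball_normP/row_norm_lt => // i.
  by rewrite !mxE ltNge; apply/negP; exact: H.
set t := _ - _ => rt; rewrite /plateau (bigD1 i)//= step_le0 ?mul0r//.
rewrite -/t.
have : 1 ^+ 2 <= `|t / r| ^+ 2.
  rewrite lerXn2r// ?nnegrE// normrM normfV (gtr0_norm r0).
  by rewrite ler_pdivlMr// mul1r.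
by rewrite real_normK ?num_real//; lra.
Qed.

Lemma plateau_ge0 n (a x : 'rV[R]_n) r : 0 <= plateau a r x.
Proof. by apply: prodr_ge0 => i _; exact: step_ge0. Qed.

Lemma closed_ball_rV_compact n (a : 'rV[R]_n) (r : R) : 0 < r ->
  compact (closed_ball a r).
Proof.
move=> r0; apply: bounded_closed_compact; last exact: closed_ball_closed.
exists (`|a| + r); split; first exact: num_real.
move=> y ry x; rewrite closed_ballE// /closed_ball_ /= => xr.
apply: le_trans (ltW ry); rewrite -lerBlDl; apply: le_trans xr.
by rewrite distrC; exact: lerB_dist.
Qed.

End CkMore.

(** * Smooth maps between manifolds *)

Section SmoothInto.
Variables (R : realType).
Implicit Types (V : normedModType R) (n : nat).

(** A version of [smooth_from] relative to a set: chart inverses are meaningful only on [chart_cod],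
    and this lets them be composed with global maps. *)
Definition smooth_into V n (M : manifoldType R n) (U : set V) (g : V -> M) :=
  (forall x, U x -> {for x, continuous g}) /\
  forall c : chart R n M, atlas c ->
    smooth_on [set x | U x /\ chart_dom c (g x)] (chart_map c \o g).

Lemma smooth_into_open V n (M : manifoldType R n) (U : set V) (g : V -> M)
    (O : set M) : open U -> open O -> smooth_into U g ->
  open [set x | U x /\ O (g x)].
Proof. by move=> oU oO [cg _]; exact: open_preim_on. Qed.

Lemma smooth_into_setT V n (M : manifoldType R n) (g : V -> M) :
  smooth_from g <-> smooth_into setT g.
Proof.
split=> [[cg sg]|[cg sg]]; split.
- by move=> x _; exact: cg.
- by move=> c Ac k; apply: Ck_on_sub (sg c Ac k) => x [].
- by move=> x; exact: cg.
- by move=> c Ac k; apply: Ck_on_sub (sg c Ac k).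
Qed.

Lemma smooth_into_sub V n (M : manifoldType R n) (U U' : set V) (g : V -> M) :
  U `<=` U' -> smooth_into U' g -> smooth_into U g.
Proof.
move=> UU' [cg sg]; split=> [x /UU'|c Ac k]; first exact: cg.
by apply: Ck_on_sub (sg c Ac k) => x [/UU'].
Qed.

Lemma smooth_into_local V n (M : manifoldType R n) (U : set V) (g : V -> M) :
  (forall x, U x -> exists2 N, open N /\ N x & smooth_into N g) ->
  smooth_into U g.
Proof.
move=> H; split=> [x Ux|c Ac k].
  by have [N [_ Nx] [cg _]] := H x Ux; exact: cg.
apply: Ck_on_local => x [Ux cx]; have [N [oN Nx] [cg sg]] := H x Ux.
by exists [set x | N x /\ chart_dom c (g x)] => //; exact: sg.
Qed.

Lemma smooth_into_eq V n (M : manifoldType R n) (U : set V) (g h : V -> M) :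
  open U -> (forall x, U x -> g x = h x) -> smooth_into U g -> smooth_into U h.
Proof.
move=> oU gh sgU; have [cg sg] := sgU; split=> [x Ux|c Ac k].
  have := cg x Ux; rewrite /prop_for /continuous_at -(gh x Ux).
  apply: cvg_trans; apply: near_eq_cvg.
  by apply: filterS (open_nbhs_nbhs (conj oU Ux)) => y /gh.
apply: (@Ck_on_sub _ _ _ _ _ [set x | U x /\ chart_dom c (g x)]).
  by move=> x [Ux]; rewrite /= gh.
apply: Ck_on_eq (sg c Ac k) => [|x [Ux _] /=]; last by rewrite gh.
by apply: smooth_into_open => //; exact: chart_open_dom.
Qed.

Lemma smooth_into_cst V n (M : manifoldType R n) (U : set V) (p : M) :
  smooth_into U (fun=> p).
Proof.
split=> [x _|c _ k]; first exact: cvg_cst.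
by rewrite /comp; exact: Ck_on_cst.
Qed.

Lemma chart_inv_smooth n (M : manifoldType R n) (c : chart R n M) :
  atlas c -> smooth_into (chart_cod c) (chart_inv c).
Proof.
move=> Ac; split=> [x|c' Ac' k]; first exact: chart_inv_cont.
exact: atlas_compatible.
Qed.

Lemma smooth_into_precomp V q n (M : manifoldType R n) (U : set V)
    (U' : set 'rV[R]_q) (h : V -> 'rV[R]_q) (g : 'rV[R]_q -> M) :
  open U -> open U' -> (forall x, U x -> U' (h x)) ->
  smooth_on U h -> smooth_into U' g -> smooth_into U (g \o h).
Proof.
move=> oU oU' hU sh sgU; have [cg sg] := sgU; split=> [x Ux|c Ac k].
  by apply: continuous_comp; [exact: (sh 0%N)|apply: cg; exact: hU].
have O1 : open [set x | U' x /\ chart_dom c (g x)].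
  by apply: smooth_into_open => //; exact: chart_open_dom.
have O2 : open [set x | U x /\ chart_dom c (g (h x))].
  have := open_preim_on oU O1 (sh 0%N); congr open.
  by apply/seteqP; split=> x /= [Ux]; [case=> //|split=> //; split=> //; exact: hU].
rewrite compA; apply: (Ck_on_comp_row O2 O1 _ _ (sg c Ac k)).
  by move=> x [Ux cx]; split=> //; exact: hU.
by apply: Ck_on_sub (sh k) => x [].
Qed.

Lemma smooth_into_fun V n (M : manifoldType R n) (U : set V) (g : V -> M)
    (f : M -> R) : open U -> smooth_into U g -> smooth_fun f ->
  smooth_on U (f \o g).
Proof.
move=> oU sgU sf k; have [cg sg] := sgU; apply: Ck_on_local => x Ux.
have [c Ac cx] := atlas_cover (g x).
exists [set x | U x /\ chart_dom c (g x)] => //.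
have oN : open [set x | U x /\ chart_dom c (g x)].
  by apply: smooth_into_open => //; exact: chart_open_dom.
apply: Ck_on_eq (Ck_on_comp oN _ (sg c Ac k) (sf c Ac k)) => //.
  by move=> y [_ cy] /=; rewrite chart_mapK.
by move=> y [_ cy]; exact: chart_map_cod.
Qed.

(** Near each point both maps land in chart domains and the composite factors through the product
    chart, fed with the [row_mx] of the two coordinate expressions; [Ck_on_local] glues these local
    statements. *)
Lemma smooth_into_bin V n q s (M : manifoldType R n) (N : manifoldType R q)
    (P : manifoldType R s) (f : M -> N -> P) (U : set V) (g : V -> M)
    (h : V -> N) : open U -> smooth_map2 f ->
  smooth_into U g -> smooth_into U h -> smooth_into U (fun x => f (g x) (h x)).
Proof.
move=> oU [cf sf] sgU shU; have [cg sg] := sgU; have [ch sh] := shU.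
have cfgh x : U x -> {for x, continuous (fun x => f (g x) (h x))}.
  move=> Ux; apply: (@continuous_comp _ _ _ (fun x => (g x, h x))
                       (fun z : M * N => f z.1 z.2)); last exact: cf.
  by apply: cvg_pair; [exact: cg|exact: ch].
split=> // c Ac k; apply: Ck_on_local => x [Ux cx].
have [a Aa ax] := atlas_cover (g x); have [b Ab bx] := atlas_cover (h x).
pose W := [set x | [/\ U x, chart_dom a (g x), chart_dom b (h x) &
                     chart_dom c (f (g x) (h x))]].
have oW : open W.
  have O1 : open [set x | U x /\ chart_dom a (g x)].
    by apply: smooth_into_open => //; exact: chart_open_dom.
  have O2 : open [set x | U x /\ chart_dom b (h x)].
    by apply: smooth_into_open => //; exact: chart_open_dom.
  have O3 : open [set x | U x /\ chart_dom c (f (g x) (h x))].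
    by apply: open_preim_on => //; exact: chart_open_dom.
  have := openI O1 (openI O2 O3); congr open; apply/seteqP; split=> y /=.
    by move=> [[? ?] [[? ?] [? ?]]].
  by move=> [].
exists W => //.
have rC : Ck_on k W (fun x => row_mx (chart_map a (g x)) (chart_map b (h x))).
  apply: Ck_on_row_mx => //.
    by apply: Ck_on_sub (sg a Aa k) => y [].
  by apply: Ck_on_sub (sh b Ab k) => y [].
have := sf a b c Aa Ab Ac k => sfk.
have cF : forall z : 'rV_(n + q), chart_cod a (lsubmx z) /\ chart_cod b (rsubmx z) ->
  {for z, continuous (fun z => f (chart_inv a (lsubmx z)) (chart_inv b (rsubmx z)))}.
  move=> z [az bz].
  have ca : {for z, continuous (chart_inv a \o @lsubmx R 1 n q)}.
    apply: continuous_comp; last exact: chart_inv_cont.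
    by apply: differentiable_continuous; exact: differentiable_lsubmx.
  have cb : {for z, continuous (chart_inv b \o @rsubmx R 1 n q)}.
    apply: continuous_comp; last exact: chart_inv_cont.
    by apply: differentiable_continuous; exact: differentiable_rsubmx.
  apply: (@continuous_comp _ _ _
    (fun z : 'rV_(n + q) => (chart_inv a (lsubmx z), chart_inv b (rsubmx z)))
    (fun z : M * N => f z.1 z.2)); last exact: cf.
  exact: (cvg_pair ca cb).
have oL : open [set z : 'rV[R]_(n + q) | chart_cod a (lsubmx z)].
  have : continuous (@lsubmx R 1 n q).
    by move=> z; apply: differentiable_continuous; exact: differentiable_lsubmx.
  by move=> /continuousP; apply; exact: chart_open_cod.
have oR : open [set z : 'rV[R]_(n + q) | chart_cod b (rsubmx z)].
  have : continuous (@rsubmx R 1 n q).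
    by move=> z; apply: differentiable_continuous; exact: differentiable_rsubmx.
  by move=> /continuousP; apply; exact: chart_open_cod.
have oF := open_preim_on (openI oL oR) (chart_open_dom c) cF.
have {}sfk : Ck_on k ([set z | (chart_cod a (lsubmx z) /\ chart_cod b (rsubmx z)) /\
    chart_dom c (f (chart_inv a (lsubmx z)) (chart_inv b (rsubmx z)))])
    (chart_map c \o (fun z : 'rV_(n + q) =>
       f (chart_inv a (lsubmx z)) (chart_inv b (rsubmx z)))).
  by apply: Ck_on_sub sfk => z /= [[? ?] ?].
apply: Ck_on_eq (Ck_on_comp_row oW oF _ rC sfk) => //.
  by move=> y [Uy ay b_y _] /=; rewrite row_mxKl row_mxKr !chart_mapK.
move=> y [Uy ay b_y cy] /=; rewrite row_mxKl row_mxKr !chart_mapK//.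
by split=> //; split; exact: chart_map_cod.
Qed.

Lemma smooth_into_map V n q (M : manifoldType R n) (N : manifoldType R q)
    (f : M -> N) (U : set V) (g : V -> M) : open U -> smooth_map f ->
  smooth_into U g -> smooth_into U (f \o g).
Proof.
move=> oU [cf sf] sgU; have [cg sg] := sgU.
have cfg x : U x -> {for x, continuous (f \o g)}.
  by move=> Ux; apply: continuous_comp; [exact: cg|exact: cf].
split=> // c Ac k; apply: Ck_on_local => x [Ux cx].
have [a Aa ax] := atlas_cover (g x).
pose W := [set x | U x /\ chart_dom a (g x)] `&`
          [set x | U x /\ chart_dom c (f (g x))].
have oW : open W.
  apply: openI; first by apply: smooth_into_open => //; exact: chart_open_dom.
  by apply: (open_preim_on oU _ cfg); exact: chart_open_dom.
exists W; first by [].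
have oF : open [set y | chart_cod a y /\ chart_dom c (f (chart_inv a y))].
  apply: (@open_preim_on _ _ _ _ (f \o chart_inv a));
    [exact: chart_open_cod|exact: chart_open_dom|].
  move=> y ay; apply: continuous_comp; last exact: cf.
  exact: chart_inv_cont.
have aC : Ck_on k W (chart_map a \o g).
  by apply: Ck_on_sub (sg a Aa k) => y [].
apply: Ck_on_eq (Ck_on_comp_row oW oF _ aC (sf a c Aa Ac k)) => //.
  by move=> y [[Uy ay] _] /=; rewrite chart_mapK.
move=> y [[Uy ay] [_ cy]] /=; rewrite chart_mapK//; split=> //.
exact: chart_map_cod.
Qed.

Lemma smooth_fun_continuous n (M : manifoldType R n) (f : M -> R) :
  smooth_fun f -> continuous f.
Proof.
move=> sf p; have [c Ac cp] := atlas_cover p.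
have E : \forall q \near p, (f \o chart_inv c) (chart_map c q) = f q.
  apply: filterS (open_nbhs_nbhs (conj (chart_open_dom c) cp)) => q cq /=.
  by rewrite chart_mapK.
rewrite /continuous_at -(nbhs_singleton E).
apply: cvg_trans (near_eq_cvg E) _.
apply: (@continuous_comp _ _ _ (chart_map c) (f \o chart_inv c)).
  exact: chart_map_cont.
by apply: (sf c Ac 0%N); exact: chart_map_cod.
Qed.

Lemma smooth_fun_comp n q (M : manifoldType R n) (N : manifoldType R q)
    (f : N -> R) (h : M -> N) : smooth_fun f ->
  (forall c, atlas c -> smooth_into (chart_cod c) (h \o chart_inv c)) ->
  smooth_fun (f \o h).
Proof.
move=> sf sh c Ac; apply: smooth_into_fun (sh c Ac) sf.
exact: chart_open_cod.
Qed.

Lemma smooth_fun_cst n (M : manifoldType R n) (a : R) :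
  smooth_fun (fun _ : M => a).
Proof. by move=> c _ k; exact: Ck_on_cst. Qed.

Lemma smooth_fun_mul n (M : manifoldType R n) (f g : M -> R) :
  smooth_fun f -> smooth_fun g -> smooth_fun (fun x => f x * g x).
Proof.
by move=> sf sg c Ac k; apply: Ck_on_mul (sf c Ac k) (sg c Ac k);
  exact: chart_open_cod.
Qed.

(** [g] is multiplied by a plateau supported in a closed ball of the chart and extended by 0.
    Smoothness outside the chart domain rests on the Hausdorff property: the image [Kc] of the
    closed ball is compact, hence closed, and the extension vanishes on its open complement. *)
Lemma smooth_extension n (M : manifoldType R n) (c : chart R n M) (p : M)
    (O : set M) (g : 'rV[R]_n -> R) : atlas c -> chart_dom c p ->
  open O -> O p -> smooth_on (chart_cod c) g ->
  exists f : M -> R, [/\ smooth_fun f,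
    forall q, ~ O q -> f q = 0,
    \forall q \near p, chart_dom c q /\ f q = g (chart_map c q) &
    (forall x, 0 <= g x) -> forall q, 0 <= f q].
Proof.
move=> Ac cp oO Op sg; set a := chart_map c p.
have ca : chart_cod c a by exact: chart_map_cod.
have oN : open [set x | chart_cod c x /\ O (chart_inv c x)].
  apply: smooth_into_open => //; first exact: chart_open_cod.
  exact: chart_inv_smooth.
have Na : [set x | chart_cod c x /\ O (chart_inv c x)] a.
  by split=> //; rewrite chart_mapK.
have /nbhs_closedballP[rr] := open_nbhs_nbhs (conj oN Na).
have : 0 < rr%:num by []; move: (rr%:num) => r r0 {rr} Hr.
pose f q := if `[< chart_dom c q >] then
  plateau a r (chart_map c q) * g (chart_map c q) else 0.
have f0 q : ~ O q -> f q = 0.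
  move=> Oq; rewrite /f; case: asboolP => // cq.
  rewrite plateau_eq0 ?mul0r// => aq; apply: Oq.
  have := Hr _ (subset_closed_ball aq).
  by rewrite /= chart_mapK// => -[].
exists f; split=> //; last first.
- move=> g0 q; rewrite /f; case: asboolP => // _.
  by rewrite mulr_ge0// plateau_ge0.
- have nb : nbhs p (chart_map c @^-1` ball a (r / 2)).
    by apply: (chart_map_cont cp); apply: nbhsx_ballx; rewrite divr_gt0.
  apply: filterS2 (open_nbhs_nbhs (conj (chart_open_dom c) cp)) nb => q cq aq.
  by split=> //; rewrite /f asboolT// plateau_eq1// mul1r.
pose Kc := chart_inv c @` closed_ball a r.
have cK : closed Kc.
  apply: compact_closed; first exact: (@manifold_hausdorff R n M).
  apply: continuous_compact; last exact: closed_ball_rV_compact.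
  apply: continuous_in_subspaceT => x; rewrite inE => /Hr[cx _].
  exact: chart_inv_cont.
move=> c' Ac' k; apply: Ck_on_local => x c'x.
have [cq|ncq] := pselect (chart_dom c (chart_inv c' x)).
  exists [set y | chart_cod c' y /\ chart_dom c (chart_inv c' y)] => //.
  have oW : open [set y | chart_cod c' y /\ chart_dom c (chart_inv c' y)].
    apply: smooth_into_open; [exact: chart_open_cod|exact: chart_open_dom|].
    exact: chart_inv_smooth.
  have bgC : Ck_on k (chart_cod c) (fun y => plateau a r y * g y).
    apply: Ck_on_mul (sg k); first exact: chart_open_cod.
    by apply: Ck_on_sub (Ck_on_plateau _ _ _).
  have cc' := atlas_compatible c' c Ac' Ac k.
  apply: Ck_on_eq (Ck_on_comp oW _ cc' bgC) => //.
    by move=> y [_ cy]; rewrite /= /f asboolT.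
  by move=> y [_ cy]; exact: chart_map_cod.
exists [set y | chart_cod c' y /\ (~` Kc) (chart_inv c' y)].
  split=> //= -[y ay yx]; apply: ncq; rewrite -yx.
  by apply: chart_inv_dom; have [] := Hr y ay.
apply: Ck_on_eq (@Ck_on_cst R _ R k _ 0) => [|y [c'y Ky]].
  apply: smooth_into_open; [exact: chart_open_cod|exact: closed_openC|].
  exact: chart_inv_smooth.
rewrite /= /f; case: asboolP => // cy.
rewrite plateau_eq0 ?mul0r// => ay; apply: Ky.
exists (chart_map c (chart_inv c' y)); last by rewrite chart_mapK.
exact: subset_closed_ball.
Qed.

Lemma bump_exists n (M : manifoldType R n) (p : M) (O : set M) :
  open O -> O p -> exists f : M -> R, [/\ smooth_fun f,
    forall q, ~ O q -> f q = 0, f p = 1 & forall q, 0 <= f q].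
Proof.
move=> oO Op; have [c Ac cp] := atlas_cover p.
have sg : smooth_on (chart_cod c) (fun=> 1 : R).
  by move=> k; exact: Ck_on_cst.
have [f [sf f0 fp fge0]] := smooth_extension Ac cp oO Op sg.
exists f; split=> //; last exact: fge0.
by have [] := nbhs_singleton fp.
Qed.

(** Tangent vectors and velocities only act on functions smooth on all of [M], so the coordinates of
    a chart are replaced by global functions with the same values near [p]. *)
Lemma chart_coordinates n (M : manifoldType R n) (c : chart R n M) (p : M) :
  atlas c -> chart_dom c p ->
  exists F : 'I_n -> M -> R, (forall i, smooth_fun (F i)) /\
    \forall q \near p, chart_dom c q /\ forall i, F i q = chart_map c q 0 i.
Proof.
move=> Ac cp.
have H i : exists f : M -> R, smooth_fun f /\
    \forall q \near p, chart_dom c q /\ f q = chart_map c q 0 i.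
  have sg : smooth_on (chart_cod c) (fun x => x 0 i).
    by move=> k; exact: Ck_on_coord.
  by have [f [sf _ fp _]] := smooth_extension Ac cp openT I sg; exists f.
have [F HF] := choice H; exists F; split=> [i|]; first by have [] := HF i.
have cn := open_nbhs_nbhs (conj (chart_open_dom c) cp).
apply: filterI => //.
apply: (@filter_forall _ _ (fun i q => F i q = chart_map c q 0 i) (nbhs p)) => i.
by have [_] := HF i; apply: filterS => q [].
Qed.

Lemma smooth_fun_separates n (M : manifoldType R n) (p q : M) :
  (forall f : M -> R, smooth_fun f -> f p = f q) -> p = q.
Proof.
move=> H; apply: contrapT => pq.
have hM := @manifold_hausdorff R n M.
have := hM; rewrite open_hausdorff => /(_ p q) [].
  by apply/eqP.
move=> [A B] /= [pA qB] [oA oB AB].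
move: pA qB; rewrite !inE => pA qB.
have [f [sf f0 fp _]] := bump_exists oA pA.
have := H f sf; rewrite fp f0; first by move/eqP; rewrite oner_eq0.
by move=> Aq; have : (A `&` B) q by []; move/eqP: AB => ->.
Qed.

(** Given a neighbourhood [B] of [g x], take a bump with value 1 at [g x] that vanishes off [B]: as
    soon as its value at [g t] differs from 1 by less than 1, [g t] is in [B]. A curve with
    velocities is thereby continuous. *)
Lemma smooth_continuous n (M : manifoldType R n) (T : topologicalType)
    (x : T) (g : T -> M) :
  (forall f : M -> R, smooth_fun f -> {for x, continuous (f \o g)}) ->
  {for x, continuous g}.
Proof.
move=> H A; rewrite nbhsE => -[B [oB Bx] BA].
have [f [sf f0 fp _]] := bump_exists oB Bx.
have /cvgrPdist_lt/(_ 1 ltr01) := H f sf.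
apply: filterS => t /=; rewrite fp => H1; apply: BA.
apply: contrapT => /f0 ft; move: H1; rewrite ft subr0 normr1.
by rewrite ltxx.
Qed.

End SmoothInto.

(** * Mixed differences, local surjectivity, ultrafilter limits *)

Section Analysis.
Variable R : realType.

Lemma rV_linear_continuous n (W : normedModType R)
    (L : {linear 'rV[R]_n -> W}) : continuous L.
Proof.
move=> x.
have -> : (L : 'rV[R]_n -> W) =
    \sum_(i < n) (fun y : 'rV[R]_n => y 0 i *: L (delta_mx 0 i)).
  apply/funext => y; rewrite fct_sumE {1}(row_sum_delta y) linear_sum.
  by apply: eq_bigr => i _; rewrite linearZ.
apply: (big_ind (fun g : 'rV[R]_n -> W => {for x, continuous g})).
- by rewrite -[0]/(cst (0 : W)); exact: cst_continuous.
- by move=> g h cg ch; exact: (continuousD cg ch).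
- move=> i _; apply: (@continuousZr_tmp _ _ _ (fun y : 'rV[R]_n => y 0 i)).
  exact: coord_continuous.
Qed.

Lemma rV_linear_diff n (W : normedModType R) (L : {linear 'rV[R]_n -> W}) x :
  differentiable L x.
Proof. by apply: linear_differentiable; exact: rV_linear_continuous. Qed.

Lemma rV_linear_derive n (W : normedModType R) (L : {linear 'rV[R]_n -> W}) x v :
  'D_v L x = L v.
Proof.
rewrite deriveE ?diff_lin//; first exact: rV_linear_continuous.
exact: rV_linear_diff.
Qed.

Lemma row_mx_diff n q (x : 'rV[R]_n) (y : 'rV[R]_q) :
  differentiable (row_mx x) y.
Proof.
have -> : row_mx x = mulmxr (row_mx 0 1%:M) + cst (row_mx x 0) :> ('rV[R]_q -> _).
  apply/funext => z; rewrite /GRing.add /= mul_mx_row mulmx0 mulmx1.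
  by rewrite add_row_mx add0r addr0.
apply: differentiableD; last exact: differentiable_cst.
exact: rV_linear_diff.
Qed.

Lemma row_mx_derive n q (x : 'rV[R]_n) (y v : 'rV[R]_q) :
  'D_v (row_mx x) y = row_mx 0 v.
Proof.
have -> : row_mx x = mulmxr (row_mx 0 1%:M) + cst (row_mx x 0) :> ('rV[R]_q -> _).
  apply/funext => z; rewrite /GRing.add /= mul_mx_row mulmx0 mulmx1.
  by rewrite add_row_mx add0r addr0.
rewrite deriveD; last exact: derivable_cst.
  by rewrite derive_cst addr0 rV_linear_derive /= mul_mx_row mulmx0 mulmx1.
by apply: diff_derivable; exact: rV_linear_diff.
Qed.

Lemma row_mx_norm_lt n q (x : 'rV[R]_n) (y : 'rV[R]_q) (r : R) :
  `|x| < r -> `|y| < r -> `|row_mx x y| < r.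
Proof.
move=> xr yr; apply: row_norm_lt => [|i]; first exact: le_lt_trans xr.
case: (split_ordP i) => j ->; rewrite ?row_mxEl ?row_mxEr.
  by apply: le_lt_trans xr; exact: coord_le.
by apply: le_lt_trans yr; exact: coord_le.
Qed.

Lemma row_mx_norm_le n q (x : 'rV[R]_n) (y : 'rV[R]_q) (r : R) :
  `|x| <= r -> `|y| <= r -> `|row_mx x y| <= r.
Proof.
move=> xr yr; apply: row_norm_le => [|i]; first exact: le_trans xr.
case: (split_ordP i) => j ->; rewrite ?row_mxEl ?row_mxEr.
  by apply: le_trans xr; exact: coord_le.
by apply: le_trans yr; exact: coord_le.
Qed.

(** For fixed [x] the left side is the increment from 0 to [y] of
    [h z = f (row_mx x z) - f (row_mx 0 z)]. The mean value theorem supplies the factor $|y|$; the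
    derivative of [h] is a difference of partials of [f], which are $C^1$, hence Lipschitz, and this
    supplies $|x|$. *)
Lemma C2_mixed n q (U : set 'rV[R]_(n + q)) (f : 'rV[R]_(n + q) -> R) :
  open U -> U 0 -> Ck_on 2 U f ->
  exists2 d : R, 0 < d & exists2 C : R, 0 <= C &
    forall x y, `|x| < d -> `|y| < d -> U (row_mx x y) /\
    `|f (row_mx x y) - f (row_mx x 0) - f (row_mx 0 y) + f 0|
      <= C * (`|x| * `|y|).
Proof.
move=> oU U0 fC; have /Ck_onS[df Df] := fC.
pose g j := 'D_(row_mx 0 (delta_mx 0 j) : 'rV[R]_(n + q)) f.
have H j : exists rC : R * R, [/\ 0 < rC.1, 0 <= rC.2, ball 0 rC.1 `<=` U &
    forall x y, ball 0 rC.1 x -> ball 0 rC.1 y ->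
      `|g j y - g j x| <= rC.2 * `|y - x|].
  have [r r0 [C C0 [rU HC]]] := C1_lipschitz oU U0 (Df (row_mx 0 (delta_mx 0 j))).
  by exists (r, C).
have {H}[rC H] := choice H.
have : \forall x \near (0 : 'rV[R]_(n + q)), U x /\ forall i, ball 0 (rC i).1 x.
  apply: filterI; first exact: open_nbhs_nbhs.
  apply: (@filter_forall _ _ (fun i x => ball (0 : 'rV[R]_(n + q)) (rC i).1 x)
            (nbhs (0 : 'rV[R]_(n + q)))) => i.
  by apply: nbhsx_ballx; have [] := H i.
move=> /nbhs_ballP[d /= d0 Hd]; exists d => //.
have inb x y : `|x| < d -> `|y| < d -> ball 0 d (row_mx x y : 'rV[R]_(n + q)).
  by move=> xd yd; apply/ball_normP; rewrite subr0; exact: row_mx_norm_lt.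
exists (\sum_j (rC j).2); first by apply: sumr_ge0 => j _; have [] := H j.
move=> x y xd yd; split; first by have [] := Hd _ (inb _ _ xd yd).
pose h (z : 'rV[R]_q) := f (row_mx x z) - f (row_mx 0 z).
have dfz (w : 'rV[R]_n) z : `|w| < d -> `|z| < d ->
    differentiable (f \o row_mx w) z /\
    forall v, 'D_v (f \o row_mx w) z = \sum_j v 0 j * g j (row_mx w z).
  move=> wd zd; have [/df dfwz _] := Hd _ (inb _ _ wd zd).
  split=> [|v]; first by apply: differentiable_comp => //; exact: row_mx_diff.
  rewrite derive_comp//; last exact: row_mx_diff.
  rewrite row_mx_derive.
  have -> : row_mx 0 v = \sum_j v 0 j *: row_mx 0 (delta_mx 0 j) :> 'rV[R]_(n + q).
    rewrite {1}(row_sum_delta v) -[LHS](mul1mx).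
    apply/rowP => i; rewrite mul1mx summxE.
    case: (split_ordP i) => k ->.
      by rewrite row_mxEl mxE big1// => j _; rewrite mxE row_mxEl mxE mulr0.
    rewrite row_mxEr summxE; apply: eq_bigr => j _.
    by rewrite [LHS]mxE [RHS]mxE row_mxEr.
  rewrite deriveE// linear_sum; apply: eq_bigr => j _.
  by rewrite linearZ/= /g deriveE.
have dh z : ball 0 d z -> differentiable h z.
  move=> /ball_normP; rewrite subr0 => zd.
  have n0 : `|0 : 'rV[R]_n| < d by rewrite normr0.
  by apply: differentiableB; [have [] := dfz x z xd zd|have [] := dfz 0 z n0 zd].
have b0 : ball (0 : 'rV[R]_q) d 0 by exact: ballxx.
have by_ : ball 0 d y by apply/ball_normP; rewrite subr0.
have [t t01 E] := ball_MVT dh b0 by_.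
have -> : f (row_mx x y) - f (row_mx x 0) - f (row_mx 0 y) + f 0 = h y - h 0.
  by rewrite /h row_mx0; ring.
rewrite E subr0 add0r.
have zd : `|t *: y| < d.
  case/andP: t01 => t0 t1; rewrite normrZ ger0_norm//.
  by apply: le_lt_trans yd; rewrite ler_piMl.
have n0 : `|0 : 'rV[R]_n| < d by rewrite normr0.
have [d1 D1] := dfz x _ xd zd; have [d2 D2] := dfz 0 _ n0 zd.
rewrite -[h]/((f \o row_mx x) - (f \o row_mx 0)).
rewrite deriveB; [|exact: diff_derivable|exact: diff_derivable].
rewrite D1 D2 -sumrB; apply: le_trans (ler_norm_sum _ _ _) _.
rewrite mulr_suml; apply: ler_sum => j _; rewrite -mulrBr normrM mulrC mulrA.
apply: ler_pM; rewrite ?coord_le//.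
have [_ _ _ Hj] := H j.
have [_ /(_ j) I1] := Hd _ (inb _ _ xd zd).
have [_ /(_ j) I2] := Hd _ (inb _ _ n0 zd).
apply: le_trans (Hj _ _ I2 I1) _; rewrite ler_wpM2l//; first by have [] := H j.
rewrite opp_row_mx add_row_mx subrr subr0; apply: row_mx_norm_le => //.
by rewrite normr0.
Qed.

(** Minimize $|y-G(x)|$ over the closed ball. If the minimum were positive, replacing $x$ by
    $x+(y-G(x))$ would halve it. Comparison with $x=0$ gives $|y-G(x)|\le|y|$ and then $|x|\le
    4|y|$; the bound $r/5$ keeps the corrected point in the ball, since $4r/5+r/5=r$. *)
Lemma local_surjection n (G : 'rV[R]_n -> 'rV[R]_n) (r : R) : 0 < r -> G 0 = 0 ->
  (forall x, `|x| <= r -> {for x, continuous G}) ->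
  (forall x y, `|x| <= r -> `|y| <= r ->
     `|G y - G x - (y - x)| <= 2^-1 * `|y - x|) ->
  forall y, `|y| <= r / 5 -> exists2 x, `|x| <= 4 * `|y| & G x = y.
Proof.
move=> r0 G0 cG HG y yr.
pose D := [set x : 'rV[R]_n | `|x| <= r].
have cD : compact D.
  have := @closed_ball_rV_compact R n 0 r r0.
  rewrite closed_ballE//; congr compact; apply/seteqP.
  by split=> x; rewrite /closed_ball_ /= sub0r normrN.
have GL x z : `|x| <= r -> `|z| <= r -> `|G z - G x| <= 2 * `|z - x|.
  move=> xr zr; have := HG x z xr zr.
  have := ler_normD (G z - G x - (z - x)) (z - x); rewrite subrK.
  have := normr_ge0 (z - x); lra.
have cont : {within D, continuous (fun x => `|y - G x|)}.
  apply: continuous_in_subspaceT => x; rewrite inE => xr.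
  apply: (@continuous_comp _ _ _ (fun x => y - G x) Num.norm).
    by apply: (@continuousB _ _ _ (cst y) G); [exact: cst_continuous|exact: cG].
  exact: norm_continuous.
have [|x Dx xmin] := compact_EVT_min _ cD cont.
  by exists 0; rewrite /D /= normr0 ltW.
move: Dx; rewrite inE /D /= => xr.
have ey : `|y - G x| <= `|y|.
  have := xmin 0; rewrite G0 subr0; apply; rewrite inE /D /= normr0 ltW//.
have xy : `|x| <= 4 * `|y|.
  have n0 : `|0 : 'rV[R]_n| <= r by rewrite normr0 ltW.
  have := HG 0 x n0 xr; rewrite G0 !subr0 => H1.
  have H2 : `|x| <= `|x - G x| + `|G x - y| + `|y|.
    have -> : `|x| = `|(x - G x) + (G x - y) + y| by rewrite addrA subrK subrK.
    apply: le_trans (ler_normD _ _) _; rewrite lerD2r.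
    exact: ler_normD.
  move: H1 H2 ey; rewrite [`|G x - x|]distrC [`|G x - y|]distrC; lra.
exists x => //; apply: contrapT => Gxy.
have e0 : 0 < `|y - G x|.
  by rewrite normr_gt0 subr_eq0; apply/eqP => H; apply: Gxy.
have x'r : `|x + (y - G x)| <= r.
  apply: le_trans (ler_normD _ _) _; lra.
have := xmin (x + (y - G x)); rewrite inE => /(_ x'r).
have := HG x (x + (y - G x)) xr x'r.
rewrite [x + _ - x]addrC addKr.
have -> : G (x + (y - G x)) - G x - (y - G x) = - (y - G (x + (y - G x))).
  by rewrite !opprB addrA subrK.
by rewrite normrN; lra.
Qed.

Lemma ultra_compact_cvg (I : Type) (T : topologicalType) (F : set_system I)
    (u : I -> T) : UltraFilter F -> compact [set: T] ->
  exists p : T, u i @[i --> F] --> p.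
Proof.
move=> FU cT; have FF : ProperFilter F := @ultra_proper _ _ FU.
have [p [_ clp]] := cT (u i @[i --> F]) _ filterT.
exists p => A pA.
have [//|nA] := in_ultra_setVsetC (u @^-1` A) FU.
have /(_ (~` A) A nA pA)[q []] := clp.
by [].
Qed.

End Analysis.

(** * The exponential map of a torus *)

Section LocalGroup.
Variables (R : realType) (l : nat) (K : lieGroupType R l).
Variables (c : chart R l K).
Hypotheses (Ac : atlas c) (c1 : chart_dom c 1%g).


(** The chart is recentred so that the identity has coordinate 0. *)
Definition chart1_inv (x : 'rV[R]_l) : K := chart_inv c (x + chart_map c 1%g).
Definition chart1_map (k : K) : 'rV[R]_l := chart_map c k - chart_map c 1%g.
Local Notation iota := chart1_inv.
Local Notation kappa := chart1_map.
Definition chart1_dom := [set x : 'rV[R]_l | chart_cod c (x + chart_map c 1%g)].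
Local Notation D := chart1_dom.

Lemma chart1_open : open D.
Proof.
have cs : continuous (fun x : 'rV[R]_l => x + chart_map c 1%g).
  move=> x; apply: (@continuousD _ _ _ id (cst (chart_map c 1%g))); [exact: cvg_id|].
  exact: cst_continuous.
by move/continuousP : cs; apply; exact: chart_open_cod.
Qed.

Lemma chart1_0 : D 0.
Proof. by rewrite /chart1_dom /= add0r; exact: chart_map_cod. Qed.

Lemma chart1_inv0 : iota 0 = 1%g.
Proof. by rewrite /iota add0r chart_mapK. Qed.

Lemma chart1_map1 : kappa 1%g = 0.
Proof. by rewrite /kappa subrr. Qed.

Lemma chart1_mapK k : chart_dom c k -> iota (kappa k) = k.
Proof. by move=> ck; rewrite /iota subrK chart_mapK. Qed.

Lemma chart1_invK x : D x -> kappa (iota x) = x.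
Proof. by move=> Dx; rewrite /kappa chart_invK// addrK. Qed.

Lemma chart1_inv_dom x : D x -> chart_dom c (iota x).
Proof. exact: chart_inv_dom. Qed.

Lemma chart1_map_cod k : chart_dom c k -> D (kappa k).
Proof. by move=> ck; rewrite /chart1_dom /= subrK; exact: chart_map_cod. Qed.

Lemma chart1_inv_smooth : smooth_into D iota.
Proof.
rewrite -[iota]/(chart_inv c \o (fun x => x + chart_map c 1%g)).
apply: (smooth_into_precomp
  chart1_open _ _ _ (chart_inv_smooth Ac)) => //; [exact: chart_open_cod|]; move=> k.
apply: Ck_on_add; [exact: chart1_open| |exact: Ck_on_cst].
apply: (@Ck_on_linear _ _ _ _ _ (idfun : {linear 'rV[R]_l -> 'rV[R]_l})).
exact: rV_linear_continuous.
Qed.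

Lemma chart1_map_smooth (V : normedModType R) (U : set V) (g : V -> K) :
  open U -> smooth_into U g -> (forall x, U x -> chart_dom c (g x)) ->
  smooth_on U (kappa \o g).
Proof.
move=> oU [cg sg] gU k.
have sgk : Ck_on k U (chart_map c \o g).
  by apply: Ck_on_sub (sg c Ac k) => x Ux; split=> //; exact: gU.
exact: (Ck_on_add oU sgk (@Ck_on_cst R _ _ k U (- chart_map c 1%g))).
Qed.

Lemma chart1_map_cont k : chart_dom c k -> {for k, continuous kappa}.
Proof.
move=> ck; apply: (@continuousB _ _ _ (chart_map c) (cst (chart_map c 1%g))).
  exact: chart_map_cont.
exact: cst_continuous.
Qed.

Let pr1 (z : 'rV[R]_(l + l)) : K := iota (lsubmx z).
Let pr2 (z : 'rV[R]_(l + l)) : K := iota (rsubmx z).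

Lemma submx_smooth (b : bool) (U : set 'rV[R]_(l + l)) :
  smooth_on U (if b then @lsubmx R 1 l l else @rsubmx R 1 l l).
Proof.
move=> k; case: b.
  apply: (@Ck_on_linear _ _ _ _ _ (@lsubmx R 1 l l : {linear _ -> _})).
  exact: rV_linear_continuous.
apply: (@Ck_on_linear _ _ _ _ _ (@rsubmx R 1 l l : {linear _ -> _})).
exact: rV_linear_continuous.
Qed.

Let DD := [set z : 'rV[R]_(l + l) | D (lsubmx z) /\ D (rsubmx z)].

Lemma DD_open : open DD.
Proof.
apply: openI.
  have : continuous (@lsubmx R 1 l l).
    exact: (@rV_linear_continuous _ _ _ (@lsubmx R 1 l l : {linear _ -> _})).
  by move=> /continuousP; apply; exact: chart1_open.
have : continuous (@rsubmx R 1 l l).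
  exact: (@rV_linear_continuous _ _ _ (@rsubmx R 1 l l : {linear _ -> _})).
by move=> /continuousP; apply; exact: chart1_open.
Qed.

Lemma pr1_smooth : smooth_into DD pr1.
Proof.
apply: (smooth_into_precomp DD_open chart1_open _ (@submx_smooth true DD)
  chart1_inv_smooth).
by move=> x [].
Qed.

Lemma pr2_smooth : smooth_into DD pr2.
Proof.
apply: (smooth_into_precomp DD_open chart1_open _ (@submx_smooth false DD)
  chart1_inv_smooth).
by move=> x [].
Qed.

Definition chart1_mul (z : 'rV[R]_(l + l)) : 'rV[R]_l :=
  kappa (iota (lsubmx z) * iota (rsubmx z))%g.
Definition chart1_mul_dom := [set z : 'rV[R]_(l + l) |
  (D (lsubmx z) /\ D (rsubmx z)) /\
  chart_dom c (iota (lsubmx z) * iota (rsubmx z))%g].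
Local Notation mu x y := (chart1_mul (row_mx x y)).

Lemma mul_into : smooth_into DD (fun z => pr1 z * pr2 z)%g.
Proof.
apply: smooth_into_bin pr1_smooth pr2_smooth; first exact: DD_open.
exact: mul_smooth.
Qed.

Lemma chart1_mul_open : open chart1_mul_dom.
Proof.
by apply: smooth_into_open mul_into; [exact: DD_open|exact: chart_open_dom].
Qed.

Lemma chart1_mul_dom0 : chart1_mul_dom 0.
Proof.
by rewrite /chart1_mul_dom /= !linear0 chart1_inv0 mulg1; split=> //;
  split; exact: chart1_0.
Qed.

Lemma chart1_mul_smooth : smooth_on chart1_mul_dom chart1_mul.
Proof.
apply: (@chart1_map_smooth _ _ (fun z => pr1 z * pr2 z)%g).
- exact: chart1_mul_open.
- by apply: smooth_into_sub mul_into => z [].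
- by move=> z [].
Qed.

(** Since [mu x 0 = x] and [mu 0 y = y], the expression is the mixed difference bounded by
    [C2_mixed]. *)
Lemma chart1_mul_est : exists2 d : R, 0 < d & exists2 C : R, 0 <= C &
  forall x y, `|x| < d -> `|y| < d -> chart1_mul_dom (row_mx x y) /\
    `|mu x y - x - y| <= C * (`|x| * `|y|).
Proof.
pose f i z := chart1_mul z 0 i.
have H i : exists dC : R * R, [/\ 0 < dC.1, 0 <= dC.2 &
    forall x y, `|x| < dC.1 -> `|y| < dC.1 -> chart1_mul_dom (row_mx x y) /\
     `|f i (row_mx x y) - f i (row_mx x 0) - f i (row_mx 0 y) + f i 0|
      <= dC.2 * (`|x| * `|y|)].
  have /(Ck_on_rowP _ _ chart1_mul_open)/(_ i) fC := chart1_mul_smooth 2.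
  have [d d0 [C C0 HC]] := C2_mixed chart1_mul_open chart1_mul_dom0 fC.
  by exists (d, C).
have {H}[dC H] := choice H.
have D0 : \forall x \near (0 : 'rV[R]_l), D x.
  by apply: open_nbhs_nbhs; split; [exact: chart1_open|exact: chart1_0].
have M0 : \forall z \near (0 : 'rV[R]_(l + l)), chart1_mul_dom z.
  by apply: open_nbhs_nbhs; split; [exact: chart1_mul_open|exact: chart1_mul_dom0].
have : \forall x \near (0 : 'rV[R]_l), D x /\ forall i, ball (0 : 'rV[R]_l) (dC i).1 x.
  apply: filterI => //.
  apply: (@filter_forall _ _ (fun i x => ball (0 : 'rV[R]_l) (dC i).1 x)
            (nbhs (0 : 'rV[R]_l))) => i.
  by apply: nbhsx_ballx; have [] := H i.
move=> /nbhs_ballP[d /= d0 Hd]; have /nbhs_ballP[e /= e0 He] := M0.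
exists (Num.min d e); first by rewrite lt_min d0.
have S0 : 0 <= \sum_i (dC i).2 by apply: sumr_ge0 => j _; have [] := H j.
exists (\sum_i (dC i).2) => // x y; rewrite !lt_min => /andP[xd xe] /andP[yd ye].
split; first by apply: He; apply/ball_normP; rewrite subr0; exact: row_mx_norm_lt.
have [Dx bx] : D x /\ forall i, ball 0 (dC i).1 x.
  by apply: Hd; apply/ball_normP; rewrite subr0.
have [Dy b_y] : D y /\ forall i, ball 0 (dC i).1 y.
  by apply: Hd; apply/ball_normP; rewrite subr0.
apply: row_norm_le => [|i]; first by rewrite !mulr_ge0.
have [_ _ /(_ x y)] := H i.
have /ball_normP := bx i; have /ball_normP := b_y i; rewrite !subr0.
have E1 : mu x 0 = x.
  by rewrite /chart1_mul row_mxKl row_mxKr chart1_inv0 mulg1 chart1_invK.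
have E2 : mu 0 y = y.
  by rewrite /chart1_mul row_mxKl row_mxKr chart1_inv0 mul1g chart1_invK.
have E0 : chart1_mul 0 = 0.
  by rewrite /chart1_mul !linear0 chart1_inv0 mulg1 chart1_map1.
move=> b1 b2 /(_ b2 b1)[_]; rewrite /f E1 E2 E0.
rewrite [(0 : 'rV_l) 0 i]mxE addr0 => Hi.
have -> (u v w : 'rV[R]_l) : (u - v - w) 0 i = u 0 i - v 0 i - w 0 i.
  by rewrite !mxE.
apply: le_trans Hi _; rewrite ler_wpM2r ?mulr_ge0//.
by rewrite (bigD1 i)//= lerDl; apply: sumr_ge0 => j _; have [] := H j.
Qed.

(** In coordinates the quotient is a $C^1$ function of [(x, y)] that vanishes on the diagonal; its
    Lipschitz bound is applied between [(x, y)] and [(y, y)]. *)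
Lemma chart1_div_est : exists2 d : R, 0 < d & exists2 L : R, 0 <= L &
  forall x y, `|x| < d -> `|y| < d ->
    chart_dom c (iota x * (iota y)^-1)%g /\
    `|kappa (iota x * (iota y)^-1)%g| <= L * `|x - y|.
Proof.
have inv_into : smooth_into DD (fun z => (pr2 z)^-1)%g.
  by apply: (smooth_into_map DD_open (inv_smooth) pr2_smooth).
have div_into : smooth_into DD (fun z => pr1 z * (pr2 z)^-1)%g.
  by apply: smooth_into_bin mul_smooth pr1_smooth inv_into; exact: DD_open.
pose W := [set z | DD z /\ chart_dom c (pr1 z * (pr2 z)^-1)%g].
have oW : open W.
  by apply: smooth_into_open div_into; [exact: DD_open|exact: chart_open_dom].
have W0 : W 0.
  rewrite /W /pr1 /pr2 /DD /= !linear0 chart1_inv0 mulgV.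
  by split=> //; split; exact: chart1_0.
have sW : smooth_on W (kappa \o (fun z => pr1 z * (pr2 z)^-1)%g).
  apply: chart1_map_smooth => //; last by move=> z [].
  by apply: smooth_into_sub div_into => z [].
have [r r0 [L L0 [rW HL]]] := C1_lipschitz_row oW W0 (sW 1%N).
exists r => //; exists L => // x y xr yr.
have inb u v : `|u| < r -> `|v| < r -> ball 0 r (row_mx u v : 'rV[R]_(l + l)).
  by move=> ur vr; apply/ball_normP; rewrite subr0; exact: row_mx_norm_lt.
have [_] := rW _ (inb _ _ xr yr); rewrite /pr1 /pr2 row_mxKl row_mxKr => dxy.
split=> //; have := HL _ _ (inb _ _ yr yr) (inb _ _ xr yr).
rewrite /pr1 /pr2 /= !row_mxKl !row_mxKr mulgV chart1_map1 subr0 => /le_trans.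
apply; rewrite ler_wpM2l// opp_row_mx add_row_mx subrr.
by apply: row_mx_norm_le => //; rewrite normr0.
Qed.

End LocalGroup.

(** * Construction of the exponential homomorphism *)

Section ExpExists.
Variables (R : realType) (l : nat) (K : lieGroupType R l).
Hypotheses (cK : compact [set: K]) (comK : forall x y : K, (x * y = y * x)%g).
Variables (c : chart R l K).
Hypotheses (Ac : atlas c) (c1 : chart_dom c 1%g).
Local Notation iota := (chart1_inv c).
Local Notation kappa := (chart1_map c).
Local Notation mu x y := (chart1_mul c (row_mx x y)).

Lemma chart1_mul_est_small : exists2 C : R, 0 <= C & exists d : R,
  [/\ 0 < d, 2 * C * d <= 1 & forall x y, `|x| < d -> `|y| < d ->
    [/\ chart1_dom c x, chart_dom c (iota x * iota y)%g &
    `|kappa (iota x * iota y)%g - x - y| <= C * (`|x| * `|y|)]].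
Proof.
have [d d0 [C C0 H]] := chart1_mul_est Ac c1.
exists C => //; exists (Num.min d (2 * C + 1)^-1).
have P : 0 < 2 * C + 1 by rewrite ltr_wpDl// mulr_ge0.
split; first by rewrite lt_min d0 invr_gt0.
  apply: (@le_trans _ _ (2 * C * (2 * C + 1)^-1)).
    by rewrite ler_wpM2l ?mulr_ge0// ge_min lexx orbT.
  by rewrite ler_pdivrMr// mul1r lerDl.
move=> x y; rewrite !lt_min => /andP[xd _] /andP[yd _].
have [] := H x y xd yd; rewrite /chart1_mul_dom /chart1_mul /=.
by rewrite row_mxKl row_mxKr => -[[Dx Dy] dxy].
Qed.

Definition iter_square (i : nat) (g : K) : K := iter i (fun h => h * h)%g g.
Local Notation sq := iter_square.

Lemma iter_squareM i g h : sq i (g * h)%g = (sq i g * sq i h)%g.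
Proof.
elim: i => [//|i IH]; rewrite /sq !iterS -!/(sq i _) IH.
by rewrite -!mulgA; congr (_ * _)%g; rewrite !mulgA; congr (_ * _)%g.
Qed.

(** Put $s=2^i|x|$ and let $y$ be the coordinate of the $2^i$-th power. Squaring doubles the
    previous error and adds at most $C|y|^2\le 4Cs^2$, because $2Cs\le 1$ gives $|y|\le 2s$. The
    constant $2C$ closes the induction: $2\cdot 2Cs^2+4Cs^2=2C(2s)^2$. *)
Lemma iter_square_est : exists2 C : R, 0 <= C & exists d : R,
  [/\ 0 < d, forall x, `|x| < d -> chart1_dom c x & forall i x,
    2 * (2 ^+ i * `|x|) < d -> chart_dom c (sq i (iota x)) /\
    `|kappa (sq i (iota x)) - 2 ^+ i *: x| <= C * (2 ^+ i * `|x|) ^+ 2].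
Proof.
have [C C0 [d [d0 Cd H]]] := chart1_mul_est_small.
have Dd x : `|x| < d -> chart1_dom c x by move=> xd; have [] := H x x xd xd.
exists (2 * C); first by rewrite mulr_ge0.
exists d; split=> //; elim=> [|i IH] x.
  rewrite expr0 mul1r scale1r => xd.
  have x0 := normr_ge0 x.
  have {}xd : `|x| < d by lra.
  rewrite /sq /= chart1_invK; [|exact: Dd].
  rewrite subrr normr0 !mulr_ge0 ?exprn_ge0//; split=> //.
  by apply: chart1_inv_dom; exact: Dd.
set s := 2 ^+ i * `|x|.
have s0 : 0 <= s by rewrite mulr_ge0// exprn_ge0.
have -> : 2 ^+ i.+1 * `|x| = 2 * s by rewrite exprS mulrA.
move=> sd; have [|di yi] := IH x; first by rewrite -/s; lra.
rewrite -/s in yi; set y := kappa (sq i (iota x)) in yi *.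
have Cs : 2 * C * s <= 1.
  apply: le_trans Cd; rewrite ler_wpM2l ?mulr_ge0//; lra.
have ys : `|y| <= 2 * s.
  have -> : y = (y - 2 ^+ i *: x) + 2 ^+ i *: x by rewrite subrK.
  apply: le_trans (ler_normD _ _) _.
  rewrite normrZ ger0_norm ?exprn_ge0// -/s.
  have : 2 * C * s ^+ 2 <= 1 * s by rewrite expr2 mulrA ler_wpM2r.
  lra.
have yd : `|y| < d by lra.
have [_ dyy] := H y y yd yd.
have E : sq i.+1 (iota x) = (iota y * iota y)%g.
  by rewrite /sq iterS -/(sq i _) /y chart1_mapK.
rewrite E; move=> Hy; split=> //.
set z := kappa _ in Hy *.
have -> : z - 2 ^+ i.+1 *: x = (z - y - y) + 2 *: (y - 2 ^+ i *: x).
  rewrite scalerBr scalerA -exprS scaler_nat mulr2n -[z - y - y]addrA -opprD.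
  by rewrite addrA subrK.
apply: le_trans (ler_normD _ _) _; rewrite normrZ ger0_norm//.
have yy : C * (`|y| * `|y|) <= C * ((2 * s) * (2 * s)).
  by rewrite ler_wpM2l// ler_pM.
rewrite exprMn; move: yy yi Hy; rewrite !expr2; nra.
Qed.

(* E v is the limit, along an ultrafilter, of the 2^k-th power of the point with
   coordinates v / 2^k. *)
Lemma exp_exists : exists2 E : 'rV[R]_l -> K,
  forall x y, E (x + y) = (E x * E y)%g &
  exists2 C : R, 0 <= C & exists2 d : R, 0 < d & forall v, `|v| < d ->
    chart_dom c (E v) /\ `|kappa (E v) - v| <= C * `|v| ^+ 2.
Proof.
(* One ultrafilter serves all vectors: limits then exist by compactness alone, and limits of
   products are products of limits. *)
have [F [FU sF]] := ultraFilterLemma (@eventually_filter).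
have FF : ProperFilter F := @ultra_proper _ _ FU.
have toF (P : set nat) : (\forall k \near \oo, P k) -> F P by exact: sF.
have hK := @manifold_hausdorff R l K.
pose h (x : 'rV[R]_l) (k : nat) := (2 ^+ k)^-1 *: x.
pose u x k := sq k (iota (h x k)).
have /choice[E HE] : forall x, exists p : K, u x k @[k --> F] --> p.
  by move=> x; exact: ultra_compact_cvg.
have p2 k : 0 < 2 ^+ k :> R by rewrite exprn_gt0.
have hn x k : 2 ^+ k * `|h x k| = `|x|.
  by rewrite /h normrZ gtr0_norm ?invr_gt0// mulrA divff ?mul1r// gt_eqF.
have h2 x k : 2 ^+ k *: h x k = x.
  by rewrite /h scalerA divff ?scale1r// gt_eqF.
have p2cvg : (2 ^+ k)^-1 @[k --> \oo] --> (0 : R).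
  have := @cvg_expr R 2^-1; rewrite ger0_norm// => /(_ _).
  under eq_fun do rewrite -exprVn.
  by apply; lra.
have small (e B : R) : 0 < e -> \forall k \near \oo, (2 ^+ k)^-1 * B < e.
  move=> e0.
  have : (2 ^+ k)^-1 * B @[k --> \oo] --> 0 * B by apply: cvgM; [exact: p2cvg|exact: cvg_cst].
  rewrite mul0r => /cvgrPdist_lt/(_ e e0); apply: filterS => k.
  by rewrite sub0r normrN; apply: le_lt_trans; exact: ler_norm.
have [C C0 [d [d0 Dd Hsq]]] := iter_square_est.
have [Cm Cm0 [dm [dm0 _ Hm]]] := chart1_mul_est_small.
have [dd dd0 [L L0 Hdiv]] := chart1_div_est Ac c1.
have ciota : {for 0, continuous iota}.
  by have [+ _] := chart1_inv_smooth Ac; apply; exact: chart1_0.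
(* Perturbations of size $O(4^{-k})$ disappear in the limit: by [iter_square_est] their $2^k$-th
   powers have size $O(2^{-k})$. *)
have sq1 (z : nat -> 'rV[R]_l) (B : R) :
    (\forall k \near \oo, `|z k| <= (2 ^+ k)^-1 * (2 ^+ k)^-1 * B) ->
    sq k (iota (z k)) @[k --> F] --> (1%g : K).
  move=> zB.
  have kz : kappa (sq k (iota (z k))) @[k --> \oo] --> (0 : 'rV[R]_l).
    apply/cvgrPdist_lt => e e0.
    have e3 : 0 < Num.min (Num.min (e / 2) (d / 2)) (C + 1)^-1.
      by rewrite !lt_min !divr_gt0// invr_gt0 ltr_wpDl.
    near=> k.
    have zk : 2 ^+ k * `|z k| < Num.min (Num.min (e / 2) (d / 2)) (C + 1)^-1.
      apply: (@le_lt_trans _ _ ((2 ^+ k)^-1 * B)); last by near: k; exact: small.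
      rewrite mulrC -ler_pdivlMr// mulrAC; near: k; exact: zB.
    move: zk; rewrite !lt_min => /andP[/andP[ze zd] zC].
    have [|_ Hk] := Hsq k (z k); first by lra.
    rewrite sub0r normrN; set y := kappa _ in Hk *.
    have -> : y = (y - 2 ^+ k *: z k) + 2 ^+ k *: z k by rewrite subrK.
    apply: le_lt_trans (ler_normD _ _) _.
    rewrite normrZ ger0_norm ?ltW//.
    set s := 2 ^+ k * `|z k| in Hk ze zd zC *.
    have s0 : 0 <= s by rewrite mulr_ge0// ltW.
    have : C * s <= 1.
      apply: (@le_trans _ _ (C * (C + 1)^-1)); first by rewrite ler_wpM2l// ltW.
      by rewrite ler_pdivrMr ?ltr_wpDl// mul1r lerDl.
    by move: Hk; rewrite expr2; nra.
  have ik : iota (kappa (sq k (iota (z k)))) @[k --> \oo] --> (1%g : K).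
    by rewrite -(chart1_inv0 c1); apply: (continuous_cvg _ ciota kz).
  have ik' : sq k (iota (z k)) @[k --> \oo] --> (1%g : K).
    apply: cvg_trans ik; apply: near_eq_cvg; near=> k.
    apply: chart1_mapK.
    have [|//] := Hsq k (z k).
    apply: (@le_lt_trans _ _ ((2 ^+ k)^-1 * (2 * B))).
      have zk : `|z k| <= (2 ^+ k)^-1 * (2 ^+ k)^-1 * B by near: k.
      have : 2 ^+ k * `|z k| <= (2 ^+ k)^-1 * B.
        by rewrite mulrC -ler_pdivlMr// mulrAC.
      lra.
    by near: k; exact: small.
  by apply: cvg_trans ik'; apply: (cvg_app (fun k => sq k (iota (z k)))).
exists E => [x y|].
  pose w k := kappa (iota (h x k) * iota (h y k))%g.
  (* [z k] is the defect between the product of the small elements for [x] and [y] and the small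
     element for [x + y]. It is $O(4^{-k})$ by the product and quotient estimates. As $K$ is
     abelian, $2^k$-th powers are multiplicative, so by [sq1] the defect vanishes in the limit. *)
  pose z k := kappa (iota (w k) * (iota (h (x + y) k))^-1)%g.
  have near_h v e : 0 < e -> \forall k \near \oo, `|h v k| < e.
    move=> e0; have := small e `|v| e0; apply: filterS => k.
    by rewrite /h normrZ gtr0_norm ?invr_gt0.
  have wB : \forall k \near \oo, [/\ chart_dom c (iota (h x k) * iota (h y k))%g,
      `|w k - h (x + y) k| <= (2 ^+ k)^-1 * (2 ^+ k)^-1 * (Cm * (`|x| * `|y|)) &
      `|w k| < dd].
    have Hw : \forall k \near \oo, chart_dom c (iota (h x k) * iota (h y k))%g /\
      `|w k - h (x + y) k| <= (2 ^+ k)^-1 * (2 ^+ k)^-1 * (Cm * (`|x| * `|y|)).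
      near=> k.
      have xk : `|h x k| < dm by near: k; exact: near_h.
      have yk : `|h y k| < dm by near: k; exact: near_h.
      have [_ dxy] := Hm _ _ xk yk.
      rewrite -addrA -opprD /h -scalerDr !normrZ gtr0_norm ?invr_gt0// => Hk.
      by split=> //; apply: le_trans Hk _; rewrite le_eqVlt; apply/orP; left;
        apply/eqP; ring.
    near=> k.
    have [H1 H2] : chart_dom c (iota (h x k) * iota (h y k))%g /\
      `|w k - h (x + y) k| <= (2 ^+ k)^-1 * (2 ^+ k)^-1 * (Cm * (`|x| * `|y|)).
      by near: k.
    split=> //.
    have -> : w k = w k - h (x + y) k + h (x + y) k by rewrite subrK.
    apply: le_lt_trans (ler_normD _ _) _.
    have Hk1 : `|h (x + y) k| < dd / 2 by near: k; apply: near_h; rewrite divr_gt0.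
    have Hk2 : (2 ^+ k)^-1 * (Cm * (`|x| * `|y|)) < dd / 2.
      by near: k; apply: small; rewrite divr_gt0.
    have k1 : (2 ^+ k)^-1 <= 1 :> R.
      by rewrite invf_le1// exprn_ege1// ler1n.
    have : (2 ^+ k)^-1 * (2 ^+ k)^-1 * (Cm * (`|x| * `|y|)) <=
           (2 ^+ k)^-1 * (Cm * (`|x| * `|y|)).
      rewrite -[leRHS]mul1r -mulrA ler_wpM2r// !mulr_ge0// invr_ge0 ltW//.
    lra.
  have zB : \forall k \near \oo,
      `|z k| <= (2 ^+ k)^-1 * (2 ^+ k)^-1 * (L * (Cm * (`|x| * `|y|))).
    near=> k.
    have [H1 H2 H3] : [/\ chart_dom c (iota (h x k) * iota (h y k))%g,
      `|w k - h (x + y) k| <= (2 ^+ k)^-1 * (2 ^+ k)^-1 * (Cm * (`|x| * `|y|)) &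
      `|w k| < dd] by near: k.
    have hk : `|h (x + y) k| < dd by near: k; exact: near_h.
    have [_ Hz] := Hdiv _ _ H3 hk.
    by apply: le_trans Hz _; rewrite mulrCA ler_wpM2l.
  have zE : \forall k \near \oo,
      (u x k * u y k)%g = (sq k (iota (z k)) * u (x + y) k)%g.
    near=> k.
    have [H1 H2 H3] : [/\ chart_dom c (iota (h x k) * iota (h y k))%g,
      `|w k - h (x + y) k| <= (2 ^+ k)^-1 * (2 ^+ k)^-1 * (Cm * (`|x| * `|y|)) &
      `|w k| < dd] by near: k.
    have hk : `|h (x + y) k| < dd by near: k; exact: near_h.
    have [dz _] := Hdiv _ _ H3 hk.
    rewrite /u -!iter_squareM; congr sq.
    by rewrite /z chart1_mapK// mulgVK /w chart1_mapK.
  have [cmul _] := @mul_smooth R l K.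
  have cm (f g : nat -> K) p q : f k @[k --> F] --> p -> g k @[k --> F] --> q ->
      (f k * g k)%g @[k --> F] --> (p * q)%g.
    move=> fp gq; apply: (@cvg_comp _ _ _ (fun k => (f k, g k))
      (fun z : K * K => (z.1 * z.2)%g) F (nbhs (p, q))).
      exact: cvg_pair.
    exact: (cmul (p, q)).
  have L1 := cm _ _ _ _ (HE x) (HE y).
  have L2 := cm _ _ _ _ (sq1 _ _ zB) (HE (x + y)).
  rewrite mul1g in L2.
  have L3 : (u x k * u y k)%g @[k --> F] --> E (x + y).
    by apply: cvg_trans L2; apply: near_eq_cvg; apply: toF;
      apply: filterS zE => k ->.
  exact: (cvg_unique hK L3 L1).
exists C => //; exists (Num.min (d / 2) (2 * (C + 1))^-1).
  by rewrite lt_min divr_gt0// invr_gt0 mulr_gt0// ltr_wpDl.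
move=> v; rewrite lt_min => /andP[vd vC].
set rho := C * `|v| ^+ 2.
pose S := [set y : 'rV[R]_l | `|y - v| <= rho].
have v0 := normr_ge0 v.
have rho0 : 0 <= rho by rewrite mulr_ge0// exprn_ge0.
have Cv : C * `|v| <= 2^-1.
  apply: (@le_trans _ _ (C * (2 * (C + 1))^-1)); first by rewrite ler_wpM2l// ltW.
  rewrite ler_pdivrMr ?mulr_gt0 ?ltr_wpDl//; lra.
have Sd y : S y -> `|y| < d.
  rewrite /S /= => yv; have -> : y = y - v + v by rewrite subrK.
  apply: le_lt_trans (ler_normD _ _) _.
  have : rho <= 2^-1 * `|v| by rewrite /rho expr2 mulrA ler_wpM2r.
  lra.
have cS : compact S.
  apply: bounded_closed_compact.
    exists d; split; first exact: num_real.
    by move=> M dM y /Sd /ltW yd; apply: le_trans yd (ltW dM).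
  have cn : continuous (Num.norm \o (fun y : 'rV[R]_l => y - v)).
    move=> y; apply: continuous_comp; last exact: norm_continuous.
      by apply: (@continuousB _ _ _ id (cst v)); [exact: cvg_id|exact: cst_continuous].
  rewrite (_ : S = (Num.norm \o (fun y : 'rV[R]_l => y - v)) @^-1` [set x : R | x <= rho])//.
  by apply: ((continuous_closedP _).1 cn); exact: closed_le.
have ciS : closed (iota @` S).
  apply: compact_closed => //; apply: continuous_compact => //.
  apply: continuous_in_subspaceT => y; rewrite inE => /Sd /Dd Dy.
  by have [+ _] := chart1_inv_smooth Ac; apply.
have uS k : (iota @` S) (u v k).
  have [|dk Hk] := Hsq k (h v k); first by rewrite hn; lra.
  exists (kappa (u v k)); last by rewrite chart1_mapK.
  by move: Hk; rewrite hn h2.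
have [y Sy yE] : (iota @` S) (E v).
  have nuS : \forall k \near F, (iota @` S) (u v k) by exact: nearW.
  apply: (@closed_cvg nat K F FF (u v) _ ciS nuS); exact: HE.
have Dy := Dd _ (Sd _ Sy).
rewrite -yE chart1_invK//; split=> //; exact: chart1_inv_dom.
Unshelve. all: by end_near. Qed.

End ExpExists.

Lemma hom_exp0 (V : zmodType) (G : groupType) (E : V -> G) :
  (forall x y, E (x + y) = (E x * E y)%g) -> E 0 = 1%g.
Proof. by move=> homE; apply: (@mulgI _ (E 0)); rewrite -homE addr0 mulg1. Qed.

(** * Smoothness and local surjectivity of the exponential *)

Section ExpSmooth.
Variables (R : realType) (l : nat) (K : lieGroupType R l).
Variables (c : chart R l K).
Hypotheses (Ac : atlas c) (c1 : chart_dom c 1%g).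
Local Notation iota := (chart1_inv c).
Local Notation kappa := (chart1_map c).
Variables (E : 'rV[R]_l -> K) (C d : R).
Hypotheses (homE : forall x y, E (x + y) = (E x * E y)%g) (C0 : 0 <= C)
  (d0 : 0 < d) (estE : forall v, `|v| < d ->
    chart_dom c (E v) /\ `|kappa (E v) - v| <= C * `|v| ^+ 2).
Let G v := kappa (E v).

Lemma exp_radius : exists r : R, [/\ 0 < r, r <= d &
  exists2 Cm : R, 0 <= Cm & forall x y, `|x| < r -> `|y| < r ->
   [/\ chart1_dom c (G x), `|G x| <= 2 * `|x|,
     chart1_mul_dom c (row_mx (G x) (G y)) &
     `|chart1_mul c (row_mx (G x) (G y)) - G x - G y| <= Cm * (`|G x| * `|G y|)]].
Proof.
have [dm dm0 [Cm Cm0 H]] := chart1_mul_est Ac c1.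
have P : 0 < C + 1 by rewrite ltr_wpDl.
exists (Num.min (Num.min d (dm / 2)) (C + 1)^-1).
split; first by rewrite !lt_min d0 divr_gt0// invr_gt0.
  by rewrite ge_min ge_min lexx.
exists Cm => // x y; rewrite !lt_min => /andP[/andP[xd xm] xC] /andP[/andP[yd ym] yC].
have G2 v : `|v| < d -> `|v| < (C + 1)^-1 -> `|G v| <= 2 * `|v|.
  move=> vd vC; have [_ Hv] := estE vd.
  rewrite -[G v](subrK v); apply: le_trans (ler_normD _ _) _.
  have Cv : C * `|v| <= 1.
    apply: (@le_trans _ _ (C * (C + 1)^-1)); first by rewrite ler_wpM2l// ltW.
    by rewrite ler_pdivrMr// mul1r lerDl.
  have : C * `|v| ^+ 2 <= 1 * `|v| by rewrite expr2 mulrA ler_wpM2r.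
  move: Hv; rewrite -/(G v); lra.
have Gx := G2 _ xd xC; have Gy := G2 _ yd yC.
have [||D1 D2] := H (G x) (G y); [lra|lra|].
split=> //; apply: chart1_map_cod; by have [] := estE xd.
Qed.

Lemma exp_mul x y : `|x| < d -> `|y| < d ->
  G (x + y) = chart1_mul c (row_mx (G x) (G y)).
Proof.
move=> xd yd; have [dx _] := estE xd; have [dy _] := estE yd.
by rewrite /chart1_mul row_mxKl row_mxKr !chart1_mapK// -homE.
Qed.

(** The remainder in [estE] is quadratic. *)
Lemma exp_diff0 : differentiable G 0 /\ 'd G 0 = id :> ('rV[R]_l -> 'rV[R]_l).
Proof.
apply: (@near_diff _ _ _ G 0 (idfun : {linear 'rV[R]_l -> 'rV[R]_l})).
  exact: rV_linear_continuous.
move=> e e0; have P : 0 < C + 1 by rewrite ltr_wpDl.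
have : 0 < Num.min d ((C + 1)^-1 * e) by rewrite lt_min d0 mulr_gt0// invr_gt0.
move=> m0; apply/nbhs_ballP; exists (Num.min d ((C + 1)^-1 * e)) => //= h.
move=> /ball_normP; rewrite subr0 lt_min => /andP[hd he].
have [_ Hh] := estE hd.
rewrite addr0 {2}/G (hom_exp0 homE) chart1_map1 subr0; apply: le_trans Hh _.
rewrite expr2 mulrA ler_wpM2r//.
apply: (@le_trans _ _ ((C + 1) * `|h|)); first by rewrite ler_wpM2r// lerDl.
by rewrite -ler_pdivlMl// ltW.
Qed.

Lemma exp_diff (r Cm : R) : 0 < r -> r <= d ->
  (forall x y, `|x| < r -> `|y| < r ->
     chart1_mul_dom c (row_mx (G x) (G y))) ->
  forall x, `|x| < r -> differentiable G x /\
    forall v, 'D_v G x = 'D_(row_mx 0 v) (chart1_mul c) (row_mx (G x) 0).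
Proof.
move=> r0 rd H x xr.
have [dG0 dG0E] := exp_diff0.
have G0 : G 0 = 0 by rewrite /G (hom_exp0 homE) chart1_map1.
have n0 : `|0 : 'rV[R]_l| < r by rewrite normr0.
have dom : chart1_mul_dom c (row_mx (G x) 0) by rewrite -G0; exact: H.
have dmul : differentiable (chart1_mul c) (row_mx (G x) (G 0)).
  rewrite G0; have /Ck_onS[+ _] := chart1_mul_smooth Ac 1.
  by apply.
pose F := chart1_mul c \o (row_mx (G x) \o G).
have dr : differentiable (row_mx (G x)) (G 0) by exact: row_mx_diff.
have dH : differentiable (row_mx (G x) \o G) 0.
  exact: differentiable_comp dG0 dr.
have dF : differentiable F 0 by exact: differentiable_comp dH dmul.
have DF v : 'D_v F 0 = 'D_(row_mx 0 v) (chart1_mul c) (row_mx (G x) 0).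
  rewrite /F (derive_comp v dH dmul) (derive_comp v dG0 dr) row_mx_derive.
  by rewrite (deriveE v dG0) dG0E /= G0.
have fg : \forall y \near x, (F \o (fun y => y + - x)) y = G y.
  near=> y; have yx : `|y - x| < d.
    apply: lt_le_trans rd; apply/ball_normP; near: y; exact: nbhsx_ballx.
  rewrite /F /= -exp_mul// ?(lt_le_trans xr)//.
  by rewrite addrC subrK.
have did : differentiable (fun y : 'rV[R]_l => y + - x) x.
  by apply: differentiableD => //; exact: differentiable_cst.
have dF' : differentiable F (x + - x) by rewrite subrr.
split; first by apply: near_differentiable fg _; exact: differentiable_comp did dF'.
move=> v; rewrite -(near_eq_derive _ fg) (derive_comp v did dF') -DF subrr.
congr derive.
rewrite (@deriveD R _ _ id (cst (- x))); [|exact: derivable_id|exact: derivable_cst].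
by rewrite derive_id derive_cst addr0.
Unshelve. all: by end_near. Qed.

(* Bootstrapping: by homogeneity the derivative of E at x in direction v is the
   derivative of the multiplication at (E x, 1) in direction (0, v). *)
Lemma exp_smooth : smooth_from E.
Proof.
have [r [r0 rd [Cm Cm0 H]]] := exp_radius.
have Hdom x y : `|x| < r -> `|y| < r -> chart1_mul_dom c (row_mx (G x) (G y)).
  by move=> xr yr; have [] := H x y xr yr.
have dG := exp_diff 0 r0 rd Hdom.
have G0 : G 0 = 0 by rewrite /G (hom_exp0 homE) chart1_map1.
pose B := ball (0 : 'rV[R]_l) r.
have BP x : B x -> `|x| < r by move=> /ball_normP; rewrite subr0.
have oB : open B by exact: ball_open.
have GC k : Ck_on k B G.
  elim: k => [x /BP xr|k IH].
    by apply: differentiable_continuous; have [] := dG x xr.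
  split=> [x /BP xr|v]; first by have [] := dG x xr.
  have /Ck_onS[_ /(_ (row_mx 0 v)) DC] := chart1_mul_smooth Ac k.+1.
  have rC : Ck_on k B (fun x => row_mx (G x) (0 : 'rV[R]_l)).
    by apply: Ck_on_row_mx => //; exact: Ck_on_cst.
  have rD x : B x -> chart1_mul_dom c (row_mx (G x) 0).
    by move=> /BP xr; rewrite -G0; apply: Hdom => //; rewrite normr0.
  apply: Ck_on_eq (Ck_on_comp_row oB (chart1_mul_open Ac) rD rC DC) => //.
  by move=> x /BP xr /=; have [_ ->] := dG x xr.
have EB : smooth_into B E.
  have GD x : B x -> chart1_dom c (G x).
    by move=> /BP xr; have [] := H x x xr xr.
  have := smooth_into_precomp oB (@chart1_open _ _ _ c) GD GC (chart1_inv_smooth Ac).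
  apply: smooth_into_eq => // x /BP xr /=.
  by rewrite chart1_mapK//; have [] := estE (lt_le_trans xr rd).
(* Away from 0, [E x = E x0 * E (x - x0)] reduces smoothness near [x0] to smoothness near 0. *)
apply/smooth_into_setT; apply: smooth_into_local => x0 _.
exists (ball x0 r); first by split; [exact: ball_open|exact: ballxx].
have oN : open (ball x0 r) by exact: ball_open.
have sh : smooth_on (ball x0 r) (fun x => x + - x0).
  move=> k; apply: Ck_on_add => //; last exact: Ck_on_cst.
  apply: (@Ck_on_linear _ _ _ _ _ (idfun : {linear 'rV[R]_l -> 'rV[R]_l})).
  exact: rV_linear_continuous.
have hB x : ball x0 r x -> B (x + - x0).
  by move=> /ball_normP xr; apply/ball_normP; rewrite subr0.
have := smooth_into_bin oN (@mul_smooth R l K)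
  (smooth_into_cst (ball x0 r) (E x0)) (smooth_into_precomp oN oB hB sh EB).
by apply: smooth_into_eq => // x _ /=; rewrite -homE addrC subrK.
Qed.

(** $G(y)-G(x)-(y-x)$ splits into $G(y)-G(x)-G(y-x)$, of order $|x||y-x|$ by the product estimate,
    and $G(y-x)-(y-x)$, of order $|y-x|^2$. On a small ball [G] is therefore close enough to the
    identity for [local_surjection]. *)
Lemma exp_locally_surjective (e : R) : 0 < e ->
  \forall k \near (1%g : K), exists2 x, `|x| < e & E x = k.
Proof.
move=> e0; have [r [r0 rd [Cm Cm0 H]]] := exp_radius.
have G0 : G 0 = 0 by rewrite /G (hom_exp0 homE) chart1_map1.
have Hdom x y : `|x| < r -> `|y| < r -> chart1_mul_dom c (row_mx (G x) (G y)).
  by move=> xr yr; have [] := H x y xr yr.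
have dG := exp_diff 0 r0 rd Hdom.
have P : 0 < 8 * Cm + 4 * C + 1 by rewrite ltr_wpDl// addr_ge0 ?mulr_ge0.
(* The two errors add up to $(4C_m+2C)\,s\,|y-x|$, at most half of $|y-x|$ by this choice; $r/3$
   ensures $|y-x|\le 2s<r$. *)
pose s := Num.min (r / 3) (8 * Cm + 4 * C + 1)^-1.
have s0 : 0 < s by rewrite lt_min divr_gt0// invr_gt0.
have sr : s <= r / 3 by rewrite ge_min lexx.
have sC : (8 * Cm + 4 * C) * s <= 1.
  apply: (@le_trans _ _ ((8 * Cm + 4 * C) * (8 * Cm + 4 * C + 1)^-1)).
    by rewrite ler_wpM2l ?addr_ge0 ?mulr_ge0// ge_min lexx orbT.
  by rewrite ler_pdivrMr// mul1r lerDl.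
have cG x : `|x| <= s -> {for x, continuous G}.
  move=> xs; apply: differentiable_continuous.
  by have [|//] := dG x; lra.
have HG x y : `|x| <= s -> `|y| <= s ->
    `|G y - G x - (y - x)| <= 2^-1 * `|y - x|.
  move=> xs ys.
  have yxs : `|y - x| <= 2 * s by apply: le_trans (ler_normB _ _) _; lra.
  have xr : `|x| < r by lra.
  have yxr : `|y - x| < r by lra.
  have [_ Gx _ Hm] := H _ _ xr yxr.
  have [_ Gyx _ _] := H _ _ yxr yxr.
  have xd := lt_le_trans xr rd; have yxd := lt_le_trans yxr rd.
  rewrite -exp_mul// [x + _]addrC subrK in Hm.
  have [_] := estE yxd; rewrite -/(G _) => He.
  have -> : G y - G x - (y - x) = (G y - G x - G (y - x)) + (G (y - x) - (y - x)).
    by rewrite addrA subrK.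
  apply: le_trans (ler_normD _ _) _.
  have n1 := normr_ge0 x; have n2 := normr_ge0 (y - x).
  have B1 : Cm * (`|G x| * `|G (y - x)|) <= Cm * ((2 * s) * (2 * `|y - x|)).
    by rewrite ler_wpM2l// ler_pM//; lra.
  have B2 : C * `|y - x| ^+ 2 <= C * (2 * s * `|y - x|).
    by rewrite ler_wpM2l// expr2 ler_wpM2r.
  have B3 : (8 * Cm + 4 * C) * s * `|y - x| <= 1 * `|y - x| by rewrite ler_wpM2r.
  lra.
have surj := local_surjection s0 G0 cG HG.
pose m := Num.min (s / 5) (Num.min (e / 4) (d / 4)).
have m0 : 0 < m by rewrite !lt_min !divr_gt0.
have nk : \forall k \near (1%g : K), `|kappa k| < m.
  have := chart1_map_cont c1; rewrite /prop_for /continuous_at chart1_map1.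
  move=> /cvgrPdist_lt/(_ m m0); apply: filterS => k.
  by rewrite sub0r normrN.
have nc : \forall k \near (1%g : K), chart_dom c k.
  by apply: open_nbhs_nbhs; split; [exact: chart_open_dom|].
apply: filterS2 nk nc => k; rewrite !lt_min => /and3P[k1 k2 k3] ck.
have [x xk Gxk] := surj (kappa k) (ltW k1).
have xd : `|x| < d by lra.
exists x; first by lra.
by rewrite -(chart1_mapK ck) -Gxk chart1_mapK//; have [] := estE xd.
Qed.

End ExpSmooth.

(** * Surjectivity of the exponential with bounded parameters *)

Section ExpSurjective.
Variables (R : realType) (l : nat) (K : lieGroupType R l).
Variables (E : 'rV[R]_l -> K).
Hypotheses (homE : forall x y, E (x + y) = (E x * E y)%g)
  (surjE : forall e : R, 0 < e ->
    \forall k \near (1%g : K), exists2 x, `|x| < e & E x = k).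

Lemma near_translate (P : K -> Prop) (k0 : K) : (\forall k \near (1%g : K), P k) ->
  \forall k \near k0, P (k0^-1 * k)%g.
Proof.
move=> P1; have [cmul _] := @mul_smooth R l K.
have cl : {for k0, continuous (fun k => k0^-1 * k)%g}.
  apply: (@continuous_comp _ _ _ (fun k => (k0^-1%g, k))
            (fun z : K * K => (z.1 * z.2)%g)); last exact: cmul.
  by apply: cvg_pair; [exact: cvg_cst|exact: cvg_id].
by apply: cl; rewrite mulVg.
Qed.

(** The image is a subgroup containing a neighbourhood of the identity, hence open; it is also
    closed, its complement being a union of translates. *)
Lemma exp_surjective : connected [set: K] -> forall k, exists x, E x = k.
Proof.
move=> conK.
have translate k0 : \forall k \near k0, exists x, (k0 * E x)%g = k.
  have := near_translate k0 (surjE ltr01); apply: filterS => k [x _ Ex].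
  by exists x; rewrite Ex mulVKg.
have oE : open (range E).
  rewrite openE => _ [x _ <-]; have := translate (E x).
  by apply: filterS => k [y <-]; exists (x + y).
have oCE : open (~` range E).
  rewrite openE => k kE; have := translate k.
  apply: filterS => _ [y <-] [x _ Ex]; apply: kE; exists (x - y) => //.
  by apply: (@mulIg _ (E y)); rewrite -homE subrK Ex.
have EK : range E = setT.
  apply: conK.
  - by exists (E 0), 0.
  - by exists (range E); rewrite ?setTI.
  - by exists (range E); rewrite ?setTI// -[X in closed X]setCK; exact: open_closedC.
by move=> k; have : [set: K] k by []; rewrite -EK => -[x _ <-]; exists x.
Qed.

(** If [k = E x], all points near [k] have a parameter of norm at most $|x|+1$, and compactness
    makes the bound uniform. The bounded set of parameters is needed twice: as a compact box
    replacing [K] when means are differentiated, and for cocompactness of the stabilizer lattice. *)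
Lemma exp_bounded_surjective : connected [set: K] -> compact [set: K] ->
  exists N : R, forall k, exists2 x, `|x| <= N & E x = k.
Proof.
move=> conK /compact_near_coveringP cK.
pose P (N : nat) (k : K) := exists2 x : 'rV[R]_l, `|x| <= N%:R & E x = k.
have : \forall N \near \oo, [set: K] `<=` P N.
  apply: cK => k _; have [x xk] := exp_surjective conK k.
  have nk := near_translate k (surjE ltr01).
  near=> k' N.
  have [y y1 yE] : exists2 x, `|x| < 1 & E x = (k^-1 * k')%g by near: k'.
  exists (x + y); last by rewrite homE xk yE mulVKg.
  apply: le_trans (ler_normD _ _) _; apply: (@le_trans _ _ (`|x| + 1)).
    by rewrite lerD2l ltW.
  by rewrite /=; near: N; exact: nbhs_infty_ger.
move=> [N _ HN]; exists N%:R => k; exact: (HN N (leqnn _) k I).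
Unshelve. all: by end_near. Qed.

End ExpSurjective.

Lemma torus_exp (R : realType) (l : nat) (K : lieGroupType R l) :
  torus_group K -> exists E : 'rV[R]_l -> K,
  [/\ forall x y, E (x + y) = (E x * E y)%g, smooth_from E,
      forall e : R, 0 < e ->
        \forall k \near (1%g : K), exists2 x, `|x| < e & E x = k &
      exists N : R, forall k, exists2 x, `|x| <= N & E x = k].
Proof.
move=> [cK conK comK]; have [c Ac c1] := @atlas_cover R l K 1%g.
have [E homE [C C0 [d d0 estE]]] := exp_exists cK comK Ac c1.
have surjE := exp_locally_surjective Ac c1 homE C0 d0 estE.
exists E; split=> //; first exact: (exp_smooth Ac c1 homE C0 d0 estE).
exact: exp_bounded_surjective.
Qed.

(** * Invariant bump functions *)

Section Mean.
Variables (R : realType) (K : groupType).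
Hypothesis comK : forall x y : K, (x * y = y * x)%g.
Implicit Types (f g : K -> R) (k h x : K) (s : seq K) (N : nat).

Definition average k N f x : R :=
  N.+1%:R^-1 * \sum_(i < N.+1) f (k ^+ i * x)%g.

Definition averages s N f : K -> R := foldr (fun k g => average k N g) f s.

Lemma average_le k N f (C : R) : (forall x, `|f x| <= C) ->
  forall x, `|average k N f x| <= C.
Proof.
move=> fC x; rewrite /average normrM ger0_norm ?invr_ge0//.
rewrite ler_pdivrMl//; apply: le_trans (ler_norm_sum _ _ _) _.
apply: le_trans (ler_sum _ (fun i _ => fC _)) _.
by rewrite sumr_const card_ord mulr_natl.
Qed.

Lemma averageD k N f g x :
  average k N (fun y => f y + g y) x = average k N f x + average k N g x.
Proof. by rewrite /average big_split mulrDr. Qed.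

Lemma averageZ k N (a : R) f x :
  average k N (fun y => a * f y) x = a * average k N f x.
Proof. by rewrite /average -mulr_sumr mulrCA. Qed.

Lemma average_cst k N (a : R) x : average k N (fun=> a) x = a.
Proof.
rewrite /average sumr_const card_ord -[a *+ _]mulr_natl mulrA mulVf ?mul1r//.
Qed.

Lemma average_translate k h N f x :
  average h N (fun y => f (k * y)%g) x = average h N f (k * x)%g.
Proof.
rewrite /average; congr (_ * _); apply: eq_bigr => i _; congr f.
by rewrite !mulgA [(k * _)%g]comK.
Qed.

(** The two sums differ by a shift of the index, so only the first and the last term survive. *)
Lemma average_self k N f (C : R) x : (forall y, `|f y| <= C) ->
  `|average k N f (k * x)%g - average k N f x| <= 2 * C / N.+1%:R.
Proof.
move=> fC; rewrite /average -mulrBr.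
have -> : \sum_(i < N.+1) f (k ^+ i * (k * x))%g - \sum_(i < N.+1) f (k ^+ i * x)%g
    = f (k ^+ N.+1 * x)%g - f x.
  rewrite big_ord_recr big_ord_recl /= expg0 mul1g.
  have -> : \sum_(i < N) f (k ^+ i * (k * x))%g =
            \sum_(i < N) f (k ^+ bump 0 i * x)%g.
    by apply: eq_bigr => i _; rewrite mulgA -expgSr.
  by rewrite mulgA -expgSr; ring.
rewrite normrM ger0_norm ?invr_ge0// mulrC ler_wpM2r ?invr_ge0//.
apply: le_trans (ler_normB _ _) _; have := fC (k ^+ N.+1 * x)%g.
by have := fC x; lra.
Qed.

Lemma averages_le s N f (C : R) : (forall x, `|f x| <= C) ->
  forall x, `|averages s N f x| <= C.
Proof. by move=> fC; elim: s => [//|k s IH]; exact: average_le. Qed.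

Lemma averagesD s N f g x :
  averages s N (fun y => f y + g y) x = averages s N f x + averages s N g x.
Proof.
elim: s x => [//|k s IH] x /=; rewrite -averageD.
by congr average; apply/funext => y; exact: IH.
Qed.

Lemma averagesZ s N (a : R) f x :
  averages s N (fun y => a * f y) x = a * averages s N f x.
Proof.
elim: s x => [//|k s IH] x /=; rewrite -averageZ.
by congr average; apply/funext => y; exact: IH.
Qed.

Lemma averages_cst s N (a : R) x : averages s N (fun=> a) x = a.
Proof.
elim: s x => [//|k s IH] x /=; rewrite -[RHS](average_cst k N a x).
by congr average; apply/funext => y; exact: IH.
Qed.

Lemma averages_translate k s N f x :
  averages s N (fun y => f (k * y)%g) x = averages s N f (k * x)%g.
Proof.
elim: s x => [//|h s IH] x /=; rewrite -average_translate.
by congr average; apply/funext => y; exact: IH.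
Qed.

(** In an abelian group averaging commutes with translation. The average over the powers of [k] can
    thus be estimated alone, and the other averages do not enlarge the bound. *)
Lemma averages_self k s N f (C : R) : k \in s -> (forall y, `|f y| <= C) ->
  forall x, `|averages s N f (k * x)%g - averages s N f x| <= 2 * C / N.+1%:R.
Proof.
move=> + fC; elim: s => [//|h s IH]; rewrite inE => /orP[/eqP <- x|ks x] /=.
  by apply: average_self; exact: averages_le.
rewrite -average_translate.
have -> : average h N (fun y => averages s N f (k * y)%g) x -
    average h N (averages s N f) x =
    average h N (fun y => averages s N f (k * y)%g + -1 * averages s N f y) x.
  by rewrite averageD averageZ mulN1r.
by apply: average_le => y; rewrite mulN1r; exact: IH.
Qed.

(* Averages over the powers of finitely many elements, in the limit along an
   ultrafilter; this stands for the Haar measure. *)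
Lemma invariant_mean : exists I : (K -> R) -> R, [/\
  forall f g (C D : R), (forall x, `|f x| <= C) -> (forall x, `|g x| <= D) ->
    I (fun x => f x + g x) = I f + I g,
  forall (a : R) f (C : R), (forall x, `|f x| <= C) -> I (fun x => a * f x) = a * I f,
  forall f (C : R), (forall x, `|f x| <= C) -> `|I f| <= C,
  I (fun=> 1) = 1 &
  forall k f (C : R), (forall x, `|f x| <= C) -> I (fun x => f (k * x)%g) = I f].
Proof.
(* Pairs are directed by inclusion of the lists and by size: each [k] is eventually in the list
   while [N] tends to infinity, so [averages_self] makes the limit invariant under [k]. *)
pose B (p : seq K * nat) := [set q : seq K * nat | {subset p.1 <= q.1} /\ (p.2 <= q.2)%N].
have FB : ProperFilter (filter_from [set: seq K * nat] B).
  apply: filter_from_proper; last by move=> p _; exists p; split.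
  apply: filter_from_filter; first by exists ([::], 0%N).
  move=> p q _ _; exists (p.1 ++ q.1, maxn p.2 q.2) => // r [/= rs rN].
  split; split.
  - by move=> k kp; apply: rs; rewrite mem_cat kp.
  - by apply: leq_trans rN; exact: leq_maxl.
  - by move=> k kp; apply: rs; rewrite mem_cat kp orbT.
  - by apply: leq_trans rN; exact: leq_maxr.
have [F [FU sF]] := ultraFilterLemma FB.
have FF : ProperFilter F := @ultra_proper _ _ FU.
pose A f (p : seq K * nat) := averages p.1 p.2 f 1%g.
pose I f := lim (A f @ F).
have cA f (C : R) : (forall x, `|f x| <= C) -> A f @ F --> I f.
  move=> fC; suff : cvg (A f @ F) by [].
  have AC p : `[-C, C]%classic (A f p).
    by rewrite /= in_itv /= -ler_norml; exact: averages_le.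
  have FA : (A f @ F) `[-C, C]%classic.
    by apply: (@filterS _ F FF setT) => [p _|]; [exact: AC|exact: filterT].
  have [p [_ clp]] := @segment_compact R (- C) C _ _ FA.
  apply/cvg_ex; exists p => Z pZ.
  have [//|nZ] := in_ultra_setVsetC (A f @^-1` Z) FU.
  by have /(_ (~` Z) Z nZ pZ)[q []] := clp.
have Ieq f (l : R) : A f @ F --> l -> I f = l.
  by move=> fl; apply: cvg_lim => //; exact: Rhausdorff.
exists I; split.
- move=> f g C D fC gD; apply: Ieq.
  have -> : A (fun x => f x + g x) = (fun p => A f p + A g p).
    by apply/funext => p; exact: averagesD.
  exact: cvgD (cA f C fC) (cA g D gD).
- move=> a f C fC; apply: Ieq.
  have -> : A (fun x => a * f x) = (fun p => a * A f p).
    by apply/funext => p; exact: averagesZ.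
  by apply: cvgM; [exact: cvg_cst|exact: (cA f C fC)].
- move=> f C fC; have AC p : `[-C, C]%classic (A f p).
    by rewrite /= in_itv /= -ler_norml; exact: averages_le.
  have nA : \forall p \near F, `[-C, C]%classic (A f p) by exact: nearW.
  have : `[-C, C]%classic (I f).
    apply: (@closed_cvg _ R F FF (A f) _ _ nA); last exact: (cA f C).
    exact: itv_closed.
  by rewrite /= in_itv /= -ler_norml.
- apply: Ieq; have -> : A (fun=> 1) = (fun=> 1).
    by apply/funext => p; exact: averages_cst.
  exact: cvg_cst.
- move=> k f C fC; apply: Ieq.
  have kC x : `|f (k * x)%g| <= C by exact: fC.
  have C0 : 0 <= C by apply: le_trans (fC 1%g).
  have dA : (fun p => A (fun x => f (k * x)%g) p - A f p) @ F --> (0 : R).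
    apply/cvgrPdist_le => e e0; apply: sF.
    have [N _ /(_ N (leqnn N)) HN] := nbhs_infty_ger (2 * C / e).
    exists ([:: k], N) => // -[s N'] [/= ks NN'].
    rewrite sub0r normrN /A /= averages_translate.
    apply: le_trans (averages_self _ _ fC _) _; first by apply: ks; rewrite inE.
    rewrite ler_pdivrMr// -ler_pdivrMl// [e^-1 * _]mulrC; apply: le_trans HN _.
    by rewrite ler_nat; apply: leq_trans NN' _.
  have -> : A (fun x => f (k * x)%g) =
      (fun p => (A (fun x => f (k * x)%g) p - A f p) + A f p).
    by apply/funext => p; rewrite subrK.
  by rewrite -[X in _ --> X]add0r; apply: cvgD dA (cA f C fC).
Qed.

End Mean.

(** * Differentiation under a mean *)

Section MeanSmooth.
Variables (R : realType) (n l : nat) (B : R) (J : ('rV[R]_l -> R) -> R).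
Local Notation bounded g C := (forall t : 'rV[R]_l, `|t| <= B -> `|g t| <= C).
Hypotheses
  (JD : forall f g (C D : R), bounded f C -> bounded g D ->
     J (fun t => f t + g t) = J f + J g)
  (JZ : forall (a : R) f (C : R), bounded f C -> J (fun t => a * f t) = a * J f)
  (Jle : forall f (C : R), bounded f C -> `|J f| <= C).

Lemma mean_sum (I : finType) (f : I -> 'rV[R]_l -> R) (C : I -> R) :
  (forall i, bounded (f i) (C i)) ->
  J (fun t => \sum_i f i t) = \sum_i J (f i).
Proof.
move=> fC.
have H (s : seq I) : J (fun t => \sum_(i <- s) f i t) = \sum_(i <- s) J (f i) /\
    bounded (fun t => \sum_(i <- s) f i t) (\sum_(i <- s) C i).
  elim: s => [|i s [IH1 IH2]].
    split; last by move=> t _; rewrite !big_nil normr0.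
    rewrite big_nil; apply/eqP; rewrite -normr_le0; apply: Jle => t _.
    by rewrite big_nil normr0.
  split; last first.
    move=> t tB; rewrite !big_cons; apply: le_trans (ler_normD _ _) _.
    by rewrite lerD//; [exact: fC|exact: IH2].
  rewrite big_cons -IH1 -(JD (fC i) IH2).
  by congr J; apply/funext => t; rewrite big_cons.
by have [] := H (index_enum I).
Qed.

Lemma meanB f g (C D : R) : bounded f C -> bounded g D ->
  J (fun t => f t - g t) = J f - J g.
Proof.
move=> fC gD; rewrite -mulN1r -(JZ (-1) gD).
have gD' : bounded (fun t => -1 * g t) D.
  by move=> t tB; rewrite mulN1r normrN; exact: gD.
by rewrite -(JD fC gD'); congr J; apply/funext => t; rewrite mulN1r.
Qed.

Lemma box_compact : compact [set t : 'rV[R]_l | `|t| <= B].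
Proof.
apply: bounded_closed_compact.
  by exists B; split; [exact: num_real|move=> C BC t /= tB; exact: le_trans (ltW BC)].
have cn : continuous (@Num.norm R 'rV[R]_l) by exact: norm_continuous.
rewrite (_ : mkset _ = Num.norm @^-1` [set x : R | x <= B])//.
by apply: ((continuous_closedP _).1 cn); exact: closed_le.
Qed.

Lemma row_mx_cont (x : 'rV[R]_n) (t : 'rV[R]_l) :
  {for (x, t), continuous (fun p : 'rV[R]_n * 'rV[R]_l => row_mx p.1 p.2)}.
Proof.
move=> A /nbhs_ballP[e /= e0 He].
have : nbhs (x, t) (ball x e `*` ball t e).
  by exists (ball x e, ball t e) => //=; split; exact: nbhsx_ballx.
apply: filterS => -[y s] [/= /ball_normP yx /ball_normP st]; apply: He.
apply/ball_normP; rewrite opp_row_mx add_row_mx.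
by apply: row_mx_norm_lt.
Qed.

Variable U : set 'rV[R]_n.
Hypothesis oU : open U.
Let W := [set z : 'rV[R]_(n + l) | U (lsubmx z)].

Lemma cylinder_row x t : U x -> W (row_mx x t).
Proof. by rewrite /W /= row_mxKl. Qed.

Lemma box_bounded (H : 'rV[R]_(n + l) -> R) x : U x ->
  (forall z, W z -> {for z, continuous H}) ->
  exists C, bounded (fun t => H (row_mx x t)) C.
Proof.
move=> Ux cH; have /compact_near_coveringP cB := box_compact.
have : \forall N \near \oo, [set t : 'rV[R]_l | `|t| <= B] `<=`
    (fun t => `|H (row_mx x t)| <= N%:R).
  apply: cB => t _.
  have cHt : {for t, continuous (fun t => H (row_mx x t))}.
    apply: (@continuous_comp _ _ _ (row_mx x) H); last exact/cH/cylinder_row.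
    by apply: differentiable_continuous; exact: row_mx_diff.
  have nt : \forall t' \near t, `|H (row_mx x t) - H (row_mx x t')| <= 1.
    by move/cvgrPdist_le : cHt => /(_ 1 ltr01).
  near=> t' N => /=.
  apply: (@le_trans _ _ (`|H (row_mx x t)| + 1)); last first.
    by near: N; exact: nbhs_infty_ger.
  rewrite -lerBlDl; apply: (@le_trans _ _ `|H (row_mx x t) - H (row_mx x t')|).
    by rewrite distrC; exact: lerB_dist.
  by near: t'.
by move=> [N _ HN]; exists N%:R => t tB; exact: (HN N (leqnn _) t tB).
Unshelve. all: by end_near. Qed.

(** Tube argument: joint continuity at each [(x, t)] becomes uniform in [t] by compactness of the
    box. *)
Lemma box_uniform (H : 'rV[R]_(n + l) -> R) x (e : R) : U x -> 0 < e ->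
  (forall z, W z -> {for z, continuous H}) ->
  \forall y \near x, forall t, `|t| <= B ->
    `|H (row_mx y t) - H (row_mx x t)| <= e.
Proof.
move=> Ux e0 cH; have /compact_near_coveringP cB := box_compact.
apply: (cB _ (nbhs x) (fun y t => `|H (row_mx y t) - H (row_mx x t)| <= e)) => t _.
have cHt : {for t, continuous (fun t => H (row_mx x t))}.
  apply: (@continuous_comp _ _ _ (row_mx x) H); last exact/cH/cylinder_row.
  by apply: differentiable_continuous; exact: row_mx_diff.
have cHxt : {for (x, t), continuous (fun p : 'rV[R]_n * 'rV[R]_l => H (row_mx p.1 p.2))}.
  apply: (@continuous_comp _ _ _ (fun p : 'rV[R]_n * 'rV[R]_l => row_mx p.1 p.2) H).
    exact: row_mx_cont.
  by apply: cH; exact: cylinder_row.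
have e2 : 0 < e / 2 by rewrite divr_gt0.
have nt : \forall t' \near t, `|H (row_mx x t) - H (row_mx x t')| <= e / 2.
  by move/cvgrPdist_le : cHt => /(_ _ e2).
have : \forall p \near (x, t), `|H (row_mx x t) - H (row_mx p.1 p.2)| <= e / 2.
  by move/cvgrPdist_le : cHxt => /(_ _ e2).
move=> [[P Q] /= [xP tQ] PQ].
exists (Q `&` (fun t' => `|H (row_mx x t) - H (row_mx x t')| <= e / 2), P) => /=.
  by split=> //; exact: filterI.
move=> [t' y] /= [[Qt' t't] Py].
have := PQ (y, t') (conj Py Qt'); move: t't => /=.
set h := H (row_mx x t); set h1 := H (row_mx y t'); set h2 := H (row_mx x t').
move=> A1 A2; have -> : h1 - h2 = (h - h2) - (h - h1) by ring.
by apply: le_trans (ler_normB _ _) _; lra.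
Qed.

Lemma row_mxl_diff (t : 'rV[R]_l) (x : 'rV[R]_n) :
  differentiable (fun y : 'rV[R]_n => row_mx y t) x /\
  forall v, 'D_v (fun y : 'rV[R]_n => row_mx y t) x = row_mx v 0.
Proof.
have -> : (fun y : 'rV[R]_n => row_mx y t) =
    mulmxr (row_mx 1%:M 0) + cst (row_mx 0 t) :> ('rV[R]_n -> 'rV[R]_(n + l)).
  apply/funext => z; rewrite /GRing.add /= mul_mx_row mulmx0 mulmx1.
  by rewrite add_row_mx add0r addr0.
split=> [|v].
  apply: differentiableD; last exact: differentiable_cst.
  exact: rV_linear_diff.
rewrite deriveD; last exact: derivable_cst.
  by rewrite derive_cst addr0 rV_linear_derive /= mul_mx_row mulmx0 mulmx1.
by apply: diff_derivable; exact: rV_linear_diff.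
Qed.

Let D v : ('rV[R]_(n + l) -> R) -> ('rV[R]_(n + l) -> R) :=
  fun H => 'D_(row_mx v 0 : 'rV[R]_(n + l)) H.

Lemma partial_sum (H : 'rV[R]_(n + l) -> R) z v : differentiable H z ->
  D v H z = \sum_i v 0 i * D (delta_mx 0 i) H z.
Proof.
move=> dH; rewrite /D.
have -> : row_mx v 0 = \sum_j v 0 j *: row_mx (delta_mx 0 j) 0 :> 'rV[R]_(n + l).
  rewrite {1}(row_sum_delta v); apply/rowP => i; rewrite summxE.
  case: (split_ordP i) => k ->.
    rewrite row_mxEl summxE; apply: eq_bigr => j _.
    by rewrite [LHS]mxE [RHS]mxE row_mxEl.
  by rewrite row_mxEr mxE big1// => j _; rewrite mxE row_mxEr mxE mulr0.
rewrite deriveE// linear_sum; apply: eq_bigr => j _.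
by rewrite linearZ/= deriveE.
Qed.

(** [J] is only additive, homogeneous and bounded by the sup norm on the box, so no integration
    theory is available. The candidate derivative [L] is built from the means of the partials; for
    each [t] the mean value theorem compares the increment of [H] with it, and [box_uniform] makes
    the error small for all [t] at once. *)
Lemma mean_diff (H : 'rV[R]_(n + l) -> R) x : U x -> Ck_on 1 W H ->
  differentiable (fun y => J (fun t => H (row_mx y t))) x /\
  forall v, 'D_v (fun y => J (fun t => H (row_mx y t))) x =
    J (fun t => D v H (row_mx x t)).
Proof.
move=> Ux HC; have /Ck_onS[dH DH] := HC.
have cH := Ck_on_cont HC.
have bd v : exists C, bounded (fun t => D v H (row_mx x t)) C.
  by apply: box_bounded => //; exact: Ck_on_cont (DH _).
have [CD HCD] := choice (fun i : 'I_n => bd (delta_mx 0 i)).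
pose b : 'cV[R]_n := \col_i J (fun t => D (delta_mx 0 i) H (row_mx x t)).
pose L : {linear 'rV[R]_n -> R} := (mxtrace \o mulmxr b)%FUN.
have LE u : L u = J (fun t => D u H (row_mx x t)).
  rewrite /L /= /mxtrace big_ord_recl big_ord0 addr0 mxE.
  under eq_bigr do rewrite mxE -(JZ _ (HCD _)).
  rewrite -(@mean_sum _ _ (fun i => `|u 0 i| * CD i)).
    by congr J; apply/funext => t; rewrite partial_sum//; exact/dH/cylinder_row.
  by move=> i t tB; rewrite normrM ler_wpM2l//; exact: HCD.
have [] := @near_diff R _ _ (fun y => J (fun t => H (row_mx y t))) x L.
- exact: rV_linear_continuous.
- move=> e e0.
  (* There are [n] partials to sum; [n.+1] avoids dividing by 0 when [n] is 0. *)
  have e1 : 0 < e / n.+1%:R by rewrite divr_gt0.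
  have : \forall y \near x, U y /\ forall i t, `|t| <= B ->
      `|D (delta_mx 0 i) H (row_mx y t) - D (delta_mx 0 i) H (row_mx x t)| <= e / n.+1%:R.
    apply: filterI; first exact: open_nbhs_nbhs.
    apply: (@filter_forall _ _ (fun i y => forall t, `|t| <= B ->
      `|D (delta_mx 0 i) H (row_mx y t) - D (delta_mx 0 i) H (row_mx x t)|
        <= e / n.+1%:R) (nbhs x)) => i.
    by apply: box_uniform => //; exact: Ck_on_cont (DH _).
  move=> /nbhs_ballP[d /= d0 Hd].
  apply/nbhs_ballP; exists d => //= h /ball_normP; rewrite subr0 => hd.
  have xb : ball x d (h + x) by apply/ball_normP; rewrite addrK.
  have [Uh _] := Hd _ xb.
  have [C1 HC1] := box_bounded Ux cH.
  have [C2 HC2] := box_bounded Uh cH.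
  have [C3 HC3] := bd h.
  have HC21 t : `|t| <= B -> `|H (row_mx (h + x) t) - H (row_mx x t)| <= C2 + C1.
    move=> tB; apply: le_trans (ler_normB _ _) _.
    by rewrite lerD//; [exact: HC2|exact: HC1].
  rewrite -[\tr _]/(L h) LE -(meanB HC2 HC1) -(meanB HC21 HC3).
  apply: Jle => t tB.
  pose f y := H (row_mx y t).
  have df y : U y -> differentiable f y /\ forall v, 'D_v f y = D v H (row_mx y t).
    move=> Uy; have [d1 D1] := row_mxl_diff t y.
    have d2 : differentiable H (row_mx y t) by apply: dH; exact: cylinder_row.
    split; first exact: (differentiable_comp d1 d2).
    by move=> v; rewrite /f (derive_comp v d1 d2) D1.
  have dfb y : ball x d y -> differentiable f y.
    by move=> /Hd[Uy _]; have [] := df y Uy.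
  have [s s01 E] := ball_MVT dfb (ballxx x d0) xb.
  have yb := ball_segment s01 (ballxx x d0) xb.
  move: E yb; rewrite addrK; set y := x + _ => E yb.
  have [Uy Hy] := Hd _ yb.
  rewrite -[H (row_mx (h + x) t)]/(f (h + x)) -[H (row_mx x t)]/(f x) E.
  have [_ ->] := df y Uy.
  rewrite !partial_sum; [|exact/dH/cylinder_row|exact/dH/cylinder_row].
  rewrite -sumrB; apply: le_trans (ler_norm_sum _ _ _) _.
  apply: (@le_trans _ _ (\sum_(i < n) `|h| * (e / n.+1%:R))).
    apply: ler_sum => i _; rewrite -mulrBr normrM ler_pM//; first exact: coord_le.
    exact: Hy.
  rewrite sumr_const card_ord -[_ *+ n]mulr_natr -mulrA mulrC ler_wpM2r//.
  by rewrite mulrAC ler_pdivrMr// ler_wpM2l ?ler_nat// ltW.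
move=> dG dGE; split=> // v; rewrite deriveE//.
by rewrite -LE -dGE.
Qed.

(** A directional derivative of a mean is the mean of a partial derivative, so the statement
    reproduces itself. *)
Lemma mean_smooth (H : 'rV[R]_(n + l) -> R) : smooth_on W H ->
  smooth_on U (fun x => J (fun t => H (row_mx x t))).
Proof.
move=> sH k; elim: k H sH => [|k IH] H sH.
  move=> x Ux; apply: differentiable_continuous.
  by have [] := mean_diff Ux (sH 1%N).
split=> [x Ux|v]; first by have [] := mean_diff Ux (sH 1%N).
have sDH : smooth_on W (D v H) by move=> j; have /Ck_onS[_] := sH j.+1; apply.
apply: Ck_on_eq (IH _ sDH) => // x Ux.
by have [_ ->] := mean_diff Ux (sH 1%N).
Qed.

End MeanSmooth.

Lemma rV_linear_smooth (R : realType) n (W : normedModType R)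
    (L : {linear 'rV[R]_n -> W}) (U : set 'rV[R]_n) : smooth_on U L.
Proof. by move=> k; apply: Ck_on_linear; exact: rV_linear_continuous. Qed.

(** * Averaging a bump function over the torus *)

Section InvariantBump.
Variables (R : realType) (l n : nat) (K : lieGroupType R l) (M : manifoldType R n).
Variable act : K -> M -> M.
Hypotheses (K_torus : torus_group K) (act_smooth : smooth_action act).

Lemma act_cont (T : topologicalType) (x : T) (g : T -> K) (h : T -> M) :
  {for x, continuous g} -> {for x, continuous h} ->
  {for x, continuous (fun y => act (g y) (h y))}.
Proof.
move=> cg ch; have [[cact _] _ _] := act_smooth.
apply: (@continuous_comp _ _ _ (fun y => (g y, h y)) (fun z : K * M => act z.1 z.2)).
  exact: (cvg_pair cg ch).
exact: cact.
Qed.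

(** Compactness of [K] is what makes the largest invariant subset of an open set open. *)
Lemma core_open (U : set M) : open U -> open [set p | forall k, U (act k p)].
Proof.
move=> oU; have [cK _ _] := K_torus; rewrite openE => p Up.
have : \forall q \near p, [set: K] `<=` (fun k => U (act k q)).
  move/compact_near_coveringP : cK; apply=> k _.
  have c2 : {for (k, p), continuous (fun z : K * M => act z.1 z.2)}.
    by have [[cact _] _ _] := act_smooth; exact: cact.
  have /c2 : nbhs (act k p) U by exact: open_nbhs_nbhs.
  by [].
by apply: filterS => q qU k; exact: qU.
Qed.

Lemma compact_group_bounded (f : K -> R) : continuous f ->
  exists C, forall k, `|f k| <= C.
Proof.
move=> cf; have [cK _ _] := K_torus.
have cn : {within [set: K], continuous (fun k => `|f k|)}.
  apply: continuous_subspaceT => k.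
  by apply: (@continuous_comp _ _ _ f Num.norm); [exact: cf|exact: norm_continuous].
have [|k _ kmax] := compact_EVT_max _ cK cn; first by exists 1%g.
by exists `|f k| => h; apply: kmax; rewrite inE.
Qed.

(** A bump at [m] supported in the invariant core of [U] is averaged over [K] and normalized at [m].
    Invariance is immediate; positivity of the average at [m] and its smoothness need work, because
    the mean is not known to be an integral. *)
Lemma invariant_bump (m : M) (U : set M) : open U -> group_orbit act m `<=` U ->
  exists rho : M -> R, [/\ smooth_fun rho, forall k p, rho (act k p) = rho p,
    rho m = 1 & forall p, ~ U p -> rho p = 0].
Proof.
move=> oU mU; have [cK conK comK] := K_torus.
have [sact act1 actM] := act_smooth.
pose V := [set p | forall k, U (act k p)].
have oV : open V by exact: core_open.
have Vm : V m by move=> k; apply: mU; exists k.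
have [b [sb b0 bm bge0]] := bump_exists oV Vm.
have [E [homE sE _ [N HN]]] := torus_exp K_torus.
have H0 k : exists t, `|t| <= N /\ E t = k by have [t tN tk] := HN k; exists t.
have [tau Htau] := choice H0.
have [I [ID IZ Ile I1 Iinv]] := invariant_mean R comK.
have cb : continuous b by exact: smooth_fun_continuous.
have bdd p : exists C, forall k, `|b (act k p)| <= C.
  apply: compact_group_bounded => k.
  apply: (@continuous_comp _ _ _ (fun k => act k p) b); last exact: cb.
  by apply: (@act_cont _ _ id (cst p)); [exact: cvg_id|exact: cst_continuous].
pose rho0 p := I (fun k => b (act k p)).
have rhoK k p : rho0 (act k p) = rho0 p.
  have [C HC] := bdd p; rewrite /rho0 -(Iinv k _ C HC).
  by congr I; apply/funext => h; rewrite -actM comK.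
have rhoU p : ~ U p -> rho0 p = 0.
  move=> Up; have z k : b (act k p) = 0.
    apply: b0 => /(_ k^-1%g); rewrite -actM mulVg act1; exact: Up.
  apply/eqP; rewrite -normr_le0; apply: Ile => k.
  by rewrite z normr0.
(* Finitely many translates of the open set where the bump exceeds 1/2 along the orbit cover [K].
   The sum of the corresponding translates of the bump is at least 1/2 everywhere, and by invariance
   its mean is [(size s)%:R * rho0 m]. *)
have rho_ge0 : 0 < rho0 m.
  have [C HC] := bdd m.
  have [s Hs] : exists s : seq K, forall k, exists2 h, h \in s & 2^-1 < b (act (h * k)%g m).
    pose B (s0 : seq K) := [set s : seq K | {subset s0 <= s}].
    have FB : Filter (filter_from [set: seq K] B).
      apply: filter_from_filter; first by exists [::].
      move=> s t _ _; exists (s ++ t) => // r rs.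
      by split=> k ks; apply: rs; rewrite mem_cat ks ?orbT.
    have : \forall s \near filter_from [set: seq K] B, [set: K] `<=`
        (fun k => exists2 h, h \in s & 2^-1 < b (act (h * k)%g m)).
      move/compact_near_coveringP : cK; apply=> k _.
      pose P (h : K) : Prop := 2^-1 < b (act h m).
      have P1 : \forall h \near (1%g : K), P h.
        have c1 : {for 1%g : K, continuous (b \o (fun h => act h m))}.
          apply: continuous_comp; last exact: cb.
          by apply: (@act_cont _ _ id (cst m)); [exact: cvg_id|exact: cst_continuous].
        have h0 : 0 < 2^-1 :> R by rewrite invr_gt0.
        move/cvgrPdist_lt : c1 => /(_ _ h0).
        apply: filterS => h; rewrite /= act1 bm /P => h1.
        have := le_lt_trans (ler_norm _) h1; lra.
      exists (fun k' => P (k^-1 * k')%g, B [:: k^-1%g]) => /=.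
        by split; [exact: near_translate|exists [:: k^-1%g]].
      move=> [k' s] /= [Pk' ks]; exists k^-1%g => //.
      by apply: ks; rewrite inE.
    move=> [s _ Hs]; exists s => k; exact: (Hs s _ k Logic.I).
  have key (r : seq K) : I (fun k => \sum_(h <- r) b (act (h * k)%g m)) =
      (size r)%:R * rho0 m /\
      forall k, `|\sum_(h <- r) b (act (h * k)%g m)| <= (size r)%:R * C.
    elim: r => [|h r [IH1 IH2]].
      split=> [|k]; last by rewrite big_nil normr0 mul0r.
      rewrite mul0r; apply/eqP; rewrite -normr_le0; apply: Ile => k.
      by rewrite big_nil normr0.
    have HhC k : `|b (act (h * k)%g m)| <= C by exact: HC.
    rewrite /= -natr1 !mulrDl !mul1r; split=> [|k].
      rewrite -IH1 /rho0 -(Iinv h _ C HC) addrC -(ID _ _ _ _ HhC IH2).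
      by congr I; apply/funext => k; rewrite big_cons.
    rewrite big_cons addrC; apply: le_trans (ler_normD _ _) _.
    by rewrite lerD.
  have [K1 K2] := key s.
  have K3 : 2^-1 <= (size s)%:R * rho0 m.
    (* The mean only satisfies a bound on absolute values. A lower bound is extracted by applying it
       to [D] minus the sum, which lies between 0 and [D - 2^-1]. *)
    rewrite -K1; pose D := (size s)%:R * C.
    have K4 k : `|D + -1 * \sum_(h <- s) b (act (h * k)%g m)| <= D - 2^-1.
      have sum_ge : 2^-1 <= \sum_(h <- s) b (act (h * k)%g m).
        have [h hs hb] := Hs k.
        rewrite (big_rem h)//=; apply: le_trans (ltW hb) _; rewrite lerDl.
        by apply: sumr_ge0 => g _; exact: bge0.
      have := K2 k; rewrite -/D ler_norml => /andP[_ sum_le].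
      by rewrite ger0_norm; lra.
    have K5 k : `|-1 * \sum_(h <- s) b (act (h * k)%g m)| <= D.
      by rewrite mulN1r normrN.
    have K6 : forall k : K, `|D * 1| <= `|D| by move=> _; rewrite mulr1.
    have := Ile _ _ K4.
    have -> : (fun k => D + -1 * \sum_(h <- s) b (act (h * k)%g m)) =
        (fun k => D * 1 + -1 * \sum_(h <- s) b (act (h * k)%g m)).
      by apply/funext => k; rewrite mulr1.
    rewrite (ID _ _ _ _ K6 K5) (IZ D _ 1) ?I1 => [|k]; last by rewrite normr1.
    rewrite (IZ _ _ D K2) mulr1 mulN1r => /ler_normlW.
    by rewrite lerD2l lerN2.
  have s0 : 0 <= (size s)%:R :> R by exact: ler0n.
  nra.
exists (fun p => (rho0 m)^-1 * rho0 p); split.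
- apply: smooth_fun_mul; first exact: smooth_fun_cst.
  move=> c Ac k.
  (* Composition with [tau], a section of [E] with values in the box and with no continuity, turns
     the mean over [K] into a functional on functions of a vector parameter, as [mean_smooth]
     requires. *)
  pose J (g : 'rV[R]_l -> R) := I (g \o tau).
  have Hn t : `|tau t| <= N by have [] := Htau t.
  have Ht k' : E (tau k') = k' by have [] := Htau k'.
  pose H (z : 'rV[R]_(n + l)) := b (act (E (rsubmx z)) (chart_inv c (lsubmx z))).
  have oc : open (chart_cod c) by exact: chart_open_cod.
  pose W := [set z : 'rV[R]_(n + l) | chart_cod c (lsubmx z)].
  have oW : open W.
    have : continuous (@lsubmx R 1 n l).
      exact: (@rV_linear_continuous _ _ _ (@lsubmx R 1 n l : {linear _ -> _})).
    by move=> /continuousP; apply.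
  have sH : smooth_on W H.
    have s1 : smooth_into W (E \o @rsubmx R 1 n l).
      apply: (@smooth_into_precomp _ _ _ _ _ _ setT (@rsubmx R 1 n l) E) => //.
      - exact: openT.
      - exact: (rV_linear_smooth (@rsubmx R 1 n l : {linear _ -> _})).
      - exact/smooth_into_setT.
    have s2 : smooth_into W (chart_inv c \o @lsubmx R 1 n l).
      apply: (@smooth_into_precomp _ _ _ _ _ _ _ (@lsubmx R 1 n l) (chart_inv c)
                oW oc) => //.
      - exact: (rV_linear_smooth (@lsubmx R 1 n l : {linear _ -> _})).
      - exact: chart_inv_smooth.
    exact: (smooth_into_fun oW (smooth_into_bin oW sact s1 s2) sb).
  have JD f g (C D : R) : (forall t, `|t| <= N -> `|f t| <= C) ->
      (forall t, `|t| <= N -> `|g t| <= D) ->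
      J (fun t => f t + g t) = J f + J g.
    move=> fC gD; apply: (ID (f \o tau) (g \o tau) C D) => k' /=.
      by apply: fC.
    by apply: gD.
  have JZ (a : R) f (C : R) : (forall t, `|t| <= N -> `|f t| <= C) ->
      J (fun t => a * f t) = a * J f.
    by move=> fC; apply: (IZ a (f \o tau) C) => k' /=; apply: fC.
  have Jle f (C : R) : (forall t, `|t| <= N -> `|f t| <= C) -> `|J f| <= C.
    by move=> fC; apply: Ile => k' /=; apply: fC.
  have := mean_smooth JD JZ Jle oc sH k.
  apply: Ck_on_eq => // x cx; rewrite /= /J /rho0 /comp /H.
  by congr I; apply/funext => k'; rewrite row_mxKl row_mxKr Ht.
- by move=> k p; rewrite rhoK.
- by rewrite mulVf// gt_eqF.
- by move=> p Up; rewrite (rhoU _ Up) mulr0.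
Qed.

End InvariantBump.

(** * Lattices and dense lines *)

Section Lattice.
Variables (R : realType) (r : nat) (L : set 'rV[R]_r).
Hypotheses (L0 : L 0) (LB : forall x y, L x -> L y -> L (x - y)).
Variables (e : R) (N : R).
Hypotheses (e0 : 0 < e) (Le : forall x, L x -> `|x| < e -> x = 0)
  (LN : forall x, exists2 y, `|y| <= N & L (x - y)).

Lemma latticeD x y : L x -> L y -> L (x + y).
Proof. by move=> Lx Ly; rewrite -[y]opprK; apply: LB => //; rewrite -sub0r; exact: LB. Qed.

Lemma latticeZ (a : R) x : a \is a Num.int -> L x -> L (a *: x).
Proof.
move=> /intrP[m ->] Lx.
have Ln k : L (k%:R *: x).
  elim: k => [|k IH]; first by rewrite scale0r.
  by rewrite -natr1 scalerDl scale1r; exact: latticeD.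
case: m => k; first exact: Ln.
by rewrite NegzE mulrNz scaleNr -sub0r; apply: LB => //; exact: Ln.
Qed.

(** Every vector is within distance [N] of [L]. If [L] were inside the span of [W], a nonzero linear
    map killing that span would be bounded on the whole space; the scaling [s] violates this
    bound. *)
Lemma lattice_not_sub j (W : 'M[R]_(j, r)) : (j < r)%N ->
  exists2 b, L b & ~~ (b <= W)%MS.
Proof.
move=> jr; apply: contrapT => H.
have LW b : L b -> (b <= W)%MS.
  by move=> Lb; apply: contrapT => /negP bW; apply: H; exists b.
have C0 : cokermx W != 0.
  rewrite -mxrank_eq0 mxrank_coker subn_eq0 -ltnNge.
  by apply: leq_ltn_trans jr; exact: rank_leq_row.
have [i Ci] : exists i, row i (cokermx W) != 0.
  apply: contrapT => /forallNP H0; move/eqP: C0; apply; apply/row_matrixP => i.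
  by rewrite row0; apply/eqP/negPn/negP => /(H0 i).
pose x : 'rV[R]_r := delta_mx 0 i.
have xC : x *m cokermx W != 0 by rewrite -rowE.
pose f : {linear 'rV[R]_r -> 'rV[R]_r} := mulmxr (cokermx W).
have [k k0 Hk] := linear_lipschitz (@rV_linear_continuous _ _ _ f).
have n0 : 0 < `|x *m cokermx W| by rewrite normr_gt0.
pose s := (k * `|N| + 1) / `|x *m cokermx W|.
have [y yN Ly] := LN (s *: x).
have := LW _ Ly; rewrite submxE mulmxBl subr_eq0 -scalemxAl => /eqP E.
have := Hk y; rewrite /f /= -E normrZ ger0_norm; last first.
  by rewrite divr_ge0// addr_ge0// mulr_ge0// ltW.
rewrite divfK ?gt_eqF//; apply/negP; rewrite -ltNge.
apply: (@le_lt_trans _ _ (k * `|N|)); last by rewrite ltrDl.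
by apply: ler_wpM2l; [exact: ltW|apply: le_trans yN _; exact: ler_norm].
Qed.

Lemma row_free_col_mx j (b : 'rV[R]_r) (W : 'M[R]_(j, r)) :
  ~~ (b <= W)%MS -> row_free W -> row_free (col_mx b W).
Proof.
move=> bW fW; apply/inj_row_free => v.
rewrite -[v]hsubmxK mul_row_col [lsubmx v]mx11_scalar mul_scalar_mx.
set a := lsubmx v 0 0; set u := rsubmx v.
have [-> |a0 E] := eqVneq a 0.
  rewrite scale0r add0r => /eqP; rewrite mulmx_free_eq0// => /eqP ->.
  by rewrite raddf0 row_mx0.
case/negP: bW; have -> : b = (- a^-1 *: u) *m W.
  rewrite -scalemxAl; apply: (scalerI a0).
  rewrite scalerA mulrN divff// scaleN1r.
  by apply/eqP; rewrite -addr_eq0 E.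
exact: submxMl.
Qed.

(** Points of [A] close to a given limit point are closer than [d] to each other, hence equal. *)
Lemma separated_closed j (A : set 'rV[R]_j) (d : R) : 0 < d ->
  (forall x y, A x -> A y -> `|x - y| < d -> x = y) -> closed A.
Proof.
move=> d0 sA p clp.
have d2 : 0 < d / 2 by rewrite divr_gt0.
have [z [Az /ball_normP zp]] := clp _ (nbhsx_ballx p _ d2).
have [<-//|zNp] := eqVneq z p.
have m0 : 0 < Num.min (d / 2) `|z - p|.
  by rewrite lt_min d2 normr_gt0 subr_eq0.
have [y [Ay /ball_normP]] := clp _ (nbhsx_ballx p _ m0).
rewrite lt_min => /andP[yp yz].
have E : z = y.
  apply: sA => //; have -> : z - y = (z - p) - (y - p) by rewrite opprB addrA subrK.
  by apply: le_lt_trans (ler_normB _ _) _; lra.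
by move: yz; rewrite E ltxx.
Qed.

(* The new basis vector has the least positive component outside the span of the
   previous ones. *)
Lemma lattice_basis j : (j <= r)%N -> exists2 W : 'M[R]_(j, r), row_free W &
  forall x : 'rV[R]_j, L (x *m W) <-> forall i, x 0 i \is a Num.int.
Proof.
elim: j => [_|j IH jr].
  exists 0; first by rewrite /row_free mxrank0.
  by move=> x; rewrite mulmx0; split=> // _ [].
have E00 : (0 : 'I_(1 + j)) = lshift j 0 by exact/val_inj.
have [W fW HW] := IH (ltnW jr).
have [b Lb bW] := lattice_not_sub W jr.
pose W' : 'M[R]_(1 + j, r) := col_mx b W.
have fW' : row_free W' by exact: row_free_col_mx.
have lW (u : 'rV[R]_j) : (forall i, u 0 i \is a Num.int) -> L (u *m W) by move=> /HW.
pose f : {linear 'rV[R]_(1 + j) -> 'rV[R]_r} := mulmxr W'.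
have [k k0 Hk] := linear_lipschitz (@rV_linear_continuous _ _ _ f).
(* Coordinates in the basis [(b, W)]: entry 0 is the component outside the span of [W]. Discreteness
   of [L] makes [A] separated, hence closed, and the bound 1 makes it compact. The bound loses
   nothing, since the other coordinates can be reduced modulo integers and [b] itself belongs to
   [A]. *)
pose A := [set z : 'rV[R]_(1 + j) | [/\ `|z| <= 1, 0 < z 0 0 & L (z *m W')]].
have sepA x y : A x -> A y -> `|x - y| < e / k -> x = y.
  move=> [_ _ Lx] [_ _ Ly] xy; apply/eqP; rewrite -subr_eq0.
  rewrite -(mulmx_free_eq0 _ fW'); apply/eqP; apply: Le.
    by rewrite mulmxBl; exact: LB.
  apply: le_lt_trans (Hk (x - y)) _.
  by rewrite mulrC -ltr_pdivlMr.
have cA : compact A.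
  apply: bounded_closed_compact.
    exists 1; split; first exact: num_real.
    by move=> M M1 x [x1 _ _]; exact: le_trans (ltW M1).
  by apply: (separated_closed _ sepA); rewrite divr_gt0.
have A1 : A (row_mx 1 0).
  split.
  - apply: row_mx_norm_le; last by rewrite normr0.
    by apply: row_norm_le => // i; rewrite ord1 mxE normr1.
  - by rewrite E00 row_mxEl mxE.
  - by rewrite mul_row_col mul1mx mul0mx addr0.
have [||z Az zmin] := @compact_EVT_min _ _ (fun z : 'rV[R]_(1 + j) => z 0 0) A _ cA.
- by exists (row_mx 1 0).
- apply: continuous_subspaceT; exact: coord_continuous.
move: Az; rewrite inE => -[z1 zp Lz].
pose t0 := z 0 0; pose x0 : 'rV[R]_j := rsubmx z.
have zE : z *m W' = t0 *: b + x0 *m W.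
  rewrite -{1}[z]hsubmxK mul_row_col [lsubmx z]mx11_scalar mul_scalar_mx.
  congr (_ *: _ + _); rewrite mxE; congr (z _ _); exact/val_inj.
pose w := z *m W'.
have wW : ~~ (w <= W)%MS.
  apply: contra bW => /submxP[D wD].
  have -> : b = t0^-1 *: (D - x0) *m W.
    rewrite -scalemxAl mulmxBl -wD /w zE addrK scalerA mulVf ?scale1r//.
    by rewrite gt_eqF.
  exact: submxMl.
exists (col_mx w W); first exact: row_free_col_mx.
change (forall x : 'rV[R]_(1 + j), L (x *m (col_mx w W : 'M[R]_(1 + j, r))) <->
  forall i : 'I_(1 + j), x 0 i \is a Num.int).
move=> x; pose a := x 0 0; pose u : 'rV[R]_j := rsubmx x.
have xE : x *m (col_mx w W : 'M[R]_(1 + j, r)) = a *: w + u *m W.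
  rewrite -{1}[x]hsubmxK mul_row_col [lsubmx x]mx11_scalar mul_scalar_mx.
  congr (_ *: _ + _); rewrite mxE; congr (x _ _); exact/val_inj.
have xi : (forall i, x 0 i \is a Num.int) <->
    a \is a Num.int /\ forall i, u 0 i \is a Num.int.
  split=> [H|[Ha Hu] i]; first by split=> [|i]; rewrite ?mxE; exact: H.
  case: (@split_ordP 1 j i) => h ->; last by have := Hu h; rewrite mxE.
  by move: Ha; rewrite /a; congr (x 0 _ \is a _); rewrite ord1; exact/val_inj.
rewrite xE xi; split=> [Lx|[Ha Hu]]; last first.
  by apply: latticeD; [exact: latticeZ|exact: lW].
(* Removing [q] times [w] and an integer combination of the rows of [W] leaves an element of [L]
   whose coordinates are in the unit box and whose first one is [f0 * t0 < t0]. Minimality forces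
   [f0 = 0], and the rest lies in the span of [W]. *)
pose q := Num.floor a; pose f0 := a - q%:~R.
have f00 : 0 <= f0 by rewrite subr_ge0 floor_le_tmp.
have f01 : f0 < 1 by rewrite ltrBlDl; have := lt_succ_floor a; rewrite intrD.
pose y := f0 *: x0 + u.
pose fy : 'rV[R]_j := \row_i (Num.floor (y 0 i))%:~R.
have Lfy : L (fy *m W) by apply: lW => i; rewrite mxE; exact: intr_int.
have Lf : L (f0 *: w + u *m W).
  have -> : f0 *: w + u *m W = (a *: w + u *m W) - q%:~R *: w.
    by rewrite /f0 scalerBl addrAC.
  by apply: LB => //; apply: latticeZ => //; exact: intr_int.
have Lf' : L ((f0 * t0) *: b + (y - fy) *m W).
  have -> : (f0 * t0) *: b + (y - fy) *m W = (f0 *: w + u *m W) - fy *m W.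
    rewrite /w zE /y mulmxBl mulmxDl -scalemxAl scalerDr scalerA.
    by rewrite !addrA.
  exact: LB.
have f0E : f0 = 0.
  apply/eqP; rewrite eq_le f00 andbT leNgt; apply/negP => f0p.
  have t1 : t0 <= 1.
    by apply: le_trans z1; apply: le_trans (ler_norm _) _; exact: coord_le.
  have ft : f0 * t0 < t0 by rewrite gtr_pMl.
  have ftp : 0 < f0 * t0 by rewrite mulr_gt0.
  have z0 : (row_mx ((f0 * t0)%:M : 'rV[R]_1) (y - fy)) 0 0 = f0 * t0.
    by rewrite E00 row_mxEl mxE.
  have Ay : A (row_mx ((f0 * t0)%:M : 'rV[R]_1) (y - fy)).
    split.
    - apply: row_mx_norm_le; apply: row_norm_le => // i; rewrite ?ord1 !mxE.
        by rewrite mulr1n gtr0_norm// ltW// (lt_le_trans ft).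
      rewrite ger0_norm ?subr_ge0 ?floor_le_tmp//.
      have := lt_succ_floor (y 0 i); rewrite intrD !mxE; lra.
    - by rewrite z0.
    - by rewrite mul_row_col mul_scalar_mx.
  have := zmin (row_mx ((f0 * t0)%:M : 'rV[R]_1) (y - fy)).
  rewrite inE => /(_ Ay); rewrite z0 leNgt => /negP; apply.
  exact: ft.
have aq : a = q%:~R by apply/eqP; rewrite -subr_eq0; apply/eqP.
split; first by rewrite aq; exact: intr_int.
by apply/HW; move: Lf; rewrite f0E scale0r add0r.
Qed.

End Lattice.

(** * A line that is dense modulo the integer lattice *)

Section DenseLine.
Variable R : realType.

Lemma floor_row n (x : 'rV[R]_n) : exists2 z : 'rV[R]_n,
  (forall i, z 0 i \is a Num.int) & `|x - z| <= 1.
Proof.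
exists (\row_i (Num.floor (x 0 i))%:~R) => [i|]; first by rewrite mxE intr_int.
apply: row_norm_le => // i; rewrite !mxE ger0_norm ?subr_ge0 ?floor_le_tmp//.
have := lt_succ_floor (x 0 i); rewrite intrD; lra.
Qed.

Lemma rat_row n (x : 'rV[R]_n) (e : R) : 0 < e ->
  exists q : 'rV[rat]_n, `|map_mx ratr q - x| < e.
Proof.
move=> e0; have H i : exists q : rat, `|ratr q - x 0 i| < e.
  have [|q] := @rat_in_itvoo R (x 0 i - e) (x 0 i + e); first lra.
  rewrite in_itv /= => /andP[q1 q2]; exists q.
  by rewrite ltr_norml; apply/andP; split; lra.
have [q Hq] := choice H; exists (\row_i q i).
by apply: row_norm_lt => // i; rewrite !mxE.
Qed.

(* A generic vector has this property, by the Baire category theorem. *)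
Lemma dense_line n : exists a : 'rV[R]_n, forall (y : 'rV[R]_n) (e : R), 0 < e ->
  exists t : R, exists2 z : 'rV[R]_n,
    forall i, z 0 i \is a Num.int & `|t *: a - y - z| < e.
Proof.
pose V : completeNormedModType R := HB.pack 'rV[R]_n (Complete.class 'rV[R]_n).
pose G (q : 'rV[rat]_n) (k : nat) := [set a : 'rV[R]_n | exists t : R,
  exists2 z : 'rV[R]_n, forall i, z 0 i \is a Num.int &
    `|t *: a - map_mx ratr q - z| < k.+1%:R^-1].
(* Countably many open dense conditions: a rational target and a precision $1/(k+1)$ for each index;
   indices that encode no pair impose nothing. *)
pose F (i : nat) : set V := if unpickle i is Some p then G p.1 p.2 else setT.
have H i : open (F i) /\ dense (F i).
  rewrite /F; case: (unpickle i) => [[q k]|]; last first.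
    split; first exact: openT.
    by move=> O O0 oO; rewrite setIT.
  split.
    rewrite openE => a [t [z zi ta]].
    pose d := k.+1%:R^-1 - `|t *: a - map_mx ratr q - z|.
    have d0 : 0 < d by rewrite subr_gt0.
    have t1 : 0 < `|t| + 1 by rewrite ltr_wpDl.
    apply/nbhs_ballP; exists (d / (`|t| + 1)); first by rewrite /= divr_gt0.
    move=> b /ball_normP ba; exists t; exists z => //.
    have -> : t *: b - map_mx ratr q - z =
        t *: (b - a) + (t *: a - map_mx ratr q - z).
      by rewrite scalerBr !addrA subrK.
    apply: le_lt_trans (ler_normD _ _) _; rewrite -ltrBrDr -/d normrZ.
    apply: (@le_lt_trans _ _ ((`|t| + 1) * `|b - a|)).
      by rewrite ler_wpM2r// lerDl.
    by rewrite mulrC -ltr_pdivlMr.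
  move=> O [a0 Oa0] oO.
  have /nbhs_ballP[e /= e0 He] := open_nbhs_nbhs (conj oO Oa0).
  (* The target is moved by an integer row to within 1 of [t *: a0]; after division by [t] the
     displacement of [a0] is at most [e / 2]. *)
  pose t := 2 / e; have t0 : 0 < t by rewrite divr_gt0.
  have [z zi xz] := floor_row (t *: a0 - map_mx ratr q).
  exists (t^-1 *: (map_mx ratr q + z) : 'rV[R]_n); split.
    apply: He; apply/ball_normP.
    have -> : t^-1 *: (map_mx ratr q + z) - a0 =
        - (t^-1 *: (t *: a0 - map_mx ratr q - z)).
      rewrite -addrA -opprD scalerBr scalerA mulVf ?gt_eqF// scale1r.
      by rewrite opprB.
    rewrite normrN normrZ gtr0_norm ?invr_gt0//.
    apply: (@le_lt_trans _ _ (t^-1 * 1)); first by rewrite ler_wpM2l// invr_ge0 ltW.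
    rewrite /t invf_div mulr1; lra.
  exists t; exists z => //.
  rewrite scalerA divff ?gt_eqF// scale1r -addrA -opprD subrr normr0.
  by rewrite invr_gt0.
have [|a [_ Ha]] := @Baire R V F H setT _ openT; first by exists 0.
exists a => y e e0.
have e2 : 0 < e / 2 by rewrite divr_gt0.
have [q qy] := rat_row y e2.
have [k _ /(_ k (leqnn k)) Hk] := near_infty_natSinv_lt (PosNum e2).
have := Ha (pickle (q, k)) I; rewrite /F pickleK => -[t [z zi ta]].
exists t; exists z => //.
have -> : t *: a - y - z = (t *: a - map_mx ratr q - z) + (map_mx ratr q - y).
  by rewrite [RHS]addrAC addrA subrK.
apply: le_lt_trans (ler_normD _ _) _; rewrite (splitr e) ltrD//.
exact: lt_trans ta Hk.
Qed.

End DenseLine.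

(** * Integral curves and one-parameter subgroups *)

Section Curves.
Variable R : realType.

Lemma velocity_cont n (M : manifoldType R n) (phi : R -> M) t v :
  velocity phi t v -> {for t, continuous phi}.
Proof.
move=> vphi; apply: smooth_continuous => f sf.
apply: differentiable_continuous; apply/derivable1_diffP.
by have [] := vphi f sf.
Qed.

(** In the chart the field is Lipschitz with constant [C]. On an interval of half-length [b] the
    maximal distance of the two curves is at most $bC$ times itself, with $bC\le 1/2$, hence 0. *)
Lemma integral_curve_local n (M : manifoldType R n) (X : M -> functional M)
    (phi1 phi2 : R -> M) (t0 : R) : vector_field X ->
  (forall t, velocity phi1 t (X (phi1 t))) ->
  (forall t, velocity phi2 t (X (phi2 t))) ->
  phi1 t0 = phi2 t0 -> \forall t \near t0, phi1 t = phi2 t.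
Proof.
move=> [_ sX] v1 v2 p12; set p := phi1 t0.
have [c Ac cp] := atlas_cover p.
have [F [sF HF]] := chart_coordinates Ac cp.
pose a := chart_map c p.
have ca : chart_cod c a by exact: chart_map_cod.
pose G (x : 'rV[R]_n) : 'rV[R]_n := \row_i X (chart_inv c x) (F i).
have oc : open (chart_cod c) by exact: chart_open_cod.
have GC : Ck_on 1 (chart_cod c) G.
  apply/(Ck_on_rowP _ _ oc) => i.
  have := sX _ (sF i) c Ac 1%N; apply: Ck_on_eq => // x cx.
  by rewrite mxE.
have [r r0 [C C0 [rU HC]]] := C1_lipschitz_row oc ca GC.
have nc : \forall q \near p, chart_dom c q /\ ball a r (chart_map c q).
  apply: filterI; first exact: (open_nbhs_nbhs (conj (chart_open_dom c) cp)).
  by apply: (chart_map_cont cp); exact: nbhsx_ballx.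
have cphi1 : {for t0, continuous phi1} by exact: velocity_cont (v1 t0).
have cphi2 : {for t0, continuous phi2} by exact: velocity_cont (v2 t0).
have near1 : \forall t \near t0, (chart_dom c (phi1 t) /\ forall i, F i (phi1 t) =
    chart_map c (phi1 t) 0 i) /\ (chart_dom c (phi1 t) /\ ball a r (chart_map c (phi1 t))).
  by apply: filterI; [exact: (cphi1 _ HF)|exact: (cphi1 _ nc)].
have near2 : \forall t \near t0, (chart_dom c (phi2 t) /\ forall i, F i (phi2 t) =
    chart_map c (phi2 t) 0 i) /\ (chart_dom c (phi2 t) /\ ball a r (chart_map c (phi2 t))).
  have HF2 := HF; have nc2 := nc; rewrite /p p12 in HF2 nc2.
  by apply: filterI; [exact: (cphi2 _ HF2)|exact: (cphi2 _ nc2)].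
move: near1 near2 => /nbhs_ballP[s1 /= s10 Hs1] /nbhs_ballP[s2 /= s20 Hs2].
pose s := Num.min s1 s2.
have s0 : 0 < s by rewrite lt_min s10.
have ss1 : s <= s1 by rewrite ge_min lexx.
have ss2 : s <= s2 by rewrite ge_min lexx orbT.
have Hs t (tb : ball t0 s t) := conj (Hs1 t (le_ball ss1 tb)) (Hs2 t (le_ball ss2 tb)).
pose v t : 'rV[R]_n := chart_map c (phi1 t) - chart_map c (phi2 t).
have P : 0 < C + 1 by rewrite ltr_wpDl.
(* The first bound keeps both curves in the ball where the Lipschitz estimate holds, the second
   gives $Cb\le 1/2$. *)
pose b := Num.min (s / 2) (2 * (C + 1))^-1.
have b0 : 0 < b by rewrite lt_min divr_gt0// invr_gt0 mulr_gt0.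
have bs : b < s by rewrite gt_min; apply/orP; left; lra.
have Cb : C * b <= 2^-1.
  apply: (@le_trans _ _ (C * (2 * (C + 1))^-1)).
    by rewrite ler_wpM2l// ge_min lexx orbT.
  by rewrite ler_pdivrMr ?mulr_gt0//; lra.
have bb t : `|t - t0| <= b -> ball t0 s t.
  by move=> tb; apply/ball_normP; exact: le_lt_trans bs.
pose g i t := F i (phi1 t) - F i (phi2 t).
have gv t i : ball t0 s t -> g i t = v t 0 i.
  move=> /Hs[[[_ H1] _] [[_ H2] _]].
  by rewrite /g H1 H2 !mxE.
have dg t i : is_derive t (1 : R) (g i) (X (phi1 t) (F i) - X (phi2 t) (F i)).
  by apply: is_deriveB; [exact: v1|exact: v2].
have dgd t i : differentiable (g i) t.
  by apply/derivable1_diffP; have [] := dg t i.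
have dgle t i : ball t0 s t -> `|'D_1 (g i) t| <= C * `|v t|.
  move=> tb; have [_ ->] := dg t i.
  have [[_ [c1 b1]] [_ [c2 b2]]] := Hs _ tb.
  have := HC _ _ b2 b1; apply: le_trans.
  by apply: le_trans (coord_le _ i); rewrite !mxE !chart_mapK.
have cv t : ball t0 s t -> {for t, continuous v}.
  move=> /Hs[[_ [c1 _]] [_ [c2 _]]].
  apply: (@continuousB _ _ _ (chart_map c \o phi1) (chart_map c \o phi2)).
    apply: continuous_comp; [exact: velocity_cont (v1 t)|exact: chart_map_cont].
  apply: continuous_comp; [exact: velocity_cont (v2 t)|exact: chart_map_cont].
pose A := [set t : R | `|t - t0| <= b].
have cA : compact A.
  rewrite (_ : A = `[t0 - b, t0 + b]%classic); first exact: segment_compact.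
  rewrite /A; apply/seteqP; split=> t /=; rewrite in_itv /= ler_norml => /andP[h1 h2];
    apply/andP; split; lra.
have cvA : {within A, continuous (fun t => `|v t|)}.
  apply: continuous_in_subspaceT => t; rewrite inE => /bb tb.
  by apply: (@continuous_comp _ _ _ v Num.norm); [exact: cv|exact: norm_continuous].
have [|t1] := compact_EVT_max _ cA cvA.
  by exists t0; rewrite /A /= subrr normr0 ltW.
rewrite inE => At1 vmax.
have vt1 : `|v t1| <= 2^-1 * `|v t1|.
  apply: row_norm_le => [|i]; first by rewrite mulr_ge0.
  rewrite -gv; last exact: bb.
  have [u u01 E] := ball_MVT (fun z _ => dgd z i) (ballxx t0 s0) (bb _ At1).
  have g0 : g i t0 = 0 by rewrite /g -p12 subrr.
  move: E; rewrite g0 subr0 => ->.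
  set z := t0 + _.
  have Az : A z.
    rewrite /A /z /= addrAC subrr add0r normrM; case/andP: u01 => u0 u1.
    rewrite (ger0_norm u0); apply: le_trans At1.
    by rewrite ler_piMl.
  have -> : t1 - t0 = (t1 - t0) *: (1 : R) by rewrite [RHS]mulr1.
  rewrite deriveZr; last exact: dgd.
  rewrite normrM.
  have H1 := dgle z i (bb _ Az).
  have H2 : `|v z| <= `|v t1| by apply: vmax; rewrite inE.
  apply: (@le_trans _ _ (b * (C * `|v t1|))).
    rewrite ler_pM//; apply: le_trans H1 _; rewrite ler_wpM2l//.
  by rewrite mulrA [b * C]mulrC ler_wpM2r.
have v0 : `|v t1| <= 0 by have := normr_ge0 (v t1); lra.
apply/nbhs_ballP; exists b => //= t /ball_normP/ltW At.
have [[_ [c1 _]] [_ [c2 _]]] := Hs _ (bb _ At).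
have : `|v t| <= 0 by apply: le_trans v0; apply: vmax; rewrite inE.
rewrite normr_le0 subr_eq0 => /eqP E.
by rewrite -(chart_mapK c1) E chart_mapK.
Qed.

(** The coincidence set is open by local uniqueness. It is closed because smooth functions separate
    points and are continuous along the curves. *)
Lemma integral_curve_unique n (M : manifoldType R n) (X : M -> functional M)
    (m : M) (phi1 phi2 : R -> M) : vector_field X ->
  integral_curve X m phi1 -> integral_curve X m phi2 -> phi1 = phi2.
Proof.
move=> vX [p1 v1] [p2 v2]; pose S := [set t | phi1 t = phi2 t].
have conR : connected [set: R].
  by apply/connected_intervalP => x y _ _ z _.
have oS : open S.
  rewrite openE => t St; exact: (integral_curve_local vX v1 v2 St).
have oCS : open (~` S).
  rewrite openE => t nS.
  have [f [sf ft]] : exists f : M -> R, smooth_fun f /\ f (phi1 t) != f (phi2 t).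
    apply: contrapT => H; apply: nS; apply: smooth_fun_separates => f sf.
    apply/eqP/negPn/negP => ft; apply: H; by exists f.
  have cf : {for t, continuous (fun s => `|f (phi1 s) - f (phi2 s)|)}.
    apply: (@continuous_comp _ _ _ (fun s => f (phi1 s) - f (phi2 s)) Num.norm);
      last exact: norm_continuous.
    apply: (@continuousB _ _ _ (f \o phi1) (f \o phi2)); apply: continuous_comp;
      by [exact: velocity_cont (v1 t)|exact: velocity_cont (v2 t)|
          exact: smooth_fun_continuous].
  have d0 : 0 < `|f (phi1 t) - f (phi2 t)| by rewrite normr_gt0 subr_eq0.
  move/cvgrPdist_lt : cf => /(_ _ d0); apply: filterS => s.
  by move=> + /= Ss; rewrite Ss subrr normr0 subr0 normr_id ltxx.
have ST : S = setT.
  apply: conR.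
  - by exists 0; rewrite /S /= p1 p2.
  - by exists S; rewrite ?setTI.
  - by exists S; rewrite ?setTI// -[S]setCK; exact: open_closedC.
by apply/funext => t; have : [set: R] t by []; rewrite -ST.
Qed.

Lemma smooth_from_linear (V V' : normedModType R) n (M : manifoldType R n)
    (L : {linear V' -> V}) (g : V -> M) :
  continuous L -> smooth_from g -> smooth_from (g \o L).
Proof.
move=> cL [cg sg]; split=> [x|c Ac k].
  by apply: continuous_comp; [exact: cL|exact: cg].
have oU : open [set x | chart_dom c (g x)].
  by move/continuousP : cg; apply; exact: chart_open_dom.
have := Ck_on_precomp 0 oU cL (sg c Ac k).
have E (x : V') : L x + 0 = L x by rewrite addr0.
rewrite (_ : [set x | [set x | chart_dom c (g x)] (L x + 0)] =
  [set x | chart_dom c ((g \o L) x)]); last first.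
  by apply/seteqP; split=> x /=; rewrite addr0.
by rewrite (_ : (fun x => _) = chart_map c \o (g \o L))//;
  apply/funext => x /=; rewrite addr0.
Qed.

Lemma is_derive_line (V W : normedModType R) (f : V -> W) (x v : V) (l : W) :
  is_derive x v f l <-> is_derive (0 : R) (1 : R) (fun s : R => f (s *: v + x)) l.
Proof.
split=> H; apply: is_derive_near => e e0; have := is_derive_near_le H e0;
  apply: filterS => h; by rewrite addr0 [h *: (1 : R)]mulr1 scale0r add0r.
Qed.

Lemma one_param0 l (K : lieGroupType R l) xi (g : R -> K) :
  one_param xi g -> g 0 = 1%g.
Proof. by case=> _ gD _; apply: (@mulgI _ (g 0)); rewrite -gD addr0 mulg1. Qed.

Lemma smooth_fun_left_mul l (K : lieGroupType R l) (k : K) (f : K -> R) :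
  smooth_fun f -> smooth_fun (fun h => f (k * h)%g).
Proof.
move=> sf; apply: (@smooth_fun_comp R l l K K f (fun h => k * h)%g sf) => c Ac.
apply: (smooth_into_bin (g := fun=> k)).
- exact: chart_open_cod.
- exact: mul_smooth.
- exact: smooth_into_cst.
- exact: chart_inv_smooth.
Qed.

(* The product g1(t) g2(-t) is a homomorphism with zero velocity, hence constant. *)
Lemma one_param_unique l (K : lieGroupType R l) xi (g1 g2 : R -> K) :
  (forall x y : K, (x * y = y * x)%g) ->
  one_param xi g1 -> one_param xi g2 -> g1 = g2.
Proof.
move=> comK o1 o2; have g10 := one_param0 o1; have g20 := one_param0 o2.
case: o1 o2 => [s1 D1 v1] [s2 D2 v2].
(* $g_1(s)g_2(-s)$ is the smooth two-variable map $g_1(a)g_2(b)$ restricted to the direction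
   $(1,-1)$; by linearity of the differential its velocity is the difference of two equal ones. *)
pose L1 : {linear 'rV[R]_(1 + 1) -> R} := (mxtrace \o lsubmx)%FUN.
pose L2 : {linear 'rV[R]_(1 + 1) -> R} := (mxtrace \o rsubmx)%FUN.
have LE (a b : R) : L1 (row_mx a%:M b%:M) = a /\ L2 (row_mx a%:M b%:M) = b.
  by rewrite /L1 /L2 /= row_mxKl row_mxKr !mxtrace_scalar.
have sg := smooth_into_bin openT (@mul_smooth R l K)
  ((smooth_into_setT _).1 (smooth_from_linear (@rV_linear_continuous _ _ _ L1) s1))
  ((smooth_into_setT _).1 (smooth_from_linear (@rV_linear_continuous _ _ _ L2) s2)).
pose d t := (g1 t * g2 (- t))%g.
have dD s t : d (s + t) = (d s * d t)%g.
  rewrite /d D1 opprD D2 -!mulgA; congr (_ * _)%g; rewrite !mulgA.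
  by congr (_ * _)%g; rewrite comK.
have d0 : d 0 = 1%g by rewrite /d g10 oppr0 g20 mulg1.
have vd f : smooth_fun f -> is_derive (0 : R) (1 : R) (f \o d) 0.
  move=> sf; pose H z := f ((g1 \o L1) z * (g2 \o L2) z)%g.
  have dH : differentiable H 0.
    by have /Ck_onS[+ _] := smooth_into_fun openT sg sf 1; apply.
  have H1 : 'D_(row_mx 1%:M 0%:M) H 0 = xi f.
    have /is_derive_line [_ <-] := DeriveDef (diff_derivable dH (v := row_mx 1%:M 0%:M)) erefl.
    have [_ <-] := v1 f sf; congr derive; apply/funext => s.
    rewrite /H /= addr0 !linearZ /= row_mxKl row_mxKr !mxtrace_scalar.
    by rewrite mulr1n mulr1 mulr0 g20 mulg1.
  have H2 : 'D_(row_mx 0%:M 1%:M) H 0 = xi f.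
    have /is_derive_line [_ <-] := DeriveDef (diff_derivable dH (v := row_mx 0%:M 1%:M)) erefl.
    have [_ <-] := v2 f sf; congr derive; apply/funext => s.
    rewrite /H /= addr0 !linearZ /= row_mxKl row_mxKr !mxtrace_scalar.
    by rewrite mulr1n mulr1 mulr0 g10 mul1g.
  have H3 : 'D_(row_mx 1%:M (-1)%:M) H 0 = 0.
    rewrite (_ : row_mx 1%:M (-1)%:M = row_mx 1%:M 0%:M + (-1) *: row_mx 0%:M 1%:M).
      by rewrite deriveDr// deriveZr// H1 H2 scaleN1r subrr.
    apply/rowP => i; rewrite [RHS]mxE [X in _ + X]mxE.
    case: (split_ordP i) => j ->; rewrite ?row_mxEl ?row_mxEr !ord1 !mxE eqxx !mulr1n.
      by rewrite mulr0 addr0.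
    by rewrite mulr1 add0r.
  have /is_derive_line := DeriveDef (diff_derivable dH (v := row_mx 1%:M (-1)%:M)) erefl.
  rewrite H3; congr (is_derive _ _ _ _); apply/funext => s.
  rewrite /H /d /= addr0 !linearZ /= row_mxKl row_mxKr !mxtrace_scalar.
  by rewrite ?mulr1n ?mulr1 ?mulrN1.
have dc f t : smooth_fun f -> f (d t) = f 1%g.
  move=> sf.
  have Df s : is_derive s (1 : R) (f \o d) 0.
    have := vd _ (smooth_fun_left_mul (d s) sf).
    move=> /is_derive_near_le H; apply: is_derive_near => e e0.
    have := H e e0; apply: filterS => h; rewrite /= !addr0 d0 mulg1 -dD.
    by rewrite [s + _]addrC.
  have := @is_derive_0_is_cst R (f \o d) t 0 Df.
  by rewrite /= d0.
have d1 t : d t = 1%g by apply: smooth_fun_separates => f; exact: dc.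
apply/funext => t; apply: (@mulIg _ (g2 (- t))).
by rewrite -D2 subrr g20 -[RHS](d1 t).
Qed.

End Curves.

(** * Torus orbits *)

Section Orbit.
Variables (R : realType) (l n q : nat) (K : lieGroupType R l) (M : manifoldType R n).
Variables (act : K -> M -> M) (m : M) (E : 'rV[R]_q -> K) (c : chart R n M).
Hypotheses (K_torus : torus_group K) (act_smooth : smooth_action act).
Hypotheses (homE : forall x y, E (x + y) = (E x * E y)%g) (sE : smooth_from E)
  (surjE : forall e : R, 0 < e ->
        \forall k \near (1%g : K), exists2 x, `|x| < e & E x = k).
Variable N : R.
Hypothesis boxE : forall k, exists2 x, `|x| <= N & E x = k.
Hypotheses (Ac : atlas c) (cm : chart_dom c m).

Lemma action_smooth_map k (f : M -> R) : smooth_fun f -> smooth_fun (f \o act k).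
Proof.
move=> sf; apply: smooth_fun_comp sf _ => c' Ac'; have [sact _ _] := act_smooth.
apply: (smooth_into_bin (g := fun=> k)) => //.
- exact: chart_open_cod.
- exact: smooth_into_cst.
- exact: chart_inv_smooth.
Qed.

Lemma action_smooth_from (V : normedModType R) (g : V -> K) (h : V -> M) :
  smooth_from g -> smooth_from h -> smooth_from (fun x => act (g x) (h x)).
Proof.
move=> sg sh; have [sact _ _] := act_smooth; apply/smooth_into_setT.
by apply: (smooth_into_bin openT sact); exact/smooth_into_setT.
Qed.

Lemma smooth_from_cst (V : normedModType R) (p : M) : smooth_from (fun _ : V => p).
Proof. by apply/smooth_into_setT; exact: smooth_into_cst. Qed.

(* The derivative at m of f, applied to a vector given in the chart c. *)
Definition chart_tangent (f : M -> R) (w : 'rV[R]_n) : R :=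
  'D_w (f \o chart_inv c) (chart_map c m).
Local Notation T := chart_tangent.

Lemma chart_tangent_diff f : smooth_fun f ->
  differentiable (f \o chart_inv c) (chart_map c m).
Proof.
by move=> sf; have /Ck_onS[+ _] := sf c Ac 1%N; apply; exact: chart_map_cod.
Qed.

Lemma chart_tangentD f v w : smooth_fun f -> T f (v + w) = T f v + T f w.
Proof. by move=> /chart_tangent_diff df; exact: deriveDr. Qed.

Lemma chart_tangent0 f : T f 0 = 0.
Proof. exact: derive0. Qed.

Lemma chart_tangent_map (V : normedModType R) (g : V -> M) (x v : V) :
  {for x, continuous g} -> g x = m -> differentiable (chart_map c \o g) x ->
  forall f, smooth_fun f -> differentiable (f \o g) x /\
    'D_v (f \o g) x = T f ('D_v (chart_map c \o g) x).
Proof.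
move=> cg gx dg f sf.
have df := chart_tangent_diff sf.
have E1 : \forall y \near x, ((f \o chart_inv c) \o (chart_map c \o g)) y = (f \o g) y.
  have : \forall y \near x, chart_dom c (g y).
    by apply: cg; apply: open_nbhs_nbhs; split; [exact: chart_open_dom|rewrite gx].
  by apply: filterS => y cy /=; rewrite chart_mapK.
have df' : differentiable (f \o chart_inv c) ((chart_map c \o g) x) by rewrite /= gx.
split; first exact: near_differentiable E1 (differentiable_comp dg df').
by rewrite -(near_eq_derive _ E1) (derive_comp v dg df') /T /= gx.
Qed.

Lemma smooth_from_chart_diff (V : normedModType R) (g : V -> M) (x : V) :
  smooth_from g -> g x = m -> differentiable (chart_map c \o g) x.
Proof.
move=> [_ sg] gx; have /Ck_onS[+ _] := sg c Ac 1%N.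
by apply; rewrite /= gx.
Qed.

(** These functions read off the coordinates of a tangent vector, so identities between row vectors
    can be tested on smooth functions. *)
Lemma chart_tangent_coord : exists F : 'I_n -> M -> R,
  (forall i, smooth_fun (F i)) /\ forall i w, T (F i) w = w 0 i.
Proof.
have [F [sF HF]] := chart_coordinates Ac cm; exists F; split=> // i w.
have ca : chart_cod c (chart_map c m) by exact: chart_map_cod.
have E1 : \forall y \near chart_map c m, (F i \o chart_inv c) y = y 0 i.
  have ci : {for chart_map c m, continuous (chart_inv c)} by exact: chart_inv_cont.
  have HF' : \forall q \near chart_inv c (chart_map c m),
      chart_dom c q /\ forall i, F i q = chart_map c q 0 i by rewrite chart_mapK.
  have HF2 : \forall y \near chart_map c m, chart_dom c (chart_inv c y) /\
      forall i, F i (chart_inv c y) = chart_map c (chart_inv c y) 0 i := ci _ HF'.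
  have nca := open_nbhs_nbhs (conj (@chart_open_cod _ _ _ c) ca).
  apply: filterS2 nca HF2 => y cy [_ /(_ i)].
  by rewrite /= => ->; rewrite chart_invK.
rewrite /T (near_eq_derive _ E1).
have did : differentiable (@id 'rV[R]_n) (chart_map c m) by exact: ex_diff.
by rewrite -(derive_coord w i did) derive_id.
Qed.

Let Phi x := act (E x) m.

Lemma orbit_map_smooth : smooth_from Phi.
Proof. by apply: action_smooth_from => //; exact: smooth_from_cst. Qed.

Lemma orbit_map0 : Phi 0 = m.
Proof. by have [_ act1 _] := act_smooth; rewrite /Phi (hom_exp0 homE) act1. Qed.

Lemma orbit_mapD x y : Phi (x + y) = act (E x) (Phi y).
Proof. by have [_ _ actM] := act_smooth; rewrite /Phi homE actM. Qed.

Let J : 'M[R]_(q, n) := jacobian (chart_map c \o Phi) 0.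

Lemma orbit_map_derive f v : smooth_fun f -> 'D_v (f \o Phi) 0 = T f (v *m J).
Proof.
move=> sf; have dP := smooth_from_chart_diff orbit_map_smooth orbit_map0.
have cP : {for 0, continuous Phi} by have [+ _] := orbit_map_smooth; apply.
have [_ ->] := chart_tangent_map v cP orbit_map0 dP sf.
by rewrite deriveEjacobian.
Qed.

(* Along such v the velocity of exp(tv) m vanishes for all t by homogeneity. *)
Lemma orbit_map_kernel x v : v *m J = 0 -> Phi (x + v) = Phi x.
Proof.
move=> vJ; rewrite orbit_mapD.
suff -> : Phi v = m by [].
apply: smooth_fun_separates => f sf.
have dfP t : is_derive t (1 : R) (fun s : R => f (Phi (s *: v))) 0.
  have sft := action_smooth_map (E (t *: v)) sf.
  have dP := smooth_from_chart_diff orbit_map_smooth orbit_map0.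
  have cP : {for 0, continuous Phi} by have [+ _] := orbit_map_smooth; apply.
  have [dfP _] := chart_tangent_map v cP orbit_map0 dP sft.
  have := DeriveDef (diff_derivable dfP (v := v)) erefl.
  rewrite orbit_map_derive// vJ chart_tangent0 => /is_derive_near_le H.
  apply: is_derive_near => e e0; have := H e e0; apply: filterS => h.
  by rewrite /= -!orbit_mapD !addr0 [h%:A]mulr1 scalerDl [h *: v + _]addrC.
have := @is_derive_0_is_cst R (fun s : R => f (Phi (s *: v))) 1 0 dfP.
by rewrite /= scale1r scale0r orbit_map0.
Qed.

Definition orbit_rank : nat := \rank J.
Definition orbit_frame : 'M[R]_(orbit_rank, n) := row_base J.
Local Notation r := orbit_rank.
Local Notation Q := orbit_frame.

Lemma orbit_frame_free : row_free Q.
Proof. exact: row_base_free. Qed.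

(** [E] is restricted to the image of [B], a complement of the kernel of the infinitesimal action at
    [m]; there the derivative has the independent rows of [Q]. No orbit point is lost: [x] and its
    projection differ by a kernel vector, which does not move [m] by [orbit_map_kernel], and linear
    maps distort norms by a bounded factor. *)
Lemma orbit_chart : exists E' : 'rV[R]_r -> K, [/\
  forall x y, E' (x + y) = (E' x * E' y)%g, smooth_from E',
  forall f u, smooth_fun f -> 'D_u (fun x => f (act (E' x) m)) 0 = T f (u *m Q),
  forall e : R, 0 < e -> \forall k \near (1%g : K),
    exists2 u, `|u| < e & act (E' u) m = act k m &
  exists N' : R, forall k, exists2 u, `|u| <= N' & act (E' u) m = act k m].
Proof.
have /row_fullP[B BC] := col_base_full J.
pose LB : {linear 'rV[R]_r -> 'rV[R]_q} := mulmxr B.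
have BJ : B *m J = Q.
  by have := congr1 (mulmx B) (mulmx_base J); rewrite mulmxA BC mul1mx.
have cB := @rV_linear_continuous _ _ _ LB.
pose LC : {linear 'rV[R]_q -> 'rV[R]_r} := mulmxr (col_base J).
have [k k0 Hk] := linear_lipschitz (@rV_linear_continuous _ _ _ LC).
have PC x : Phi (LB (LC x)) = Phi x.
  rewrite -[in RHS](subrK (LB (LC x)) x) [in RHS]addrC [RHS]orbit_map_kernel//.
  have JE : col_base J *m Q = J := mulmx_base J.
  have LE : LB (LC x) *m J = x *m (col_base J *m (B *m J)) by rewrite /LB /LC /= !mulmxA.
  by rewrite mulmxBl LE BJ JE subrr.
exists (E \o LB); split.
- by move=> x y; rewrite /= mulmxDl homE.
- exact: smooth_from_linear.
- move=> f u sf.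
  have dfP : differentiable (f \o Phi) (LB 0).
    rewrite linear0.
    have dP := smooth_from_chart_diff orbit_map_smooth orbit_map0.
    have cP : {for 0, continuous Phi} by have [+ _] := orbit_map_smooth; apply.
    by have [] := chart_tangent_map 0 cP orbit_map0 dP sf.
  have := derive_comp u (rV_linear_diff LB 0) dfP.
  rewrite -[X in 'D_u X 0 = _]/(fun x => f (act ((E \o LB) x) m)) => ->.
  rewrite rV_linear_derive linear0 orbit_map_derive//; congr T.
  by rewrite /= -mulmxA BJ.
- move=> e e0.
  have ek : 0 < k^-1 * e by rewrite mulr_gt0// invr_gt0.
  have := surjE ek; apply: filterS => h [x xe <-].
  exists (LC x); last exact: (PC x).
  by apply: le_lt_trans (Hk x) _; rewrite -ltr_pdivlMl.
- exists (k * N) => h; have [x xN <-] := boxE h.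
  exists (LC x); last exact: (PC x).
  by apply: le_trans (Hk x) _; rewrite ler_wpM2l// ltW.
Qed.

End Orbit.

Section Line.
Variables (R : realType) (V : normedModType R).

Definition line (z : V) (s : R) : V := s *: z.

Lemma line_linear z : linear (line z).
Proof. by move=> a s t; rewrite /line scalerDl scalerA. Qed.

HB.instance Definition _ z := GRing.isLinear.Build R R V *:%R (line z) (line_linear z).

Lemma smooth_from_line n (M : manifoldType R n) (g : V -> M) z :
  smooth_from g -> smooth_from (fun s : R => g (s *: z)).
Proof. exact: (@smooth_from_linear _ _ _ _ _ (line z) g (@scalel_continuous _ _ z)). Qed.

End Line.

(** * Geometry of the orbit and gauge transformations along it *)

Section OrbitTorus.
Variables (R : realType) (l n r : nat) (K : lieGroupType R l) (M : manifoldType R n).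
Variables (act : K -> M -> M) (m : M) (c : chart R n M).
Variables (E : 'rV[R]_r -> K) (Q : 'M[R]_(r, n)) (N : R).
Hypotheses (K_torus : torus_group K) (act_smooth : smooth_action act).
Hypotheses (Ac : atlas c) (cm : chart_dom c m).
Hypotheses (homE : forall x y, E (x + y) = (E x * E y)%g) (sE : smooth_from E)
  (derE : forall (f : M -> R) u, smooth_fun f ->
     'D_u (fun x => f (act (E x) m)) 0 = chart_tangent m c f (u *m Q))
  (surjE : forall e : R, 0 < e -> \forall k \near (1%g : K),
     exists2 u, `|u| < e & act (E u) m = act k m)
  (boxE : forall k, exists2 u, `|u| <= N & act (E u) m = act k m)
  (Qfree : row_free Q).
Local Notation T := (chart_tangent m c).
Local Notation Psi := (fun u => act (E u) m).

Lemma orbit_compact : compact (group_orbit act m).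
Proof.
have [cK _ _] := K_torus; apply: continuous_compact cK.
apply: continuous_subspaceT => k.
by apply: (act_cont act_smooth (g := id) (h := fun=> m)); [|exact: cst_continuous].
Qed.

Lemma orbit_closed : closed (group_orbit act m).
Proof. exact: compact_closed manifold_hausdorff orbit_compact. Qed.

Lemma orbit_par_sub u v : act (E u) m = act (E v) m <-> act (E (u - v)) m = m.
Proof.
have P0 := orbit_map0 m act_smooth homE.
have PD := orbit_mapD m act_smooth homE.
split=> H.
  rewrite addrC PD H -PD addNr; exact: P0.
by rewrite -{1}(subrK v u) addrC PD H.
Qed.

Lemma orbit_par_derive f x u : smooth_fun f ->
  is_derive x u (fun y => f (act (E y) m)) (T (f \o act (E x)) (u *m Q)).
Proof.
move=> sf; have sfx := action_smooth_map act_smooth (E x) sf.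
have sP := orbit_map_smooth m act_smooth sE.
have df : differentiable ((f \o act (E x)) \o Psi) 0.
  by have /Ck_onS[+ _] := smooth_into_fun openT ((smooth_into_setT _).1 sP) sfx 1; apply.
have := DeriveDef (diff_derivable df (v := u)) erefl.
rewrite [X in is_derive _ _ _ X](_ : _ = T (f \o act (E x)) (u *m Q)); last exact: derE.
move=> /is_derive_near_le H; apply: is_derive_near => e e0.
have PD := orbit_mapD m act_smooth homE.
have := H e e0; apply: filterS => h; rewrite /= -!PD !addr0.
by rewrite [x + _]addrC.
Qed.

Let G u := chart_map c (act (E u) m).

Lemma orbit_par_chart e : 0 < e ->
  \forall u \near (0 : 'rV[R]_r), `|G u - chart_map c m - u *m Q| <= e * `|u|.
Proof.
move=> e0; have sP := orbit_map_smooth m act_smooth sE.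
have P0 : act (E 0) m = m := orbit_map0 m act_smooth homE.
have dG := smooth_from_chart_diff Ac cm sP P0.
have cP : {for 0, continuous Psi} by have [+ _] := sP; apply.
have dGE u : 'd (chart_map c \o Psi) 0 u = u *m Q.
  have [F [sF TF]] := chart_tangent_coord Ac cm.
  rewrite -deriveE//; apply/rowP => i.
  rewrite -(TF i ('D_u _ _)) -(TF i (u *m Q)) -derE//.
  by have [_ <-] := chart_tangent_map Ac cm u cP P0 dG (sF i).
have := diff_near dG e0; apply: filterS => u.
by rewrite dGE addr0 /G /= P0.
Qed.

Lemma orbit_frame_lower : exists2 k : R, 0 < k & forall u : 'rV[R]_r, `|u| <= k * `|u *m Q|.
Proof.
have /row_freeP[D QD] := Qfree.
pose LD : {linear 'rV[R]_n -> 'rV[R]_r} := mulmxr D.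
have [k k0 Hk] := linear_lipschitz (@rV_linear_continuous _ _ _ LD).
exists k => // u; have := Hk (u *m Q).
by rewrite /LD /= -mulmxA QD mulmx1.
Qed.

(** To first order the orbit map is $u\mapsto uQ$ with $|u|\le k|uQ|$. If a small [u] fixes [m],
    then $|uQ|\le |u|/(2k)$, and therefore $|u|\le |u|/2$. *)
Lemma orbit_stab_discrete : exists2 e : R, 0 < e &
  forall u, act (E u) m = m -> `|u| < e -> u = 0.
Proof.
have [k k0 Hk] := orbit_frame_lower.
have k2 : 0 < (2 * k)^-1 by rewrite invr_gt0 mulr_gt0.
have /nbhs_ballP[e /= e0 He] := orbit_par_chart k2.
exists e => // u um ue.
have := He u; rewrite /= /G um subrr sub0r normrN => H.
have {}H : `|u *m Q| <= (2 * k)^-1 * `|u|.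
  by apply: H; apply/ball_normP; rewrite subr0.
have H2 : `|u| <= 2^-1 * `|u|.
  apply: le_trans (Hk u) _; apply: le_trans (ler_wpM2l (ltW k0) H) _.
  have kk : k * (2 * k)^-1 = 2^-1 by rewrite invfM mulrCA mulfV ?gt_eqF// mulr1.
  by rewrite mulrA kk.
have : `|u| <= 0 by have := normr_ge0 u; lra.
by rewrite normr_le0 => /eqP.
Qed.

(* The remaining part of the orbit is compact and avoids m. *)
Lemma orbit_local_section e : 0 < e ->
  \forall p \near m, group_orbit act m p -> exists2 u, `|u| < e & act (E u) m = p.
Proof.
move=> e0; have [cK _ comK] := K_torus; have [_ act1 actM] := act_smooth.
(* These group elements move [m] as some small parameter does. The set contains the stabilizer of
   [m], and it is open by [surjE] and translation. *)
pose A := [set k | exists2 u, `|u| < e & act (E u) m = act k m].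
have oA : open A.
  rewrite openE => k0 [u ue uk].
  have d0 : 0 < e - `|u| by rewrite subr_gt0.
  have := near_translate k0 (surjE d0); apply: filterS => k [v ve vk].
  exists (v + u); first by apply: le_lt_trans (ler_normD _ _) _; rewrite -ltrBrDr.
  by rewrite homE actM uk -actM comK actM vk -actM mulgA mulgV mul1g.
have cB : compact ((fun k => act k m) @` ~` A).
  apply: continuous_compact.
    apply: continuous_subspaceT => k.
    by apply: (act_cont act_smooth (g := id) (h := fun=> m)); [|exact: cst_continuous].
  by apply: subclosed_compact cK _ => //; exact: open_closedC.
have oB := closed_openC (compact_closed (@manifold_hausdorff _ _ M) cB).
have mB : (~` ((fun k => act k m) @` ~` A)) m.
  move=> [k nAk km]; apply: nAk; exists 0; rewrite ?normr0// km.
  exact: (orbit_map0 m act_smooth homE).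
have := open_nbhs_nbhs (conj oB mB); apply: filterS => p np [k _ kp].
apply: contrapT => H; apply: np; exists k => // -[u ue uk]; apply: H.
by exists u => //; rewrite uk.
Qed.

(** Only values of [g] in the orbit are known, so no differentiable lift is assumed. For small [s]
    one has $g(s)=\Psi(u)$ with small $u$, whence both $sw$ and $uQ$ approximate the displacement in
    the chart, and $|u|=O(s)$. The cokernel of [Q] kills $uQ$, so it maps $sw$ to a vector of size
    $o(s)$. *)
Lemma orbit_tangent_cone (g : R -> M) w : g 0 = m -> {for 0, continuous g} ->
  (forall s, group_orbit act m (g s)) ->
  is_derive (0 : R) (1 : R) (chart_map c \o g) w -> (w <= Q)%MS.
Proof.
move=> g0 cg og dg.
have [k k0 Hk] := orbit_frame_lower.
pose LC : {linear 'rV[R]_n -> 'rV[R]_n} := mulmxr (cokermx Q).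
have [kc kc0 Hkc] := linear_lipschitz (@rV_linear_continuous _ _ _ LC).
rewrite submxE -normr_eq0 eq_le normr_ge0 andbT; apply/ler_addgt0Pr => z z0; rewrite add0r.
(* [D * e] collects the final error: $e|u|$ from the orbit map with $|u|\le 2k(|w|+1)s$, and $es$
   from the curve. The bound $e\le 1/(2k)$ lets $|u|$ be absorbed, and $e\le z/D$ concludes. *)
pose D := kc * (1 + 2 * k * (`|w| + 1)).
have D0 : 0 < D by rewrite mulr_gt0// ltr_wpDr// !mulr_ge0// ?ltW// ltr_wpDl.
pose e := Num.min (Num.min 1 (2 * k)^-1) (z / D).
have e0 : 0 < e by rewrite !lt_min ltr01 invr_gt0 mulr_gt0//= divr_gt0.
have e1 : e <= 1 by rewrite !ge_min lexx.
have ek : e <= (2 * k)^-1 by rewrite !ge_min lexx orbT.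
have eD : D * e <= z by rewrite mulrC -ler_pdivlMr// !ge_min lexx orbT.
have /nbhs_ballP[d /= d0 Hd] := orbit_par_chart e0.
have cgm : g s @[s --> 0] --> m by rewrite -[X in _ --> X]g0.
have sec : \forall s \near (0 : R), group_orbit act m (g s) ->
    exists2 u, `|u| < d & act (E u) m = g s := cgm _ (orbit_local_section d0).
have dgn := is_derive_near_le dg e0.
move: sec dgn => /nbhs_ballP[t1 /= t10 Ht1] /nbhs_ballP[t2 /= t20 Ht2].
pose s := Num.min t1 t2 / 2.
have s0 : 0 < s by rewrite divr_gt0// lt_min t10.
have st1 : s < t1 by rewrite /s ltr_pdivrMr// gt_min ltr_pMr ?ltr1n.
have st2 : s < t2 by rewrite /s ltr_pdivrMr// gt_min [t2 < t2 * 2]ltr_pMr ?ltr1n ?orbT.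
have sec_s : group_orbit act m (g s) -> exists2 u, `|u| < d & act (E u) m = g s.
  by apply: Ht1; apply/ball_normP; rewrite subr0 gtr0_norm.
have bs2 : ball 0 t2 s by apply/ball_normP; rewrite subr0 gtr0_norm.
have /= := Ht2 s bs2.
rewrite addr0 [s *: (1 : R)]mulr1 g0 (gtr0_norm s0) => H1.
have [u ud us] := sec_s (og s).
have H2 : `|G u - chart_map c m - u *m Q| <= e * `|u|.
  by apply: Hd; apply/ball_normP; rewrite subr0.
rewrite -us -/(G u) in H1; set y := G u - _ in H1 H2.
have H3 : `|y| <= (`|w| + 1) * s.
  rewrite -(subrK (s *: w) y); apply: le_trans (ler_normD _ _) _.
  rewrite normrZ (gtr0_norm s0).
  have : e * s <= s by rewrite ler_piMl// ltW.
  lra.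
have H4 : `|u| <= 2 * k * `|y|.
  have : `|u *m Q| <= `|y| + e * `|u|.
    rewrite -(subrK y (u *m Q)) addrC; apply: le_trans (ler_normD _ _) _.
    by rewrite lerD2l distrC.
  move=> /(ler_wpM2l (ltW k0)) /(le_trans (Hk u)).
  have : k * (e * `|u|) <= 2^-1 * `|u|.
    rewrite mulrA ler_wpM2r//; apply: le_trans (ler_wpM2l (ltW k0) ek) _.
    by rewrite invfM mulrCA mulfV ?gt_eqF// mulr1.
  lra.
have H5 : s *: (w *m cokermx Q) = LC (y - u *m Q) - LC (y - s *: w).
  rewrite /LC /= -mulmxBl (_ : _ - _ - _ = s *: w - u *m Q).
    by rewrite mulmxBl -mulmxA mulmx_coker mulmx0 subr0 -scalemxAl.
  by rewrite opprB addrC addrA subrK.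
have H6 : s * `|w *m cokermx Q| <= s * (D * e).
  rewrite -{1}(gtr0_norm s0) -normrZ H5; apply: le_trans (ler_normB _ _) _.
  apply: le_trans (lerD (Hkc _) (Hkc _)) _; rewrite -mulrDr.
  have -> : s * (D * e) = kc * (e * (2 * k * ((`|w| + 1) * s)) + e * s).
    by rewrite /D; ring.
  apply: ler_wpM2l; first exact: ltW.
  apply: lerD => //; apply: le_trans H2 _.
  apply: ler_wpM2l; first exact: ltW.
  apply: le_trans H4 _.
  by rewrite ler_wpM2l// mulr_ge0 ?ltW.
by apply: le_trans eD; rewrite -(ler_pM2l s0).
Qed.


Lemma tangent_orbit_frame (g : R -> M) : smooth_from g -> g 0 = m ->
  (forall s, group_orbit act m (g s)) ->
  exists u, forall f, smooth_fun f -> 'D_1 (f \o g) 0 = T f (u *m Q).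
Proof.
move=> sg g0 og; have cg : {for 0, continuous g} by have [+ _] := sg; apply.
have dg := smooth_from_chart_diff Ac cm sg g0.
have /submxP[u wu] := orbit_tangent_cone g0 cg og
  (DeriveDef (diff_derivable dg (v := (1 : R))) erefl).
exists u => f sf; rewrite -wu.
by have [_ ->] := chart_tangent_map Ac cm (1 : R) cg g0 dg sf.
Qed.

(** After translation the torus parametrization passes through [m]. Every directional derivative
    there lies in the row space of [Q] by [orbit_tangent_cone], and the immersion condition makes
    the $d$ rows of its Jacobian independent; ranks are then compared. *)
Lemma torus_dim_orbit d S : torus_of_dim d S -> S `<=` group_orbit act m -> (d <= r)%N.
Proof.
case=> e [se _ ie eS] SO; have [_ act1 actM] := act_smooth.
have [k0 _ k0e] : group_orbit act m (e 0) by apply: SO; rewrite -eS; exists 0.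
have oe x : group_orbit act m (e x) by apply: SO; rewrite -eS; exists x.
pose g x := act k0^-1%g (e x).
have sg : smooth_from g by apply: action_smooth_from => //; exact: smooth_from_cst.
have g0 : g 0 = m by rewrite /g -k0e -actM mulVg act1.
have og x : group_orbit act m (g x).
  by have [k _ ke] := oe x; exists (k0^-1 * k)%g => //; rewrite actM ke.
have cg : {for 0, continuous g} by have [+ _] := sg; apply.
have dg := smooth_from_chart_diff Ac cm sg g0.
pose P : 'M[R]_(d, n) := jacobian (chart_map c \o g) 0.
have PE v : 'D_v (chart_map c \o g) 0 = v *m P by rewrite deriveEjacobian.
have PQ (v : 'rV[R]_d) : (v *m P <= Q)%MS.
  apply: (@orbit_tangent_cone (fun s => g (s *: v))).
  - by rewrite scale0r.
  - by have [+ _] := smooth_from_line v sg; apply.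
  - by move=> s; exact: og.
  - rewrite -PE.
    have /is_derive_line := DeriveDef (diff_derivable dg (v := v)) erefl.
    by congr (is_derive _ _ _ _); apply/funext => s; rewrite /= addr0.
have Pfree : row_free P.
  rewrite -kermx_eq0; apply/eqP/row_matrixP => i; rewrite row0.
  set v := row i _; apply/eqP; apply: contraT => v0.
  have vP : v *m P = 0 by rewrite -row_mul mulmx_ker row0.
  have [f sf] := ie 0 v v0; rewrite (_ : f \o e = (f \o act k0) \o g).
    have [_ ->] := chart_tangent_map Ac cm v cg g0 dg (action_smooth_map act_smooth k0 sf).
    by rewrite PE vP chart_tangent0 eqxx.
  by apply/funext => x; rewrite /g /= -actM mulgV act1.
have sub : (P <= Q)%MS by apply/row_subP => i; rewrite rowE.
by move: (mxrankS sub); rewrite (eqP Pfree) (eqP Qfree).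
Qed.

(** The equivalence in [lattice_basis] says that stabilizer vectors in the span of [W] have integer
    coordinates; this gives injectivity modulo $\mathbb Z^j$. The immersion property comes from
    freeness of both [W] and [Q]. *)
Lemma orbit_subtorus j : (j <= r)%N -> exists z : 'rV[R]_r,
  torus_of_dim j (closure (range (fun t : R => act (E (t *: z)) m))).
Proof.
move=> jr; have [_ act1 actM] := act_smooth.
have P0 : act (E 0) m = m := orbit_map0 m act_smooth homE.
have sP := orbit_map_smooth m act_smooth sE.
have [e e0 He] := orbit_stab_discrete.
pose L := [set u | act (E u) m = m].
have LB x y : L x -> L y -> L (x - y).
  by rewrite /L /= => xm ym; apply/orbit_par_sub; rewrite xm ym.
have LN x : exists2 y, `|y| <= N & L (x - y).
  by have [y yN yx] := boxE (E x); exists y => //; apply/orbit_par_sub.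
have [W Wfree HW] := lattice_basis P0 LB e0 He LN jr.
have [a Ha] := dense_line R j.
pose LW : {linear 'rV[R]_j -> 'rV[R]_r} := mulmxr W.
have cW := @rV_linear_continuous _ _ _ LW.
pose h x := act (E (x *m W)) m.
have sh : smooth_from h := smooth_from_linear cW sP.
have hE x y : h x = h y <-> forall i, x 0 i - y 0 i \is a Num.int.
  split=> [/orbit_par_sub|H].
    rewrite -mulmxBl => /(HW (x - y)).1 H i.
    by have := H i; rewrite !mxE.
  apply/orbit_par_sub; rewrite -mulmxBl; apply/HW => i.
  by rewrite !mxE.
exists (a *m W); exists h; split=> //.
- move=> x v v0.
  have : v *m W *m Q != 0.
    have /row_freeP[W' WW'] := Wfree; have /row_freeP[Q' QQ'] := Qfree.
    apply: contra v0 => /eqP vQ; apply/eqP.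
    by rewrite -(mulmx1 v) -WW' mulmxA -(mulmx1 (v *m W)) -QQ' mulmxA vQ !mul0mx.
  move/rV0Pn => [i vi].
  have [F [sF TF]] := chart_tangent_coord Ac cm.
  pose f := F i \o act (E (x *m W))^-1%g.
  have sf : smooth_fun f := action_smooth_map act_smooth _ (sF i).
  exists f => //.
  have df : differentiable (f \o (fun u => act (E u) m)) (LW x).
    by have /Ck_onS[+ _] := smooth_into_fun openT ((smooth_into_setT _).1 sP) sf 1; apply.
  have := derive_comp v (rV_linear_diff LW x) df.
  rewrite -[X in 'D_v X x = _]/(f \o h) => ->.
  rewrite rV_linear_derive; have [_ ->] := orbit_par_derive (LW x) (LW v) sf.
  rewrite (_ : f \o act (E (LW x)) = F i); first by rewrite TF.
  by apply/funext => p; rewrite /f /= -actM mulVg act1.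
- rewrite eqEsubset; split.
  (* Some [t *: a] is within [d] of [y] up to an integer row [z], and removing [z] does not change
     [h]. *)
  + move=> _ [y _ <-] B /(sh.1 y)/nbhs_ballP[d /= d0 Bd].
    have [t [z zint tz]] := Ha y d d0.
    exists (act (E (t *: (a *m W))) m); split; first by exists t.
    rewrite scalemxAl -/(h (t *: a)) (_ : h (t *: a) = h (t *: a - z)).
      by apply: Bd; apply/ball_normP; rewrite addrAC.
    by apply/hE => i; rewrite !mxE opprB addrC subrK.
  (* Every class modulo integers meets the unit ball, so the range is compact, hence closed. *)
  + have hB : range h = h @` closed_ball (0 : 'rV[R]_j) 1.
      rewrite eqEsubset; split=> [_ [x _ <-]|_ [x _ <-]]; last by exists x.
      have [z zint xz] := floor_row x; exists (x - z).
        by rewrite closed_ballE// /closed_ball_ /= sub0r normrN.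
      by apply/hE => i; rewrite !mxE [_ - z 0 i]addrC addrK rpredN.
    have cl : closed (range h).
      apply: (compact_closed (@manifold_hausdorff _ _ M)); rewrite hB.
      apply: continuous_compact; last exact: closed_ball_rV_compact.
      by apply: continuous_subspaceT; case: sh.
    rewrite [X in _ `<=` X](closure_id _).1//; apply: closure_subset.
    by move=> _ [t _ <-]; exists (t *: a) => //; rewrite /h scalemxAl.
Qed.

Lemma smooth_from_exp_diff u (f : K -> R) : smooth_fun f -> differentiable (f \o E) u.
Proof.
move=> sf.
by have /Ck_onS[+ _] := smooth_into_fun openT ((smooth_into_setT _).1 sE) sf 1; apply.
Qed.

(** [lie_exp] chooses by [xget], with default 1, so its value is known only once a one-parameter
    subgroup is exhibited and shown to be unique. *)
Lemma lie_exp_linear (a : R) u : lie_exp (fun h => a * 'D_u (h \o E) 0) = E (a *: u).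
Proof.
have [_ _ comK] := K_torus.
have op : one_param (fun h => a * 'D_u (h \o E) 0) (fun s : R => E (s *: (a *: u))).
  split.
  - exact: smooth_from_line.
  - by move=> s t; rewrite scalerDl homE.
  - move=> f sf; have df := smooth_from_exp_diff 0 sf.
    have /is_derive_line := DeriveDef (diff_derivable df (v := a *: u)) erefl.
    rewrite deriveZr//; congr (is_derive _ _ _ _).
    by apply/funext => s; rewrite /= addr0.
apply: xget_unique; first by exists (fun s : R => E (s *: (a *: u))); rewrite ?scale1r.
by move=> _ [g og <-]; rewrite (one_param_unique comK og op) scale1r.
Qed.

(** [Ad] is trivial in an abelian group, so invariance of [rho] is all that equivariance asks. *)
Lemma exp_gauge (rho : M -> R) u : smooth_fun rho ->
  (forall k p, rho (act k p) = rho p) ->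
  gauge act (fun p (h : K -> R) => rho p * 'D_u (h \o E) 0).
Proof.
move=> srho irho; have [_ _ comK] := K_torus; split.
- move=> p; split=> [a f g sf sg|f g sf sg].
    have df := diff_derivable (smooth_from_exp_diff 0 sf) (v := u).
    have dg := diff_derivable (smooth_from_exp_diff 0 sg) (v := u).
    rewrite (_ : _ \o E = a *: (f \o E) + (g \o E)); last exact/funext.
    rewrite (@deriveD _ _ _ (a *: (f \o E)) (g \o E) 0 u (@derivableZ _ _ _ (f \o E) a 0 u df) dg).
    rewrite (@deriveZ _ _ _ (f \o E) a 0 u df) mulrDr; congr (_ + _); exact: mulrCA.
  have df := diff_derivable (smooth_from_exp_diff 0 sf) (v := u).
  have dg := diff_derivable (smooth_from_exp_diff 0 sg) (v := u).
  rewrite (_ : _ \o E = (f \o E) * (g \o E)); last exact/funext.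
  rewrite (@deriveM _ _ (f \o E) (g \o E) 0 u df dg) /= (hom_exp0 homE) mulrDr.
  congr (_ + _); first exact: mulrCA.
  by rewrite -mulrA; congr (_ * _); exact: mulrC.
- by move=> f sf; apply: smooth_fun_mul => //; exact: smooth_fun_cst.
- move=> k p f sf; rewrite /Ad irho.
  rewrite (_ : (fun x => f _) = f)//.
  by apply/funext => x; rewrite comK mulgA mulVg mul1g.
Qed.

Lemma exp_gauge_field (rho : M -> R) u p f :
  gauge_field act (fun p (h : K -> R) => rho p * 'D_u (h \o E) 0) p f =
  'D_1 (fun s : R => f (act (E ((s * rho p) *: u)) p)) 0.
Proof.
rewrite /gauge_field -derive1E; congr (derive1 _ 0); apply/funext => s.
rewrite -lie_exp_linear (_ : (fun h => s * _) = (fun h => s * rho p * 'D_u (h \o E) 0))//.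
by apply/funext => h; rewrite mulrA.
Qed.

Lemma exp_gauge_field_orbit (rho : M -> R) u x f : smooth_fun f -> rho (act (E x) m) = 1 ->
  gauge_field act (fun p (h : K -> R) => rho p * 'D_u (h \o E) 0) (act (E x) m) f =
  T (f \o act (E x)) (u *m Q).
Proof.
move=> sf rx; rewrite exp_gauge_field rx.
have /is_derive_line[_ <-] := orbit_par_derive x u sf.
rewrite (_ : (fun s : R => f (act (E ((s * 1) *: u)) _)) =
  (fun s : R => f (act (E (s *: u + x)) m)))//.
by apply/funext => s; have [_ _ actM] := act_smooth; rewrite mulr1 -actM -homE.
Qed.

End OrbitTorus.

(** * Proof of the stabilization theorem *)

Section Stabilize.
Variables (R : realType) (l n : nat) (K : lieGroupType R l) (M : manifoldType R n).
Variables (act : K -> M -> M) (X : M -> functional M) (m : M) (phi : R -> M) (d : nat).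
Hypotheses (K_torus : torus_group K) (act_smooth : smooth_action act)
  (X_field : vector_field X) (X_equivariant : equivariant act X)
  (m_releq : relative_equilibrium act X m) (phi_curve : integral_curve X m phi)
  (d_dim : torus_of_dim d (closure (range phi))).

Lemma stabilize_near j (U : set M) : (j <= d)%N ->
  open U -> group_orbit act m `<=` U ->
  exists psi : M -> functional K, [/\ gauge act psi, stabilizes act X m psi j
    & forall p, ~ U p -> tangent_eq (vf_add X (gauge_field act psi) p) (X p)].
Proof.
move=> jd oU mU; have [_ act1 actM] := act_smooth.
have [c Ac cm] := atlas_cover m.
have [E0 [homE0 sE0 surjE0 [N0 boxE0]]] := torus_exp K_torus.
have [E [homE sE derE surjE [N boxE]]] :=
  orbit_chart act_smooth homE0 sE0 surjE0 boxE0 Ac cm.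
have Qfree := orbit_frame_free act m E0 c.
(* From here on only the listed properties of the orbit chart matter, so its construction is
   forgotten. *)
move: (orbit_rank act m E0 c) E (orbit_frame act m E0 c)
  homE sE derE surjE boxE Qfree => r E Q homE sE derE surjE boxE Qfree.
have P0 : act (E 0) m = m := orbit_map0 m act_smooth homE.
have [u0 Xu0] : exists u, forall f, smooth_fun f -> X m f = chart_tangent m c f (u *m Q).
  have [g [sg og g0 vg]] := m_releq.
  have [u Hu] := tangent_orbit_frame K_torus act_smooth Ac cm homE sE derE surjE
    Qfree sg g0 og.
  by exists u => f sf; rewrite -Hu//; have [_ ->] := vg f sf.
have Xorb x f : smooth_fun f -> X (act (E x) m) f =
    chart_tangent m c (f \o act (E x)) (u0 *m Q).
  by move=> sf; rewrite X_equivariant// Xu0//; exact: action_smooth_map.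
have dPsi z t f : smooth_fun f -> is_derive t (1 : R) (fun s : R => f (act (E (s *: z)) m))
    (chart_tangent m c (f \o act (E (t *: z))) (z *m Q)).
  move=> sf.
  have := orbit_par_derive act_smooth homE sE derE (t *: z) z sf.
  move=> /is_derive_near_le H; apply: is_derive_near => e e0; have := H e e0.
  by apply: filterS => h; rewrite -scalerDl [h *: (1 : R)]mulr1.
(* By equivariance $X$ at $E(x)\cdot m$ is the translate of [u0 *m Q], so the explicit curve is
   integral for $X$. *)
have phiE : phi = fun t => act (E (t *: u0)) m.
  apply: (integral_curve_unique X_field phi_curve); split.
    by rewrite scale0r.
  by move=> t f sf; rewrite Xorb//; exact: dPsi.
have dr : (d <= r)%N.
  apply: (torus_dim_orbit K_torus act_smooth Ac cm homE sE derE surjE Qfree d_dim).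
  (* The orbit is compact, hence closed, and contains the closure of any curve in it. *)
  have /closure_id -> := orbit_closed (m := m) K_torus act_smooth.
  apply: closure_subset => _ [t _ <-]; rewrite phiE; by exists (E (t *: u0)).
have [z torz] := orbit_subtorus act_smooth Ac cm homE sE derE boxE Qfree
  (leq_trans jd dr).
have [rho [srho irho rhom rhoU]] := invariant_bump K_torus act_smooth oU mU.
pose psi : M -> functional K := fun p h => rho p * 'D_(z - u0) (h \o E) 0.
exists psi; split.
- exact: exp_gauge.
- exists (fun t => act (E (t *: z)) m) => //; split; first by rewrite scale0r.
  move=> t f sf; rewrite /vf_add Xorb//.
  rewrite (exp_gauge_field_orbit K_torus act_smooth homE sE derE)//; last first.
    by rewrite irho rhom.
  have sft := action_smooth_map act_smooth (E (t *: z)) sf.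
  (* [rho] equals 1 on the whole orbit by invariance, so the two directions add up to
     [u0 + (z - u0) = z] all along the curve. *)
  rewrite -(chart_tangentD Ac cm)// -mulmxDl addrC subrK.
  exact: dPsi.
- move=> p /rhoU rp f sf; rewrite /vf_add (exp_gauge_field act K_torus homE sE)//.
  rewrite (_ : (fun s => _) = cst (f p)) ?derive_cst ?addr0//.
  by apply/funext => s; rewrite rp mulr0 scale0r (hom_exp0 homE) act1.
Qed.

End Stabilize.

Theorem theorem3p10 (R : realType) (l n : nat)
    (K : lieGroupType R l) (M : manifoldType R n) (act : K -> M -> M)
    (X : M -> functional M) (m : M) (phi : R -> M) (d : nat)
    (K_torus : torus_group K)
    (act_smooth : smooth_action act)
    (X_field : vector_field X)
    (X_equivariant : equivariant act X)
    (m_releq : relative_equilibrium act X m)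
    (phi_curve : integral_curve X m phi)
    (d_dim : torus_of_dim d (closure (range phi))) :
  forall j : nat, (j <= d)%N ->
    (exists psi : M -> functional K,
        gauge act psi /\ stabilizes act X m psi j) /\
    (forall U : set M, open U -> group_orbit act m `<=` U ->
      exists psi : M -> functional K,
        [/\ gauge act psi,
            stabilizes act X m psi j
          & forall p, ~ U p ->
              tangent_eq (vf_add X (gauge_field act psi) p) (X p)]).
Proof.
move=> j jd; split=> [|U oU mU]; last exact: (stabilize_near _ _ X_field _ _ phi_curve d_dim).
(* Without a support condition, [U] is taken to be all of [M]. *)
have [psi [g s _]] := stabilize_near K_torus act_smooth X_field X_equivariant m_releq
  phi_curve d_dim jd openT (@subsetT _ _).
by exists psi.
Qed.
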